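(* For undirected Budgeted Middlebox Node Purchase (defined in the context) with a single source (all demand pairs have the same source vertex $s$), there is a deterministic polynomial time algorithm that produces a solution (purchased set of cost at most $k$ and feasible processed flow) routing at least $(1-1/e)/8\approx 0.078$ times the optimal objective value.
   Context: Undirected Budgeted Middlebox Node Purchase: input is an undirected graph $G=(V,E)$ with edge capacities $B:E\to\mathbb{R}^+$, nonnegative vertex costs $c_v$, potential processing capacities $C:V\to[0,\infty)$, demand pairs $(s_i,t_i)$ with demands $R_i>0$, and a budget $k$. A solution purchases a set $T\subseteq V$ with $\sum_{v\in T}c_v\le k$; only purchased vertices may process flow (vertex $v\in T$ may do at most $C(v)$ total processing), while flow may pass through any vertex. A processed flow assigns nonnegative amounts $p^v_{i,\pi}$ to triples (demand $i$, walk $\pi$ from $s_i$ to $t_i$ visiting each vertex at most twice, edges traversable in either direction, vertex $v\in\pi$): $p^v_{i,\pi}$ units of demand-$i$ flow are sent along $\pi$ and processed at $v$ (each unit of flow needs one unit of processing). It is feasible if each edge $e$ carries total flow (both directions combined) at most $B(e)$, each vertex $v$ does total processing at most $C(v)$ if $v\in T$ and $0$ otherwise, and the total demand-$i$ flow is at most $R_i$. The goal is to maximize the total amount of (processed) flow routed, $\sum_{i}\sum_{\pi,v}p^v_{i,\pi}$. *)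

(* Defs.v *)
From Corelib Require Import BinNums.
From mathcomp Require Import all_boot all_order all_algebra.
From mathcomp Require Import all_classical all_reals all_analysis.

Set Implicit Arguments.
Unset Strict Implicit.
Unset Printing Implicit Defensive.

Import Order.TTheory GRing.Theory Num.Theory.
Local Open Scope ring_scope.

(** The machine model is the WHILE language over binary trees (Jones,
  "Computability and Complexity from a Programming Perspective"), except that
  reading a variable is charged the size of the tree it contains instead of 1.
  With this charge every tree built during a run has size at most the time
  spent, so that running times agree with those of multitape Turing machines up
  to a polynomial. *)

Inductive tree := Leaf | Node of tree & tree.

Fixpoint tree_size (t : tree) : nat :=
  if t is Node l r then (tree_size l + tree_size r).+1 else 1%N.

Inductive expr :=
  | EVar of nat
  | ELeaf
  | ENode of expr & expr
  | ELeft of expr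
  | ERight of expr.

Inductive prog :=
  | Assign of nat & expr
  | Seq of prog & prog
  | If of expr & prog & prog
  | While of expr & prog.

Definition store := nat -> tree.

Definition update (s : store) (x : nat) (t : tree) : store :=
  fun y => if y == x then t else s y.

Definition left_of (t : tree) : tree := if t is Node l _ then l else Leaf.
Definition right_of (t : tree) : tree := if t is Node _ r then r else Leaf.

Fixpoint eval (s : store) (e : expr) : tree :=
  match e with
  | EVar x => s x
  | ELeaf => Leaf
  | ENode e1 e2 => Node (eval s e1) (eval s e2)
  | ELeft e1 => left_of (eval s e1)
  | ERight e1 => right_of (eval s e1)
  end.

Fixpoint eval_time (s : store) (e : expr) : nat :=
  match e with
  | EVar x => tree_size (s x)
  | ELeaf => 1%N
  | ENode e1 e2 => (eval_time s e1 + eval_time s e2).+1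
  | ELeft e1 | ERight e1 => (eval_time s e1).+1
  end.

Lemma tree_size_eval s e : (tree_size (eval s e) <= eval_time s e)%N.
Proof.
elim: e => //= [e1 IH1 e2 IH2|e IH|e IH]; first by rewrite ltnS leq_add.
- case: (eval s e) IH => //= l r IH.
  by rewrite ltnW // ltnS (leq_trans _ IH) // ltnW // ltnS leq_addr.
- case: (eval s e) IH => //= l r IH.
  by rewrite ltnW // ltnS (leq_trans _ IH) // ltnW // ltnS leq_addl.
Qed.

Definition truthy (t : tree) : bool := if t is Node _ _ then true else false.

(** [exec c s k s']: started in [s], [c] halts after time [k] in [s']. *)
Inductive exec : prog -> store -> nat -> store -> Prop :=
  | ExecAssign x e s :
      exec (Assign x e) s (eval_time s e).+1 (update s x (eval s e))
  | ExecSeq c1 c2 s s1 s2 k1 k2 :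
      exec c1 s k1 s1 -> exec c2 s1 k2 s2 ->
      exec (Seq c1 c2) s (k1 + k2).+1 s2
  | ExecIfTrue e c1 c2 s s1 k :
      truthy (eval s e) -> exec c1 s k s1 ->
      exec (If e c1 c2) s (eval_time s e + k).+1 s1
  | ExecIfFalse e c1 c2 s s1 k :
      ~~ truthy (eval s e) -> exec c2 s k s1 ->
      exec (If e c1 c2) s (eval_time s e + k).+1 s1
  | ExecWhileFalse e c s :
      ~~ truthy (eval s e) -> exec (While e c) s (eval_time s e).+1 s
  | ExecWhileTrue e c s s1 s2 k1 k2 :
      truthy (eval s e) -> exec c s k1 s1 -> exec (While e c) s1 k2 s2 ->
      exec (While e c) s (eval_time s e + k1 + k2).+1 s2.

Lemma exec_deterministic c s k1 s1 k2 s2 :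
  exec c s k1 s1 -> exec c s k2 s2 -> k1 = k2 /\ s1 = s2.
Proof.
move=> H; elim: H k2 s2 => {c s k1 s1}.
all: intros; match goal with H : exec _ _ ?k ?s |- _ = ?k /\ _ = ?s =>
  inversion H; subst; clear H end.
all: try match goal with
  A : is_true ?b, B : is_true (~~ ?b) |- _ => by rewrite A in B end.
all: repeat match goal with
  IH : forall k s', exec ?c ?s k s' -> _, H : exec ?c ?s _ _ |- _ =>
    have [? ?] := IH _ _ H; subst; clear H end.
all: by [].
Qed.

Definition input_store (t : tree) : store :=
  fun x => if x == 0%N then t else Leaf.

(** Some program, given (the encoding of) any [x] satisfying the promise [dom],
  halts within time polynomial in the input size and leaves in variable 0 the
  encoding of some [y] with [good x y]. *)
Definition polytime_solvable (X : Type) (Y : X -> Type)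
    (encX : X -> tree) (encY : forall x, Y x -> tree)
    (dom : X -> Prop) (good : forall x, Y x -> Prop) : Prop :=
  exists (c : prog) (q : {poly nat}), forall x : X, dom x ->
    exists (k : nat) (s : store) (y : Y x),
      [/\ exec c (input_store (encX x)) k s,
          (k <= q.[tree_size (encX x)])%N,
          s 0%N = encY x y
        & good x y].

Definition enc_bit (b : bool) : tree := if b then Node Leaf Leaf else Leaf.

(** Binary, least significant bit first. *)
Fixpoint enc_pos (p : positive) : tree :=
  match p with
  | xH => Node (enc_bit true) Leaf
  | xO p' => Node (enc_bit false) (enc_pos p')
  | xI p' => Node (enc_bit true) (enc_pos p')
  end.

Definition enc_nat (n : nat) : tree :=
  if bin_of_nat n is Npos p then enc_pos p else Leaf.

(** Only used for nonnegative rationals, whence no sign. *)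
Definition enc_rat (x : rat) : tree :=
  Node (enc_nat `|numq x|%N) (enc_nat `|denq x|%N).

Definition enc_seq (A : Type) (f : A -> tree) (s : seq A) : tree :=
  foldr (fun a t => Node (f a) t) Leaf s.

(** Vertices are ['I_nv], demands are ['I_nd], edges are two-element sets of
  vertices; [cap] is only meaningful on [edges]. The numbers are rational, as
  they have to be written down in the input. *)
Record instance := Instance {
  nv : nat;
  nd : nat;
  edges : {set {set 'I_nv}};
  cap : {set 'I_nv} -> rat;
  cost : 'I_nv -> rat;
  proc : 'I_nv -> rat;
  src : 'I_nd -> 'I_nv;
  dst : 'I_nd -> 'I_nv;
  dem : 'I_nd -> rat;
  budget : rat;
  edges_card2 : forall e, e \in edges -> #|e| = 2%N;
  cap_gt0 : forall e, e \in edges -> 0 < cap e;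
  cost_ge0 : forall v, 0 <= cost v;
  proc_ge0 : forall v, 0 <= proc v;
  dem_gt0 : forall i, 0 < dem i;
  budget_ge0 : 0 <= budget }.

Definition single_source (I : instance) : Prop :=
  exists s : 'I_(nv I), forall i : 'I_(nd I), src i = s.

Definition adj (I : instance) : rel 'I_(nv I) :=
  fun u v => [set u; v] \in edges I.

(** Walks are given by their vertex sequences. *)
Definition is_walk (I : instance) (i : 'I_(nd I)) (w : seq 'I_(nv I)) : bool :=
  if w is x :: w' then
    [&& x == src i, path (@adj I) x w', last x w' == dst i
      & [forall u, (count_mem u w <= 2)%N]]
  else false.

(** Number of traversals of [e], in either direction. *)
Definition traversals (I : instance) (e : {set 'I_(nv I)}) (w : seq 'I_(nv I))
    : nat :=
  count (fun uv => [set uv.1; uv.2] == e) (zip w (behead w)).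

(** Triples (demand, walk, processing vertex); visiting each vertex at most
  twice bounds the length of the vertex sequence by [2 * nv I]. *)
Definition triple (I : instance) : finType :=
  ('I_(nd I) * (2 * nv I).-bseq 'I_(nv I) * 'I_(nv I))%type.

Definition tdemand (I : instance) (t : triple I) : 'I_(nd I) := t.1.1.
Definition twalk (I : instance) (t : triple I) : seq 'I_(nv I) := t.1.2.
Definition tvertex (I : instance) (t : triple I) : 'I_(nv I) := t.2.

Definition valid_triple (I : instance) (t : triple I) : bool :=
  is_walk (tdemand t) (twalk t) && (tvertex t \in twalk t).

Definition affordable (I : instance) (T : {set 'I_(nv I)}) : Prop :=
  \sum_(v in T) cost v <= budget I.

Definition feasible (R : realType) (I : instance) (T : {set 'I_(nv I)})
    (p : {ffun triple I -> R}) : Prop :=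
  [/\ forall t, 0 <= p t,
      forall t, ~~ valid_triple t -> p t = 0,
      forall e, e \in edges I ->
        \sum_t p t *+ traversals e (twalk t) <= ratr (cap e),
      forall v, \sum_(t | tvertex t == v) p t
        <= (if v \in T then ratr (proc v) else 0)
    & forall i, \sum_(t | tdemand t == i) p t <= ratr (dem i)].

Definition is_solution (R : realType) (I : instance) (T : {set 'I_(nv I)})
    (p : {ffun triple I -> R}) : Prop :=
  affordable T /\ feasible T p.

Definition routed (R : realType) (I : instance) (p : {ffun triple I -> R}) : R :=
  \sum_t p t.

Definition opt_value (R : realType) (I : instance) : \bar R :=
  ereal_sup [set x | exists (T : {set 'I_(nv I)}) (p : {ffun triple I -> R}),
                       is_solution T p /\ x = (routed p)%:E].

(** The graph is given by its adjacency matrix, a missing edge being [Leaf]. *)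
Definition enc_instance (I : instance) : tree :=
  Node (enc_seq (fun u => enc_seq (fun v =>
          if adj u v then enc_rat (cap [set u; v]) else Leaf)
          (enum 'I_(nv I))) (enum 'I_(nv I)))
 (Node (enc_seq (fun v => Node (enc_rat (cost v)) (enc_rat (proc v)))
          (enum 'I_(nv I)))
 (Node (enc_seq (fun i => Node (enc_nat (src i))
                         (Node (enc_nat (dst i)) (enc_rat (dem i))))
          (enum 'I_(nd I)))
       (enc_rat (budget I)))).

(** Purchased vertices, and the flow as a sparse list of triples with amounts;
  an amount is a fraction (numerator, denominator), not necessarily reduced,
  and triples that are not listed have amount 0. *)
Definition output (I : instance) : Type :=
  (seq 'I_(nv I) * seq (triple I * (nat * nat)))%type.

Definition enc_vertex (I : instance) (v : 'I_(nv I)) : tree := enc_nat v.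

Definition enc_output (I : instance) (o : output I) : tree :=
  Node (enc_seq (@enc_vertex I) o.1)
       (enc_seq (fun x : triple I * (nat * nat) =>
          Node (enc_nat (tdemand x.1))
         (Node (enc_seq (@enc_vertex I) (twalk x.1))
         (Node (enc_vertex (tvertex x.1))
         (Node (enc_nat x.2.1) (enc_nat x.2.2))))) o.2).

Definition out_set (I : instance) (o : output I) : {set 'I_(nv I)} :=
  [set v in o.1].

Definition out_flow (R : realType) (I : instance) (o : output I)
    : {ffun triple I -> R} :=
  [ffun t => \sum_(x <- o.2 | x.1 == t) x.2.1%:R / x.2.2%:R].

Definition out_wf (I : instance) (o : output I) : Prop :=
  all (fun x : triple I * (nat * nat) => 0 < x.2.2)%N o.2.

(* Main.v *)
(* Let [F T] be the value of a maximum flow from the common source [s] into the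
   purchased set [T], each [v] in [T] absorbing at most [C v], and let [D] be
   the value of a maximum flow from [s] to the destinations, ignoring
   processing. Cutting the walks of a solution shows that the optimum is at most
   [min (F O) D], where [O] is the optimal purchase.

   By min-cut duality and uncrossing of cuts, [F] is monotone and submodular.
   Greedily purchasing the vertex of largest marginal gain per cost, up to the
   first vertex that does not fit, and taking the better of the purchased set
   and that single vertex, yields an affordable [T] with [F T >= F O / 4].

   As edges are undirected, unit [s]-[v] and [s]-[t] paths combine into the walk
   [s]-[v]-[s]-[t], which uses each edge at most twice for the first and once
   for the second path. Erasing the loops of its part from [v] to [t], each
   vertex is visited at most twice. Pairing all paths of the two flows in
   proportion and scaling by 1/3 gives a feasible flow of value
   [min (F T) D / 3], at least 1/12 of the optimum, and
   [(1 - 1/e) / 8 <= 1/12] as [e <= 3].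

   Maximum flows are computed on integers, after clearing denominators, by
   capacity scaling. *)

Require Import Defs.
From mathcomp Require Import all_boot all_order all_algebra.
From mathcomp Require Import all_classical all_reals all_analysis.
From mathcomp Require Import zify ring lra.
Import Order.TTheory GRing.Theory Num.Theory.
Import Defs.

Set Implicit Arguments.
Unset Strict Implicit.
Unset Printing Implicit Defensive.

Local Open Scope nat_scope.

(** * Polynomial-time functions *)

Class encodable (A : Type) := enc : A -> tree.
#[global] Instance encodable_nat : encodable nat := enc_nat.
#[global] Instance encodable_bool : encodable bool := enc_bit.
#[global] Instance encodable_pair A B `{encodable A} `{encodable B} :
  encodable (A * B) := fun p => Node (enc p.1) (enc p.2).
#[global] Instance encodable_seq A `{encodable A} : encodable (seq A) :=
  enc_seq enc.

(** * Polynomial bounds on encoded sizes *)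

Definition esize A `{encodable A} (a : A) : nat := tree_size (enc a).

Lemma tree_size_gt0 t : 0 < tree_size t.
Proof. by case: t. Qed.

Lemma esize_gt0 A `{encodable A} (a : A) : 0 < esize a.
Proof. exact: tree_size_gt0. Qed.

(** A normal form for polynomial bounds: encodings have positive size, so the base is at least 2 and
    a larger exponent absorbs constants, sums and products. *)
Definition pbound A `{encodable A} (h : A -> nat) : Prop :=
  exists d, forall a, h a <= (esize a).+1 ^ d.

Section PBound.
Context {A : Type} {eA : encodable A}.
Implicit Types h : A -> nat.

Lemma pbound_le h h' : pbound h' -> (forall a, h a <= h' a) -> pbound h.
Proof. by move=> [d hd] le; exists d => a; apply: leq_trans (le a) (hd a). Qed.

Lemma pboundM h h' : pbound h -> pbound h' -> pbound (fun a => h a * h' a).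
Proof.
by move=> [d hd] [d' hd']; exists (d + d') => a; rewrite expnD leq_mul.
Qed.

Lemma pbound_cst c : pbound (fun _ : A => c).
Proof.
exists c => a; apply: (leq_trans (ltnW (ltn_expl c (ltnSn 1)))).
by case: c => // c; rewrite leq_exp2r // ltnS esize_gt0.
Qed.

Lemma pboundD h h' : pbound h -> pbound h' -> pbound (fun a => h a + h' a).
Proof.
move=> ph ph'.
have := pboundM (pbound_cst 2)
  (pboundM (_ : pbound (fun a => (h a).+1)) (_ : pbound (fun a => (h' a).+1))).
have S1 g : pbound g -> pbound (fun a : A => (g a).+1).
  move=> [d hd]; exists d.+1 => a; rewrite expnS.
  apply: (@leq_trans (2 * (esize a).+1 ^ d)); last by rewrite leq_mul2r ltnS esize_gt0 orbT.
  by rewrite mul2n -addnn; apply: leq_ltn_trans (hd a) _; rewrite -addn1 leq_add2l expn_gt0.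
move=> /(_ (S1 _ ph) (S1 _ ph')) H; apply: pbound_le H _ => a; nia.
Qed.

Lemma pboundS h : pbound h -> pbound (fun a => (h a).+1).
Proof. by move=> ph; apply: pbound_le (pboundD ph (pbound_cst 1)) _ => a; rewrite addn1. Qed.

Lemma pboundX h d : pbound h -> pbound (fun a => h a ^ d).
Proof.
by move=> [e he]; exists (e * d) => a; rewrite expnM; case: d => // d; rewrite leq_exp2r.
Qed.

Lemma pbound_esize : pbound (fun a : A => esize a).
Proof. by exists 1 => a; rewrite expn1. Qed.

End PBound.

Lemma pbound_comp A B `{encodable A} `{encodable B} (f : A -> B) (h : B -> nat) :
  pbound (fun a => esize (f a)) -> pbound h -> pbound (fun a => h (f a)).
Proof.
move=> pf [d hd]; apply: pbound_le (pboundX d (pboundS pf)) _ => a; exact: hd.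
Qed.

Ltac pbound_tac := cbv beta; lazymatch goal with
  | |- pbound (fun a => @?h a + @?h' a) => apply: (@pboundD _ _ h h'); pbound_tac
  | |- pbound (fun a => @?h a * @?h' a) => apply: (@pboundM _ _ h h'); pbound_tac
  | |- pbound (fun a => S (@?h a)) => first [exact: pbound_cst | apply: (@pboundS _ _ h); pbound_tac]
  | |- pbound (fun a => (@?h a) ^ ?n) => apply: (@pboundX _ _ h n); pbound_tac
  | |- pbound (fun a => esize a) => exact: pbound_esize
  | |- _ => first [exact: pbound_cst | done | idtac]
  end.

(** * Timed execution and closure under composition *)

Definition runs (c : prog) (s : store) (n : nat) (Q : store -> Prop) : Prop :=
  exists k s', [/\ exec c s k s', k <= n & Q s'].

Lemma runs_assign x e s n (Q : store -> Prop) :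
  eval_time s e < n -> Q (update s x (eval s e)) -> runs (Assign x e) s n Q.
Proof.
by move=> le q; exists (eval_time s e).+1, (update s x (eval s e)); split=> //; apply: ExecAssign.
Qed.

Lemma runs_seq c1 c2 s n1 n2 n (Q : store -> Prop) :
  runs c1 s n1 (fun s1 => runs c2 s1 n2 Q) -> n1 + n2 < n ->
  runs (Seq c1 c2) s n Q.
Proof.
move=> [k1 [s1 [x1 le1 [k2 [s2 [x2 le2 q]]]]]] le.
exists (k1 + k2).+1, s2; split=> //; first exact: ExecSeq x1 x2.
by apply: leq_ltn_trans le; apply: leq_add.
Qed.

Lemma runs_mono c s n n' (Q Q' : store -> Prop) :
  runs c s n Q -> n <= n' -> (forall s', Q s' -> Q' s') -> runs c s n' Q'.
Proof.
move=> [k [s1 [x le q]]] len i; exists k, s1; split=> //; last exact: i.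
exact: leq_trans le len.
Qed.

(** Here the charge for reading variables pays off: a time bound is also a bound on the size of the
    output. Composition depends on it, as the second program is timed on the output of the first. *)
Lemma tree_size_exec c s k s' x :
  exec c s k s' -> tree_size (s' x) <= maxn (tree_size (s x)) k.
Proof.
move=> ex; elim: ex x => {c s k s'}.
- move=> x e s y; rewrite /update; case: eqP => _; last exact: leq_maxl.
  by rewrite leq_max orbC (leqW (tree_size_eval s e)).
all: intros; rewrite ?leq_maxl //.
- by have := H0 x; have := H2 x; lia.
- by have := H1 x; lia.
- by have := H1 x; lia.
- by have := H1 x; have := H3 x; lia.
Qed.

(* The other variables may hold garbage initially, and those from [m] on are
   left untouched, so that programs can be composed. *)
Definition polytime A B `{encodable A} `{encodable B} (f : A -> B) : Prop :=
  exists c m h, pbound h /\ forall s a, s 0 = enc a ->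
    runs c s (h a) (fun s' => s' 0 = enc (f a) /\ forall y, m <= y -> s' y = s y).

Section Closure.
Context {A B C : Type} {eA : encodable A} {eB : encodable B} {eC : encodable C}.

Lemma pbound_polytime (f : A -> B) : polytime f -> pbound (fun a => esize (f a)).
Proof.
move=> [c [m [h [ph H]]]]; apply: pbound_le (pboundD (@pbound_esize A _) ph) _ => a.
have [k [s' [ex le [s0 _]]]] := H (fun=> enc a) a erefl.
have := tree_size_exec 0 ex; rewrite s0 /esize /=; lia.
Qed.

(** Only encodings matter, so a function may be traded for one with values in another type. This is
    how numbers are read as lists of digits, and data as bare trees. *)
Lemma polytime_enc (f : A -> B) (g : A -> C) :
  (forall a, enc (f a) = enc (g a)) -> polytime f -> polytime g.
Proof.
move=> e [c [m [h [ph H]]]]; exists c, m, h; split=> // s a sa.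
by apply: runs_mono (H s a sa) _ _ => // s' [-> ?]; rewrite e.
Qed.

Lemma polytime_expr (f : A -> B) e h : pbound h ->
  (forall s a, s 0 = enc a -> eval s e = enc (f a) /\ eval_time s e <= h a) ->
  polytime f.
Proof.
move=> ph H; exists (Assign 0 e), 1, (fun a => (h a).+1); split; first exact: pboundS.
move=> s a sa; have [ev le] := H s a sa; apply: runs_assign => //.
by rewrite /update eqxx; split=> // -[].
Qed.

Lemma polytime_comp (f : A -> B) (g : B -> C) :
  polytime f -> polytime g -> polytime (fun a => g (f a)).
Proof.
move=> pf [c2 [m2 [h2 [ph2 H2]]]]; have := pf; move=> [c1 [m1 [h1 [ph1 H1]]]].
exists (Seq c1 c2), (maxn m1 m2), (fun a => (h1 a + h2 (f a)).+1); split.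
  by apply/pboundS/pboundD => //; apply: pbound_comp => //; apply: pbound_polytime.
move=> s a sa; apply: runs_seq (ltnSn _).
apply: runs_mono (H1 s a sa) (leqnn _) _ => s1 [s1a s1m].
apply: runs_mono (H2 s1 _ s1a) (leqnn _) _ => s2 [s2a s2m]; split=> // y.
by rewrite geq_max => /andP[l1 l2]; rewrite s2m ?s1m.
Qed.

End Closure.

Lemma polytime_ext A B `{encodable A} `{encodable B} (f g : A -> B) :
  f =1 g -> polytime f -> polytime g.
Proof. by move=> e; apply: polytime_enc => a; rewrite e. Qed.

Lemma polytime_id A `{encodable A} : polytime (fun a : A => a).
Proof. by apply: (@polytime_expr _ _ _ _ _ (EVar 0) (fun a => esize a)) (@pbound_esize A _) _ => s a /= ->. Qed.

Section Closure2.
Context {A B C : Type} {eA : encodable A} {eB : encodable B} {eC : encodable C}.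

Lemma polytime_fst (f : A -> B * C) : polytime f -> polytime (fun a => (f a).1).
Proof.
move=> pf; apply: polytime_comp pf _.
apply: (@polytime_expr _ _ _ _ _ (ELeft (EVar 0)) (fun a => (esize a).+1)).
  exact/pboundS/pbound_esize.
by move=> s a /= ->.
Qed.

Lemma polytime_snd (f : A -> B * C) : polytime f -> polytime (fun a => (f a).2).
Proof.
move=> pf; apply: polytime_comp pf _.
apply: (@polytime_expr _ _ _ _ _ (ERight (EVar 0)) (fun a => (esize a).+1)).
  exact/pboundS/pbound_esize.
by move=> s a /= ->.
Qed.

Lemma polytime_cst (b : B) : polytime (fun _ : A => b).
Proof.
pose fix e t := if t is Node l r then ENode (e l) (e r) else ELeaf.
apply: (@polytime_expr _ _ _ _ _ (e (enc b)) (fun=> esize b)); first exact: pbound_cst.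
move=> s a _; rewrite /esize; elim: (enc b) => //= l [-> lel] r [-> ler].
by split=> //; rewrite ltnS leq_add.
Qed.

Lemma polytime_pair (f : A -> B) (g : A -> C) :
  polytime f -> polytime g -> polytime (fun a => (f a, g a)).
Proof.
move=> pf pg; have := pg; have := pf.
move=> [c1 [m1 [h1 [ph1 H1]]]] [c2 [m2 [h2 [ph2 H2]]]].
(* The variables [m] and [m.+1] lie beyond the reach of both programs; they keep the input and the
   first result. *)
pose m := (maxn m1 m2).+1.
exists (Seq (Assign m (EVar 0)) (Seq c1 (Seq (Assign m.+1 (EVar 0))
  (Seq (Assign 0 (EVar m)) (Seq c2 (Assign 0 (ENode (EVar m.+1) (EVar 0)))))))).
exists m.+2, (fun a => 20 + 3 * esize a + h1 a + h2 a + 2 * esize (f a) + esize (g a)).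
split.
  have := pbound_polytime pf; have := pbound_polytime pg => pbg pbf.
  by pbound_tac.
move=> s a sa; have ea : tree_size (s 0) = esize a by rewrite sa.
apply: (@runs_seq _ _ _ (esize a).+1 (18 + 2 * esize a + h1 a + h2 a + 2 * esize (f a) + esize (g a))); last lia.
apply: runs_assign; rewrite /= ?ea //; set s1 := update _ _ _.
have s1a : s1 0 = enc a by rewrite /s1 /update.
apply: (@runs_seq _ _ _ (h1 a) (17 + 2 * esize a + h2 a + 2 * esize (f a) + esize (g a))); last lia.
apply: runs_mono (H1 s1 a s1a) (leqnn _) _ => s2 [s2a s2m].
have s2m' : s2 m = enc a by rewrite s2m /s1 /update ?eqxx // /m; lia.
apply: (@runs_seq _ _ _ (esize (f a)).+1 (15 + 2 * esize a + h2 a + esize (f a) + esize (g a))); last lia.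
apply: runs_assign; rewrite /= ?s2a //; set s3 := update _ _ _.
apply: (@runs_seq _ _ _ (esize a).+1 (13 + esize a + h2 a + esize (f a) + esize (g a))); last lia.
have s3m : s3 m = enc a by rewrite /s3 /update ltn_eqF.
apply: runs_assign; rewrite /= ?s3m //; set s4 := update _ _ _.
have s4a : s4 0 = enc a by rewrite /s4 /update.
apply: (@runs_seq _ _ _ (h2 a) (3 + esize (f a) + esize (g a))); last lia.
apply: runs_mono (H2 s4 a s4a) (leqnn _) _ => s5 [s5a s5m].
have s5f : s5 m.+1 = enc (f a) by rewrite s5m /s4 /s3 /update /= ?eqxx // /m; lia.
apply: runs_assign; first by rewrite /= s5f s5a /esize; lia.
rewrite /update /= s5f s5a; split=> // y ly.
rewrite gtn_eqF ?(leq_ltn_trans _ ly) // s5m; last by rewrite /m in ly; lia.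
rewrite /s4 /s3 /update gtn_eqF ?(leq_ltn_trans _ ly) // gtn_eqF //.
rewrite s2m; last by rewrite /m in ly; lia.
by rewrite /s1 /update gtn_eqF // ltnW.
Qed.

End Closure2.

Lemma polytime_if A B (eA : encodable A) (eB : encodable B) (b : A -> bool) (f g : A -> B) :
  polytime b -> polytime f -> polytime g ->
  polytime (fun a => if b a then f a else g a).
Proof.
move=> pb pf pg; have := pg; have := pf; have := polytime_pair (@polytime_id A _) pb.
move=> [c0 [m0 [h0 [ph0 H0]]]] [c1 [m1 [h1 [ph1 H1]]]] [c2 [m2 [h2 [ph2 H2]]]].
(* The test is computed in a pair with a copy of the input, which the chosen branch then
   restores. *)
exists (Seq c0 (If (ERight (EVar 0)) (Seq (Assign 0 (ELeft (EVar 0))) c1)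
  (Seq (Assign 0 (ELeft (EVar 0))) c2))), (maxn m0 (maxn m1 m2)).+1.
exists (fun a => 20 + h0 a + 2 * esize (a, b a) + h1 a + h2 a); split.
  have pab := pbound_polytime (polytime_pair (@polytime_id A _) pb).
  by pbound_tac.
move=> s a sa.
apply: (@runs_seq _ _ _ (h0 a) (19 + 2 * esize (a, b a) + h1 a + h2 a)); last lia.
apply: runs_mono (H0 s a sa) (leqnn _) _ => s1 [s1a s1m].
have et : eval_time s1 (ERight (EVar 0)) = (esize (a, b a)).+1 by rewrite /= s1a.
have ev : truthy (eval s1 (ERight (EVar 0))) = b a by rewrite /= s1a /=; case: (b a).
have s2a : update s1 0 (eval s1 (ELeft (EVar 0))) 0 = enc a by rewrite /update /= s1a.
case: ifP => ba.
  have [k [s3 [x3 le3 [r3 fr3]]]] : runs (Seq (Assign 0 (ELeft (EVar 0))) c1) s1 (5 + esize (a, b a) + h1 a)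
     (fun s' => s' 0 = enc (f a) /\ forall y : nat, (maxn m0 (maxn m1 m2)).+1 <= y -> s' y = s y).
    apply: (@runs_seq _ _ _ (esize (a, b a)).+2 (h1 a)); last lia.
    apply: runs_assign; first by rewrite /= s1a.
    apply: runs_mono (H1 _ a s2a) (leqnn _) _ => s3 [-> s3m]; split=> // y ly.
    by rewrite s3m /update ?gtn_eqF ?s1m //; lia.
  exists (eval_time s1 (ERight (EVar 0)) + k).+1, s3; split=> //.
    by apply: ExecIfTrue => //; rewrite ev.
  by rewrite et; lia.
have [k [s3 [x3 le3 [r3 fr3]]]] : runs (Seq (Assign 0 (ELeft (EVar 0))) c2) s1 (5 + esize (a, b a) + h2 a)
   (fun s' => s' 0 = enc (g a) /\ forall y : nat, (maxn m0 (maxn m1 m2)).+1 <= y -> s' y = s y).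
  apply: (@runs_seq _ _ _ (esize (a, b a)).+2 (h2 a)); last lia.
  apply: runs_assign; first by rewrite /= s1a.
  apply: runs_mono (H2 _ a s2a) (leqnn _) _ => s3 [-> s3m]; split=> // y ly.
  by rewrite s3m /update ?gtn_eqF ?s1m //; lia.
exists (eval_time s1 (ERight (EVar 0)) + k).+1, s3; split=> //.
  by apply: ExecIfFalse => //; rewrite ev ba.
by rewrite et; lia.
Qed.


Lemma esize_pair A B `{encodable A} `{encodable B} (a : A) (b : B) :
  esize (a, b) = (esize a + esize b).+1.
Proof. by []. Qed.

Lemma esize_cons A `{encodable A} (a : A) l : esize (a :: l) = (esize a + esize l).+1.
Proof. by []. Qed.

Lemma esize_seq A `{encodable A} (l : seq A) :
  esize l = (\sum_(x <- l) (esize x).+1).+1.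
Proof.
by elim: l => [|x l IH]; rewrite ?big_nil // big_cons esize_cons IH; lia.
Qed.

Lemma size_le_esize A `{encodable A} (l : seq A) : size l <= esize l.
Proof. by elim: l => // x l IH; rewrite esize_cons /=; lia. Qed.

Lemma esize_mem A `{encodable A} (l l1 l2 : seq A) x :
  l = l1 ++ x :: l2 -> esize x <= esize l.
Proof. by move->; elim: l1 => [|y l1 IH]; rewrite ?cat_cons esize_cons; lia. Qed.

(** * Folds over lists *)

Section Fold.
Context {A S X : Type} {eA : encodable A} {eS : encodable S} {eX : encodable X}.

(** The single use of [While]. The bound [b] on the accumulators of all prefixes cannot be derived
    from the step: repeated squaring takes polynomial time per step and exponential time in
    total. *)
Lemma polytime_foldl (step : A -> S -> X -> S) (init : A -> S) (l : A -> seq X)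
    (b : A -> nat) :
  polytime (fun p : A * (S * X) => step p.1 p.2.1 p.2.2) ->
  polytime init -> polytime l -> pbound b ->
  (forall a l1 l2, l a = l1 ++ l2 -> esize (foldl (step a) (init a) l1) <= b a) ->
  polytime (fun a => foldl (step a) (init a) (l a)).
Proof.
move=> [c1 [m1 [h1 [[d ph1] H1]]]] pinit pl pb bnd.
have := polytime_pair (@polytime_id A _) (polytime_pair pinit pl).
move=> pal; have := pal; move=> [c0 [m0 [h0 [ph0 H0]]]].
pose m := (maxn m0 m1).+1.
pose e := ERight (ERight (EVar m)).
pose body := Seq (Assign 0 (ENode (ELeft (EVar m)) (ENode (ELeft (ERight (EVar m))) (ELeft e))))
  (Seq c1 (Assign m (ENode (ELeft (EVar m)) (ENode (EVar 0) (ERight e))))).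
exists (Seq c0 (Seq (Assign m (EVar 0)) (Seq (While e body) (Assign 0 (ELeft (ERight (EVar m))))))), m.+1.
(* [q a] bounds the contents of variable [m], and [T a] the time of one turn: the power pays for the
   step, the multiple of [q a] for the test and for moving data around it. *)
pose (q := fun a : A => esize a + b a + esize (l a) + 30).
pose (T := fun a : A => 10 * q a + (q a).+1 ^ d).
have pq : pbound q.
  apply: pboundD; last exact: pbound_cst.
  by apply: pboundD (pbound_polytime pl); apply: pboundD pb; exact: pbound_esize.
exists (fun a : A => 20 + h0 a + (10 * q a) + (esize (l a)) * T a); split.
  have pT : pbound T.
    by apply: pboundD; [apply: pboundM pq; exact: pbound_cst|apply/pboundX/pboundS].
  pbound_tac; exact: (pbound_polytime pl).
move=> s a sa.
apply: (@runs_seq _ _ _ (h0 a) (19 + (10 * q a) + (esize (l a)) * T a)); last lia.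
apply: runs_mono (H0 s a sa) (leqnn _) _ => s1 [s1a s1m].
have e0 : esize (a, (init a, l a)) <= q a.
  rewrite !esize_pair /q; have := bnd a [::] (l a) erefl; rewrite /= => ?; lia.
apply: (@runs_seq _ _ _ (q a).+1 (15 + (9 * q a) + (esize (l a)) * T a)); last lia.
apply: runs_assign; first by rewrite /= s1a ltnS.
set s2 := update _ _ _.
have s2m y : m <= y -> s2 y = if y == m then enc (a, (init a, l a)) else s y.
  by move=> ly; rewrite /s2 /update /= s1a; case: eqP => // _; rewrite s1m //; move: ly; rewrite /m; lia.
apply: (@runs_seq _ _ _ (5 + 2 * q a + (esize (l a)) * T a) (3 + q a)); last lia.
have : runs (While e body) s2 (5 + q a + esize (l a) * T a)
   (fun s' => forall y, m <= y -> s' y =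
          if y == m then enc (a, (foldl (step a) (init a) (l a), [::] : seq X)) else s y).
  (* Variable [m] holds the parameter, the accumulator and the unread list. The remaining time is
     charged to the encoded size of that list, which is more than its length. *)
  enough (loop : forall l2 l1 s3, esize l2 <= esize (l a) ->
      (forall y, m <= y -> s3 y = if y == m then enc (a, (foldl (step a) (init a) l1, l2)) else s y) ->
      l a = l1 ++ l2 ->
      runs (While e body) s3 (5 + q a + esize l2 * T a)
       (fun s' => forall y, m <= y -> s' y =
          if y == m then enc (a, (foldl (step a) (init a) (l a), [::] : seq X)) else s y)).
    exact: (loop (l a) [::] s2).
  move: s2 s2m => _ _; elim => [|x l2 IH] l1 s2 esl s2m la.
    have e1 : eval_time s2 e <= q a + 2.
      rewrite /= s2m // eqxx; have := bnd a l1 [::] la.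
      rewrite -[tree_size _]/(esize (a, (foldl (step a) (init a) l1, [::] : seq X))) !esize_pair.
      by rewrite /q; have := esize_gt0 (l a); rewrite [esize [::]]/=; lia.
    exists (eval_time s2 e).+1, s2; split; last by move=> y ly; rewrite s2m // la cats0.
      by apply: ExecWhileFalse; rewrite /= s2m ?eqxx.
    by move: e1; lia.
  have bl1 := bnd a l1 _ la.
  have bl2 : esize (foldl (step a) (init a) (rcons l1 x)) <= b a.
    by apply: (bnd a _ l2); rewrite cat_rcons.
  rewrite esize_cons in esl.
  set t1 := foldl _ _ l1 in s2m bl1.
  have t1x : foldl (step a) (init a) (rcons l1 x) = step a t1 x by rewrite foldl_rcons.
  rewrite t1x in bl2.
  have es2 : tree_size (s2 m) = (esize a + (esize t1 + (esize x + esize l2).+1).+1).+1.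
    by rewrite s2m // eqxx.
  have le2 : tree_size (s2 m) <= q a by rewrite es2 /q; lia.
  have : runs body s2 (T a - q a - 3) (fun s3 => forall y, m <= y ->
      s3 y = if y == m then enc (a, (step a t1 x, l2)) else s y).
    have T1 : T a >= 10 * q a + h1 (a, (t1, x)).
      rewrite /T leq_add2l; apply: leq_trans (ph1 _) _; case: (d) => // d'; rewrite leq_exp2r // ltnS.
      rewrite !esize_pair /q; lia.
    have q10 : 30 <= q a by rewrite /q; lia.
    apply: (@runs_seq _ _ _ (3 * q a + 10) (h1 (a, (t1,x)) + 3 * q a + 20)); last lia.
    apply: runs_assign; first by rewrite /=; lia.
    rewrite [eval _ _]/= s2m // eqxx /=.
    set s3 := update _ _ _.
    have s3a : s3 0 = enc (a, (t1, x)) by rewrite /s3 /update.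
    apply: (@runs_seq _ _ _ (h1 (a, (t1,x))) (3 * q a + 15)); last lia.
    apply: runs_mono (H1 s3 _ s3a) (leqnn _) _ => s4 [s4a s4m].
    have s4e y : m <= y -> s4 y = s2 y.
      move=> ly; rewrite s4m /s3 /update ?gtn_eqF //; last by move: ly; rewrite /m; lia.
      exact: leq_ltn_trans ly.
    apply: runs_assign.
      rewrite /= (s4e m) // s4a; have : tree_size (enc (step a t1 x)) <= b a := bl2.
      move: le2; rewrite /q /=; lia.
    move=> y ly; rewrite /update /= (s4e m) // s4a s2m // eqxx; case: eqP => // /eqP ym.
    by rewrite s4e // s2m // (negbTE ym).
  move=> [k [s3 [x3 le3 s3m]]].
  have [] := IH (rcons l1 x) s3.
  - lia.
  - by move=> y ly; rewrite s3m // t1x.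
  - by rewrite cat_rcons.
  move=> k' [s4 [x4 le4 s4m]].
  exists (eval_time s2 e + k + k').+1, s4; split.
  - by apply: ExecWhileTrue x4 => //; rewrite /= s2m // eqxx.
  - rewrite [eval_time _ _]/= ; rewrite esize_cons.
    have q10 : 30 <= q a by rewrite /q; lia.
    have : T a >= 10 * q a by rewrite /T; lia.
    have -> : (esize x + esize l2).+1 * T a = esize x * T a + esize l2 * T a + T a by lia.
    lia.
  - by move=> y ly; rewrite s4m // t1x.
move=> h; apply: runs_mono h _ _; first lia.
move=> s3 s3m; have bf := bnd a (l a) [::] (esym (cats0 _)).
apply: runs_assign.
  rewrite /= s3m // eqxx; move: bf; rewrite /q /esize /=; lia.
rewrite /= s3m // eqxx /update /=; split=> // y ly.
rewrite gtn_eqF ?(leq_ltn_trans _ ly) // s3m ?gtn_eqF //; exact: ltnW.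
Qed.
End Fold.

Section FoldBounds.
Context {A S X : Type} {eA : encodable A} {eS : encodable S} {eX : encodable X}.

(** Growth by a summand per step stays polynomial, as there are at most [esize (l a)] steps. The
    bound is only required for elements no larger than the list, since these are the ones met. *)
Lemma polytime_foldl_add (step : A -> S -> X -> S) (init : A -> S)
    (l : A -> seq X) (g : A -> nat) :
  polytime (fun p : A * (S * X) => step p.1 p.2.1 p.2.2) ->
  polytime init -> polytime l -> pbound g ->
  (forall a s x, esize x <= esize (l a) -> esize (step a s x) <= esize s + g a) ->
  polytime (fun a => foldl (step a) (init a) (l a)).
Proof.
move=> ps pi pl pg H.
apply: (@polytime_foldl _ _ _ _ _ _ step init l
  (fun a => esize (init a) + esize (l a) * g a)) => //.
  by pbound_tac; exact: pbound_polytime.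
move=> a l1 l2 E.
have el l3 : esize l3 <= esize (l1 ++ l3) by elim: (l1) => // x l4; rewrite cat_cons esize_cons; lia.
enough (h : esize (foldl (step a) (init a) l1) <= esize (init a) + size l1 * g a).
  apply: leq_trans h _; rewrite leq_add2l leq_mul2r; apply/orP; right.
  by pose proof (size_le_esize (l a)) as h1; move: h1; rewrite {1}E size_cat; lia.
elim/last_ind: l1 l2 E {el} => [|l1 x IH] l2 E; first by rewrite mul0n addn0.
rewrite foldl_rcons size_rcons mulSn; rewrite cat_rcons in E.
have := H a (foldl (step a) (init a) l1) x (esize_mem E).
by have := IH _ E; lia.
Qed.

Lemma pbound_elem (h : A * X -> nat) (l : A -> seq X) :
  pbound h -> polytime l ->
  exists2 g : A -> nat, pbound g & forall a x, esize x <= esize (l a) -> h (a, x) <= g a.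
Proof.
move=> [d hd] pl; exists (fun a => (esize a + esize (l a) + 2) ^ d).
  by pbound_tac; exact: pbound_polytime.
move=> a x le; apply: leq_trans (hd _) _; case: (d) => // d'.
by rewrite leq_exp2r // esize_pair; lia.
Qed.

End FoldBounds.

(** * Tests and list operations *)

#[global] Instance encodable_tree : encodable tree := id.

Section Trees.
Context {A X : Type} {eA : encodable A} {eX : encodable X}.

Lemma polytime_tree (f : A -> X) : polytime f -> polytime (fun a => enc (f a) : tree).
Proof. exact: polytime_enc. Qed.

Lemma polytime_left (f : A -> tree) : polytime f -> polytime (fun a => left_of (f a)).
Proof.
move=> pf; apply: polytime_comp pf _.
apply: (@polytime_expr _ _ _ _ _ (ELeft (EVar 0)) (fun a => (esize a).+1)).
  exact/pboundS/pbound_esize.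
by move=> s a /= ->.
Qed.

Lemma polytime_right (f : A -> tree) : polytime f -> polytime (fun a => right_of (f a)).
Proof.
move=> pf; apply: polytime_comp pf _.
apply: (@polytime_expr _ _ _ _ _ (ERight (EVar 0)) (fun a => (esize a).+1)).
  exact/pboundS/pbound_esize.
by move=> s a /= ->.
Qed.

Lemma polytime_truthy (f : A -> tree) : polytime f -> polytime (fun a => truthy (f a)).
Proof.
move=> pf; apply: polytime_comp pf _.
exists (If (EVar 0) (Assign 0 (ENode ELeaf ELeaf)) (Assign 0 ELeaf)), 1.
exists (fun t => esize t + 10); split; first by pbound_tac.
move=> s t st.
have [k [s1 [x le [v fr]]]] : runs (Assign 0 (if truthy t then ENode ELeaf ELeaf else ELeaf)) s 6
   (fun s' => s' 0 = enc (truthy t) /\ forall y, 0 < y -> s' y = s y).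
  apply: runs_assign; first by case: (truthy t).
  by rewrite /update /=; split; [case: (truthy t)|case].
exists (eval_time s (EVar 0) + k).+1, s1; split=> //; last by rewrite /= st /esize /enc /encodable_tree /=; lia.
by case E: (truthy t) x => x; [apply: ExecIfTrue|apply: ExecIfFalse]; rewrite //= st /enc /= /encodable_tree ?E.
Qed.

End Trees.

Section Lists.
Context {A X : Type} {eA : encodable A} {eX : encodable X}.

Lemma polytime_nilp (l : A -> seq X) : polytime l -> polytime (fun a => nilp (l a)).
Proof.
move=> pl; apply: (@polytime_ext _ _ _ _ (fun a => if truthy (enc (l a)) then false else true)).
  by move=> a; case: (l a).
apply: polytime_if; [exact/polytime_truthy/polytime_tree|exact: polytime_cst|exact: polytime_cst].
Qed.

Lemma polytime_head (d : A -> X) (l : A -> seq X) :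
  polytime d -> polytime l -> polytime (fun a => head (d a) (l a)).
Proof.
move=> pd pl.
apply: (@polytime_enc _ _ _ _ _ _ (fun a => if nilp (l a) then enc (d a) else left_of (enc (l a)))).
  by move=> a; case: (l a).
by apply: polytime_if; [exact: polytime_nilp|exact: polytime_tree|exact/polytime_left/polytime_tree].
Qed.

Lemma polytime_behead (l : A -> seq X) : polytime l -> polytime (fun a => behead (l a)).
Proof.
move=> pl; apply: (@polytime_enc _ _ _ _ _ _ (fun a => right_of (enc (l a)))).
  by move=> a; case: (l a).
exact/polytime_right/polytime_tree.
Qed.

Lemma polytime_cons (x : A -> X) (l : A -> seq X) :
  polytime x -> polytime l -> polytime (fun a => x a :: l a).
Proof. by move=> px pl; apply: polytime_enc (polytime_pair px pl). Qed.

Lemma polytime_andb (b c : A -> bool) : polytime b -> polytime c -> polytime (fun a => b a && c a).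
Proof. by move=> pb pc; apply: polytime_if => //; exact: polytime_cst. Qed.

Lemma polytime_orb (b c : A -> bool) : polytime b -> polytime c -> polytime (fun a => b a || c a).
Proof. by move=> pb pc; apply: polytime_if => //; exact: polytime_cst. Qed.

Lemma polytime_negb (b : A -> bool) : polytime b -> polytime (fun a => ~~ b a).
Proof. by move=> pb; exact: (polytime_if pb (polytime_cst false) (polytime_cst true)). Qed.

Lemma polytime_addb (b c : A -> bool) : polytime b -> polytime c -> polytime (fun a => b a (+) c a).
Proof. by move=> pb pc; apply: polytime_ext (polytime_if pb (polytime_negb pc) pc) => a; case: (b a). Qed.

End Lists.

Lemma polytime_comp1 A B C (eA : encodable A) (eB : encodable B) (eC : encodable C)
    (f : B -> C) (b : A -> B) :
  polytime f -> polytime b -> polytime (fun a => f (b a)).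
Proof. by move=> pf pb; exact: polytime_comp pb pf. Qed.

Lemma polytime_comp2 A B C D (eA : encodable A) (eB : encodable B) (eC : encodable C)
    (eD : encodable D) (f : B -> C -> D) (b : A -> B) (c : A -> C) :
  polytime (fun p => f p.1 p.2) -> polytime b -> polytime c ->
  polytime (fun a => f (b a) (c a)).
Proof. by move=> pf pb pc; apply: polytime_comp (polytime_pair pb pc) pf. Qed.

Lemma polytime_comp3 A B C D E (eA : encodable A) (eB : encodable B) (eC : encodable C)
    (eD : encodable D) (eE : encodable E) (f : B -> C -> D -> E) (b : A -> B) (c : A -> C) (d : A -> D) :
  polytime (fun p : B * (C * D) => f p.1 p.2.1 p.2.2) -> polytime b -> polytime c -> polytime d ->
  polytime (fun a => f (b a) (c a) (d a)).
Proof. by move=> pf pb pc pd; apply: polytime_comp (polytime_pair pb (polytime_pair pc pd)) pf. Qed.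

(* Proof search for polynomial-time functions *)
Create HintDb polytime.
#[global] Hint Constants Opaque : polytime.
#[global] Hint Variables Opaque : polytime.
#[global] Hint Resolve polytime_id : polytime.
#[global] Hint Resolve polytime_cst : polytime.
#[global] Hint Resolve polytime_fst polytime_snd polytime_pair polytime_if polytime_tree
  polytime_left polytime_right polytime_truthy polytime_nilp polytime_head polytime_behead
  polytime_cons polytime_andb polytime_orb polytime_negb polytime_addb : polytime.

Ltac pt := cbv beta; solve [eauto 100 with polytime nocore].

Lemma foldl_cons_rev T (l acc : seq T) : foldl (fun s x => x :: s) acc l = rev l ++ acc.
Proof. by elim: l acc => //= x l IH acc; rewrite IH rev_cons cat_rcons. Qed.

Section Lists2.
Context {A X : Type} {eA : encodable A} {eX : encodable X}.

Lemma polytime_rev (l : A -> seq X) : polytime l -> polytime (fun a => rev (l a)).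
Proof.
move=> pl; apply: (@polytime_ext _ _ _ _ (fun a => foldl (fun s x => x :: s) [::] (l a))).
  by move=> a; rewrite foldl_cons_rev cats0.
apply: (@polytime_foldl_add _ _ _ _ _ _ (fun _ s x => x :: s) (fun=> [::]) l
  (fun a => esize (l a) + 1)) => //; [pt|pt|by pbound_tac; exact: pbound_polytime|].
by move=> a s x le; rewrite esize_cons; lia.
Qed.

Lemma esize_rev (l : seq X) : esize (rev l) = esize l.
Proof.
rewrite !esize_seq; congr _.+1; elim: l => // x l IH.
by rewrite rev_cons -cats1 big_cat big_seq1 big_cons IH /=; lia.
Qed.
End Lists2.

Section Foldr.
Context {A X S : Type} {eA : encodable A} {eX : encodable X} {eS : encodable S}.

Lemma polytime_foldr_add (step : A -> X -> S -> S) (init : A -> S)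
    (l : A -> seq X) (g : A -> nat) :
  polytime (fun p : A * (S * X) => step p.1 p.2.2 p.2.1) ->
  polytime init -> polytime l -> pbound g ->
  (forall a s x, esize x <= esize (l a) -> esize (step a x s) <= esize s + g a) ->
  polytime (fun a => foldr (step a) (init a) (l a)).
Proof.
move=> ps pi pl pg H.
apply: (@polytime_ext _ _ _ _ (fun a => foldl (fun s x => step a x s) (init a) (rev (l a)))).
  by move=> a; rewrite foldl_rev.
apply: (@polytime_foldl_add _ _ _ _ _ _ (fun a s x => step a x s) init (fun a => rev (l a)) g) => //.
  exact: polytime_rev.
by move=> a s x; rewrite esize_rev; exact: H.
Qed.

End Foldr.

Section Lists3.
Context {A X Y : Type} {eA : encodable A} {eX : encodable X} {eY : encodable Y}.

Lemma polytime_map (f : A -> X -> Y) (l : A -> seq X) :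
  polytime (fun p : A * X => f p.1 p.2) -> polytime l ->
  polytime (fun a => [seq f a x | x <- l a]).
Proof.
move=> pf pl; have [g pg gP] := pbound_elem (pbound_polytime pf) pl.
apply: (@polytime_foldr_add _ _ _ _ _ _ (fun a x s => f a x :: s) (fun=> [::]) l (fun a => (g a).+1)) => //.
- by apply: polytime_cons; [apply: (polytime_comp2 pf); pt|pt].
- pt.
- by pbound_tac.
- by move=> a s x le; rewrite esize_cons; have := gP a x le; rewrite /=; lia.
Qed.

Lemma polytime_filter (f : A -> X -> bool) (l : A -> seq X) :
  polytime (fun p : A * X => f p.1 p.2) -> polytime l ->
  polytime (fun a => [seq x <- l a | f a x]).
Proof.
move=> pf pl.
apply: (@polytime_ext _ _ _ _ (fun a => foldr (fun x s => if f a x then x :: s else s) [::] (l a))).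
  by move=> a; elim: (l a) => //= x s ->.
apply: (@polytime_foldr_add _ _ _ _ _ _ (fun a x s => if f a x then x :: s else s)
   (fun=> [::]) l (fun a => (esize (l a)).+1)) => //.
- by apply: polytime_if; [apply: (polytime_comp2 pf); pt|pt|pt].
- pt.
- by pbound_tac; exact: pbound_polytime.
- by move=> a s x le; case: ifP; rewrite ?esize_cons; lia.
Qed.

Lemma polytime_has (f : A -> X -> bool) (l : A -> seq X) :
  polytime (fun p : A * X => f p.1 p.2) -> polytime l ->
  polytime (fun a => has (f a) (l a)).
Proof.
move=> pf pl.
apply: (@polytime_ext _ _ _ _ (fun a => ~~ nilp [seq x <- l a | f a x])).
  by move=> a /=; rewrite /nilp size_filter has_count lt0n.
exact/polytime_negb/polytime_nilp/polytime_filter.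
Qed.

Lemma polytime_cat (l1 l2 : A -> seq X) : polytime l1 -> polytime l2 ->
  polytime (fun a => l1 a ++ l2 a).
Proof.
move=> p1 p2.
apply: (@polytime_ext _ _ _ _ (fun a => foldr (fun x s => x :: s) (l2 a) (l1 a))).
  by move=> a; elim: (l1 a) => //= x s ->.
apply: (@polytime_foldr_add _ _ _ _ _ _ (fun _ x s => x :: s) l2 l1 (fun a => (esize (l1 a)).+1)) => //.
- pt.
- by pbound_tac; exact: pbound_polytime.
- by move=> a s x le; rewrite esize_cons; lia.
Qed.

Lemma polytime_zip (y0 : Y) (l1 : A -> seq X) (l2 : A -> seq Y) : polytime l1 -> polytime l2 ->
  polytime (fun a => zip (l1 a) (l2 a)).
Proof.
move=> p1 p2.
pose step (s : seq Y * seq (X * Y)) x :=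
  if nilp s.1 then s else (behead s.1, (x, head y0 s.1) :: s.2).
apply: (@polytime_ext _ _ _ _ (fun a => rev (foldl step (l2 a, [::]) (l1 a)).2)).
  move=> a.
  enough (H : forall acc, rev (foldl step (l2 a, acc) (l1 a)).2 = rev acc ++ zip (l1 a) (l2 a)) by (by rewrite H).
  elim: (l1 a) (l2 a) => [|x l IH] [|y l'] acc //=; rewrite ?cats0 //.
    by have -> : foldl step ([::], acc) l = ([::], acc) by elim: l {IH}.
  by rewrite IH rev_cons cat_rcons.
apply: polytime_rev; apply: polytime_snd.
apply: (@polytime_foldl_add _ _ _ _ _ _ (fun _ => step) (fun a => (l2 a, [::])) l1
  (fun a => 3 + esize (l1 a))) => //.
- rewrite /step; pt.
- pt.
- by pbound_tac; exact: pbound_polytime.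
- move=> a [s o] x le; rewrite /step /=; case: s => [|y s] /=; rewrite ?esize_pair ?esize_cons ?esize_pair; lia.
Qed.

End Lists3.

Lemma polytime_flatten A X (eA : encodable A) (eX : encodable X) (l : A -> seq (seq X)) :
  polytime l -> polytime (fun a => flatten (l a)).
Proof.
move=> pl.
have es (s t : seq X) : esize (s ++ t) <= esize s + esize t.
  by elim: s => [|x s IH]; rewrite ?cat0s ?cat_cons ?esize_cons; lia.
apply: (@polytime_foldr_add _ _ _ _ _ _ (fun _ x s => x ++ s) (fun=> [::]) l (fun a => (esize (l a)))) => //.
- by apply: polytime_cat; pt.
- pt.
- by pbound_tac; exact: pbound_polytime.
- by move=> a s x le; have := es x s; lia.
Qed.

#[global] Hint Resolve polytime_rev polytime_map polytime_filter polytime_has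
  polytime_cat polytime_flatten : polytime.

(** * Binary arithmetic *)

(** As the least significant digit comes first, parity and halving are the two projections of the
    encoding; all arithmetic below is built on them. *)
Lemma enc_natE (n : nat) : enc n = if n == 0 then Leaf else Node (enc (odd n)) (enc n./2).
Proof.
rewrite -(bin_of_natK n); move: (bin_of_nat n) => [//|p].
have E q : enc (nat_of_bin (BinNums.Npos q)) = enc_pos q by rewrite /enc /encodable_nat /enc_nat nat_of_binK.
have p0 q : 0 < nat_of_pos q by elim: q => //= q IH; rewrite NatTrec.doubleE ?double_gt0.
rewrite (gtn_eqF (p0 p : 0 < nat_of_bin (BinNums.Npos p))) E.
case: p => [q|q|//] /=; rewrite NatTrec.doubleE ?oddS odd_double /= ?uphalf_double ?doubleK.
all: by rewrite -(E q).
Qed.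

Lemma half_ind (P : nat -> Prop) :
  P 0 -> (forall n, 0 < n -> P n./2 -> P n) -> forall n, P n.
Proof.
move=> P0 PS n; elim: {n}(n.+1) {-2}n (leqnn n.+1) => // k IH [|n] // le.
by apply: PS => //; apply: IH; lia.
Qed.

Lemma esize_natE (n : nat) : esize n = if n == 0 then 1 else 2 + 2 * odd n + esize n./2.
Proof.
rewrite {1}/esize enc_natE; case: eqP => // _; rewrite /= -[tree_size (enc _./2)]/(esize n./2).
by case: (odd n) => /=; lia.
Qed.

Lemma esize_nat_gt0 (n : nat) : 0 < esize n.
Proof. exact: esize_gt0. Qed.

Lemma esize_nat0 : esize 0 = 1.
Proof. by []. Qed.

(** Size is not monotone, because a digit 1 costs 4 and a digit 0 only 2: [esize 7] is 13 and
    [esize 8] is 11. This accounts for the factor 2. *)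
Lemma esize_nat_leq (m n : nat) : m <= n -> esize m <= 2 * esize n.
Proof.
elim/half_ind: n m => [|n n0 IH] m; first by rewrite leqn0 => /eqP->; lia.
case: (posnP m) => [->|m0] le; first by have := esize_nat_gt0 n; rewrite esize_nat0; lia.
rewrite esize_natE [esize n]esize_natE !gtn_eqF // ?(leq_trans m0).
have := IH m./2; rewrite half_leq // => /(_ isT); case: (odd m); case: (odd n); lia.
Qed.

Lemma esize_half (n : nat) : esize n./2 <= esize n.
Proof. by rewrite [esize n]esize_natE; case: eqP => [->//|_]; lia. Qed.

(** The carry is treated as a third summand. The two digits 1 that create it cost 8 and pay for the
    resulting digit 0 and for the carry, 2 + 5. Having no additive constant, the bound extends to
    sums over lists. *)
Lemma esize_addn (m n : nat) : esize (m + n) <= esize m + esize n.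
Proof.
move: {2}(m + n) (leqnn (m + n)) => k.
elim: k m n => [|k IH] m n.
  by rewrite leqn0 addn_eq0 => /andP[/eqP-> /eqP->].
case: (posnP m) => [->|m0]; first by rewrite add0n; lia.
case: (posnP n) => [->|n0]; first by rewrite addn0; lia.
move=> le; rewrite esize_natE [esize m]esize_natE [esize n]esize_natE.
rewrite !gtn_eqF ?addn_gt0 ?m0 //.
have mE := odd_double_half m; have nE := odd_double_half n.
have hE : (m + n)./2 = m./2 + (n./2 + (odd m && odd n)).
  by rewrite halfD addnC -addnA.
rewrite hE oddD.
have h1 : esize (m./2 + (n./2 + (odd m && odd n))) <= esize m./2 + esize (n./2 + (odd m && odd n)).
  by apply: IH; move: (odd m) (odd n) mE nE => [] [] /=; lia.
have h2 : esize (n./2 + (odd m && odd n)) <= esize n./2 + esize (nat_of_bool (odd m && odd n)).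
  by apply: IH; move: (odd m) (odd n) mE nE => [] [] /=; lia.
have e1 : esize (nat_of_bool true) = 5 by [].
have e0 : esize (nat_of_bool false) = 1 by [].
have := esize_nat_gt0 n./2.
move: (odd m) (odd n) h1 h2 {hE mE nE} => [] [] /=; rewrite ?e1 ?e0 ?addn0; lia.
Qed.

Section Bits.
Context {A : Type} {eA : encodable A}.

Lemma polytime_odd (n : A -> nat) : polytime n -> polytime (fun a => odd (n a)).
Proof.
move=> pn; apply: (@polytime_enc _ _ _ _ _ _ (fun a => left_of (enc (n a)))); last pt.
by move=> a; rewrite enc_natE; case: eqP => // ->.
Qed.

Lemma polytime_half (n : A -> nat) : polytime n -> polytime (fun a => (n a)./2).
Proof.
move=> pn; apply: (@polytime_enc _ _ _ _ _ _ (fun a => right_of (enc (n a)))); last pt.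
by move=> a; rewrite enc_natE; case: eqP => // ->.
Qed.

Lemma polytime_eq0 (n : A -> nat) : polytime n -> polytime (fun a => n a == 0).
Proof.
move=> pn; apply: (@polytime_ext _ _ _ _ (fun a => ~~ truthy (enc (n a)))); last pt.
by move=> a; rewrite enc_natE; case: eqP.
Qed.

Definition bdouble (b : bool) (n : nat) : nat := b + n.*2.

(** Encodings have no leading zeros, so putting a digit 0 below the number 0 must not create a
    node. *)
Lemma enc_bdouble b n : enc (bdouble b n) = if b || (n != 0) then enc (b, n) else Leaf.
Proof.
rewrite enc_natE /bdouble oddD odd_double addbF oddb halfD odd_double andbF add0n doubleK.
by case: b => /=; rewrite ?add0n ?double_eq0 //; case: eqP.
Qed.

Lemma polytime_bdouble (b : A -> bool) (n : A -> nat) :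
  polytime b -> polytime n -> polytime (fun a => bdouble (b a) (n a)).
Proof.
move=> pb pn.
apply: (@polytime_enc _ _ _ _ _ _ (fun a =>
  if b a || ~~ (n a == 0) then enc (b a, n a) else Leaf)).
  by move=> a; rewrite enc_bdouble.
have := polytime_eq0 pn; pt.
Qed.

Lemma esize_bdouble b n : esize (bdouble b n) <= esize n + 4.
Proof.
have -> : esize (bdouble b n) = if b || (n != 0) then esize (b, n) else 1.
  by rewrite {1}/esize enc_bdouble; case: ifP.
have eb : esize b <= 3 by case: b.
by rewrite esize_pair; case: ifP => _; lia.
Qed.

End Bits.

Fixpoint pos_bits (p : BinNums.positive) : seq bool :=
  match p with
  | BinNums.xH => [:: true]
  | BinNums.xO q => false :: pos_bits q
  | BinNums.xI q => true :: pos_bits q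
  end.

Definition bits (n : nat) : seq bool :=
  if bin_of_nat n is BinNums.Npos p then pos_bits p else [::].

(** A number and its list of digits are the same tree, hence numbers can be folded over without
    conversion. *)
Lemma enc_bits n : enc (bits n) = enc n.
Proof.
rewrite /enc /encodable_seq /encodable_nat /enc_nat /bits; case: (bin_of_nat n) => // p.
by elim: p => //= p ->.
Qed.

Lemma enc_bits_inj (l l' : seq bool) : enc l = enc l' -> l = l'.
Proof.
elim: l l' => [|b l IH] [|b' l'] //= [e1 e2]; rewrite (IH _ e2).
by case: b b' e1 => [] [].
Qed.

Lemma bitsE n : bits n = if n == 0 then [::] else odd n :: bits n./2.
Proof.
apply: enc_bits_inj; rewrite enc_bits enc_natE; case: eqP => // _.
by rewrite -(enc_bits n./2).
Qed.

Lemma polytime_bits A (eA : encodable A) (n : A -> nat) : polytime n -> polytime (fun a => bits (n a)).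
Proof. by apply: polytime_enc => a; rewrite enc_bits. Qed.

Lemma esize_bits n : esize (bits n) = esize n.
Proof. by rewrite /esize enc_bits. Qed.

Lemma size_bits_half n : size (bits n./2) = (size (bits n)).-1.
Proof. by rewrite [bits n]bitsE; case: eqP => [->|]. Qed.

Lemma size_bits_eq0 n : size (bits n) = 0 -> n = 0.
Proof. by rewrite bitsE; case: eqP. Qed.

#[global] Hint Resolve polytime_odd polytime_half polytime_eq0 polytime_bdouble polytime_bits : polytime.

(** Puts the digits, most significant first, below those of the initial number, which may be a final
    carry. *)
Definition of_bits : nat -> seq bool -> nat := foldl (fun n b => bdouble b n).

Lemma polytime_of_bits A (eA : encodable A) (n : A -> nat) (l : A -> seq bool) :
  polytime n -> polytime l -> polytime (fun a => of_bits (n a) (l a)).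
Proof.
move=> pn pl; apply: (@polytime_foldl_add _ _ _ _ _ _ (fun _ n b => bdouble b n) n l (fun=> 4)) => //.
- pt.
- exact: pbound_cst.
- by move=> a s x _; exact: esize_bdouble.
Qed.
#[global] Hint Resolve polytime_of_bits : polytime.

(* The state of the serial adder and subtractor: the unread parts of both
   arguments, the carry, and the digits produced, most significant first. *)
Definition serial_step (carry : bool -> bool -> bool -> bool)
    (st : nat * (nat * (bool * seq bool))) (_ : bool) :=
  let a := st.1 in let b := st.2.1 in let c := st.2.2.1 in
  (a./2, (b./2, (carry (odd a) (odd b) c, (odd a (+) odd b (+) c) :: st.2.2.2))).

(** The concatenated digits serve only as a clock that is long enough for both arguments; their
    values are ignored. *)
Definition serial carry (a b : nat) : bool * seq bool :=
  (foldl (serial_step carry) (a, (b, (false, [::]))) (bits a ++ bits b)).2.2.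

Lemma polytime_serial carry A (eA : encodable A) (m n : A -> nat) :
  polytime (fun p : bool * (bool * bool) => carry p.1 p.2.1 p.2.2) ->
  polytime m -> polytime n -> polytime (fun a => serial carry (m a) (n a)).
Proof.
move=> pc pm pn; do 2 apply: polytime_snd.
apply: (@polytime_foldl_add _ _ _ _ _ _ (fun _ => serial_step carry)
  (fun a => (m a, (n a, (false, [::])))) (fun a => bits (m a) ++ bits (n a)) (fun=> 10)) => //.
- rewrite /serial_step; do 2 (apply: polytime_pair; first pt).
  by apply: polytime_pair; [apply: (polytime_comp3 pc); pt|pt].
- pt.
- pt.
- exact: pbound_cst.
- move=> a [k [k' [c o]]] x _; rewrite /serial_step /= !esize_pair esize_cons.
  have eb (b : bool) : 1 <= esize b <= 3 by case: b.
  have := esize_half k; have := esize_half k'.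
  by move: (eb (carry (odd k) (odd k') c)) (eb c) (eb (odd k (+) odd k' (+) c)); lia.
Qed.

Definition maj (a b c : bool) := if a then b || c else b && c.

Lemma serial_addn m n : let r := serial maj m n in of_bits r.1 r.2 = m + n.
Proof.
(* Invariant: the sum of the unread parts and the carry, with the digits produced so far put below
   it, does not change. *)
suff H : forall l a b (c : bool) o, size (bits a) <= size l -> size (bits b) <= size l ->
  let r := (foldl (serial_step maj) (a, (b, (c, o))) l).2.2 in
  of_bits r.1 r.2 = of_bits (a + b + c) o.
  by rewrite /= H ?addn0 // size_cat ?leq_addl ?leq_addr.
elim=> [|x l IH] a b c o /=.
  by rewrite !leqn0 => /eqP/size_bits_eq0-> /eqP/size_bits_eq0->; rewrite !add0n.
move=> la lb; rewrite IH /= ?size_bits_half; try lia.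
rewrite /of_bits /= /bdouble; congr foldl.
have := odd_double_half a; have := odd_double_half b.
by case: (odd a) (odd b) c => [] [] [] /=; lia.
Qed.

Definition borrow (a b c : bool) := if a then b && c else b || c.

(** One pass yields both the comparison, as the final borrow, and the difference. *)
Lemma serial_subn m n : let r := serial borrow m n in
  r.1 = (m < n) /\ (n <= m -> of_bits 0 r.2 = m - n).
Proof.
suff H : forall l a b (c : bool) o, size (bits a) <= size l -> size (bits b) <= size l ->
  let r := (foldl (serial_step borrow) (a, (b, (c, o))) l).2.2 in
  r.1 = (a < b + c) /\ (b + c <= a -> of_bits 0 r.2 = of_bits (a - (b + c)) o).
  have := H (bits m ++ bits n) m n false [::]; rewrite addn0 size_cat leq_addr leq_addl.
  by apply.
elim=> [|x l IH] a b c o /=.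
  rewrite !leqn0 => /eqP/size_bits_eq0-> /eqP/size_bits_eq0->; rewrite !add0n.
  by case: c.
move=> la lb.
have [] := IH a./2 b./2 (borrow (odd a) (odd b) c) ((odd a (+) odd b (+) c) :: o).
- by rewrite /= size_bits_half; lia.
- by rewrite /= size_bits_half; lia.
have := odd_double_half a; have := odd_double_half b.
rewrite /serial_step /= => ha hb -> h2; split.
  by case: (odd a) (odd b) c ha hb {h2} => [] [] [] /=; lia.
move=> le; rewrite h2.
  rewrite /of_bits /= /bdouble; congr foldl.
  by case: (odd a) (odd b) c ha hb le {h2} => [] [] [] /=; lia.
by case: (odd a) (odd b) c ha hb le {h2} => [] [] [] /=; lia.
Qed.

Section Arith.
Context {A : Type} {eA : encodable A}.
Implicit Types m n : A -> nat.

Lemma polytime_addn m n : polytime m -> polytime n -> polytime (fun a => m a + n a).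
Proof.
move=> pm pn.
apply: (@polytime_ext _ _ _ _ (fun a =>
  of_bits (bdouble (serial maj (m a) (n a)).1 0) (serial maj (m a) (n a)).2)).
  by move=> a; rewrite -serial_addn /bdouble addn0.
have : polytime (fun a => serial maj (m a) (n a)) by apply: polytime_serial => //; rewrite /maj; pt.
pt.
Qed.

Lemma polytime_leq m n : polytime m -> polytime n -> polytime (fun a => m a <= n a).
Proof.
move=> pm pn.
apply: (@polytime_ext _ _ _ _ (fun a => ~~ (serial borrow (n a) (m a)).1)).
  by move=> a; rewrite (serial_subn _ _).1 -leqNgt.
have : polytime (fun a => serial borrow (n a) (m a)) by apply: polytime_serial => //; rewrite /borrow; pt.
pt.
Qed.

Lemma polytime_subn m n : polytime m -> polytime n -> polytime (fun a => m a - n a).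
Proof.
move=> pm pn.
apply: (@polytime_ext _ _ _ _ (fun a => if n a <= m a then of_bits 0 (serial borrow (m a) (n a)).2 else 0)).
  move=> a; case: leqP => le; first by rewrite (serial_subn _ _).2.
  by apply/esym/eqP; rewrite subn_eq0 ltnW.
have := polytime_leq pn pm.
have : polytime (fun a => serial borrow (m a) (n a)) by apply: polytime_serial => //; rewrite /borrow; pt.
pt.
Qed.

End Arith.
#[global] Hint Resolve polytime_addn polytime_leq polytime_subn : polytime.

Lemma polytime_muln A (eA : encodable A) (m n : A -> nat) :
  polytime m -> polytime n -> polytime (fun a => m a * n a).
Proof.
move=> pm pn.
(* Horner's scheme in base 2; the right fold meets the most significant digit first. *)
pose step k (b : bool) s := (if b then k else 0) + bdouble false s.
apply: (@polytime_ext _ _ _ _ (fun a => foldr (step (n a)) 0 (bits (m a)))).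
  move=> a; elim/half_ind: (m a) => [//|k k0 IH].
  rewrite bitsE gtn_eqF //= IH /step /bdouble; have := odd_double_half k; case: (odd k) => /=; nia.
apply: (@polytime_foldr_add _ _ _ _ _ _ (fun a => step (n a)) (fun=> 0)
  (fun a => bits (m a)) (fun a => 5 + esize (n a))).
- by rewrite /step; apply: polytime_addn; [|pt]; apply: polytime_if; [pt| |pt]; apply: polytime_comp pn; pt.
- pt.
- pt.
- by pbound_tac; exact: pbound_polytime.
move=> a s b _; rewrite /step.
have := esize_addn (if b then n a else 0) (bdouble false s); have := esize_bdouble false s.
by case: b => /=; rewrite ?esize_nat0; lia.
Qed.
#[global] Hint Resolve polytime_muln : polytime.

Lemma polytime_ltn A (eA : encodable A) (m n : A -> nat) :
  polytime m -> polytime n -> polytime (fun a => m a < n a).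
Proof.
move=> pm pn; apply: (@polytime_ext _ _ _ _ (fun a => ~~ (n a <= m a))); last pt.
by move=> a; rewrite ltnNge.
Qed.

Lemma polytime_eqn A (eA : encodable A) (m n : A -> nat) :
  polytime m -> polytime n -> polytime (fun a => m a == n a).
Proof.
move=> pm pn; apply: (@polytime_ext _ _ _ _ (fun a => (m a <= n a) && (n a <= m a))); last pt.
by move=> a; rewrite eqn_leq.
Qed.
#[global] Hint Resolve polytime_ltn polytime_eqn : polytime.

Lemma polytime_divn A (eA : encodable A) (m n : A -> nat) :
  polytime m -> polytime n -> polytime (fun a => m a %/ n a).
Proof.
move=> pm pn.
(* Long division. Replacing the divisor 0 by 1 keeps the remainder below the divisor, so that the
   fold is bounded for this input as well, although its result is then discarded. *)
pose dd (k : nat) : nat := if k == 0 then 1 else k.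
pose step d (b : bool) (s : nat * nat) :=
  if d <= bdouble b s.2 then (bdouble true s.1, bdouble b s.2 - d)
  else (bdouble false s.1, bdouble b s.2).
have stepE d k : 0 < d -> foldr (step d) (0, 0) (bits k) = (k %/ d, k %% d).
  move=> d0; elim/half_ind: k => [|k k0 IH]; first by rewrite div0n mod0n.
  rewrite bitsE gtn_eqF //= IH /step /= /bdouble.
  have kE : k = odd k + (k./2 %/ d * d + k./2 %% d).*2 by rewrite -divn_eq odd_double_half.
  have lt : k./2 %% d < d by rewrite ltn_mod.
  move: (k./2 %/ d) (k./2 %% d) kE lt => q r; move: (odd k) => b kE lt.
  rewrite kE; case: leqP => le.
    have -> : b + (q * d + r).*2 = (true + q.*2) * d + (b + r.*2 - d) by case: b kE le => /=; lia.
    by rewrite divnMDl // modnMDl divn_small ?modn_small ?addn0 //; case: b kE le => /=; lia.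
  have -> : b + (q * d + r).*2 = (false + q.*2) * d + (b + r.*2) by case: b kE le => /=; lia.
  by rewrite divnMDl // modnMDl divn_small ?modn_small ?addn0.
apply: (@polytime_ext _ _ _ _ (fun a => if n a == 0 then 0 else (foldr (step (dd (n a))) (0, 0) (bits (m a))).1)).
  move=> a; case: eqP => [->|/eqP n0]; first by rewrite divn0.
  by rewrite stepE /dd (negbTE n0) // lt0n.
apply: polytime_if; [pt|pt|]; apply: polytime_fst.
apply: (@polytime_ext _ _ _ _ (fun a => foldl (fun s b => step (dd (n a)) b s) (0,0) (rev (bits (m a))))).
  by move=> a; rewrite foldl_rev.
apply: (@polytime_foldl _ _ _ _ _ _ (fun a s b => step (dd (n a)) b s) (fun=> (0, 0)) (fun a => rev (bits (m a)))
  (fun a => 3 + 4 * esize (m a) + 2 * (5 + esize (n a)))).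
- have pn1 : polytime (fun p : A * (nat * nat * bool) => n p.1) by apply: polytime_comp pn; pt.
  rewrite /step /dd; pt.
- pt.
- pt.
- by pbound_tac; exact: pbound_polytime.
move=> a l1 l2 E.
have d0 : 0 < dd (n a) by rewrite /dd; case: (n a).
have : let s := foldl (fun s b => step (dd (n a)) b s) (0, 0) l1 in
   s.2 < dd (n a) /\ esize s.1 <= 1 + 4 * size l1.
  elim/last_ind: l1 {l2 E} => [|l x IH] //=; rewrite foldl_rcons size_rcons.
  move: (foldl _ _ l) IH => [q r] /= [lt es]; rewrite /step /=.
  have := esize_bdouble true q; have := esize_bdouble false q.
  have : bdouble x r <= 2 * r + 1 by rewrite /bdouble; case: x => /=; lia.
  by case: (leqP (dd (n a)) (bdouble x r)) => le /=; split; lia.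
case: (foldl _ _ l1) => q r /= [lt es]; rewrite esize_pair.
have := esize_nat_leq (ltnW lt).
have : size l1 <= esize (m a).
  have : size (rev (bits (m a))) <= esize (rev (bits (m a))) by exact: size_le_esize.
  by rewrite {1}E size_cat esize_rev esize_bits; lia.
have : esize (dd (n a)) <= 5 + esize (n a) by rewrite /dd; case: eqP => _; [rewrite (_ : esize 1 = 5) //|]; lia.
lia.
Qed.
#[global] Hint Resolve polytime_divn : polytime.

Lemma polytime_comp4 A B C D E F (eA : encodable A) (eB : encodable B) (eC : encodable C)
    (eD : encodable D) (eE : encodable E) (eF : encodable F) (f : B -> C -> D -> E -> F)
    (b : A -> B) (c : A -> C) (d : A -> D) (e : A -> E) :
  polytime (fun p : B * (C * (D * E)) => f p.1 p.2.1 p.2.2.1 p.2.2.2) ->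
  polytime b -> polytime c -> polytime d -> polytime e ->
  polytime (fun a => f (b a) (c a) (d a) (e a)).
Proof.
move=> pf pb pc pd pe.
exact: polytime_comp (polytime_pair pb (polytime_pair pc (polytime_pair pd pe))) pf.
Qed.

Lemma polytime_size A X (eA : encodable A) (eX : encodable X) (l : A -> seq X) :
  polytime l -> polytime (fun a => size (l a)).
Proof.
move=> pl; apply: (@polytime_ext _ _ _ _ (fun a => foldr (fun _ n => n + 1) 0 (l a))).
  by move=> a; elim: (l a) => //= _ s ->; rewrite addn1.
apply: (@polytime_foldr_add _ _ _ _ _ _ (fun _ _ n => n + 1) (fun=> 0) l (fun=> 5)) => //; [pt|pt|by pbound_tac|].
by move=> a s x _; have := esize_addn s 1; rewrite (_ : esize 1 = 5) //.
Qed.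
#[global] Hint Resolve polytime_size : polytime.

Lemma esize_nat_le n : esize n <= 5 * n + 1.
Proof. by elim: n => // n IH; have := esize_addn n 1; rewrite addn1 (_ : esize 1 = 5) //; lia. Qed.

Lemma esize_seq_le X (eX : encodable X) (l : seq X) c :
  (forall l1 x l2, l = l1 ++ x :: l2 -> esize x <= c) -> esize l <= 1 + size l * c.+1.
Proof.
elim: l => // x l IH H; rewrite esize_cons /= mulSn.
have := H [::] x l erefl; have : esize l <= 1 + size l * c.+1; last lia.
by apply: IH => l1 y l2 E; apply: (H (x :: l1) y l2); rewrite E.
Qed.

Lemma esize_seq_le_in (X : eqType) (eX : encodable X) (l : seq X) c :
  (forall x, x \in l -> esize x <= c) -> esize l <= 1 + size l * c.+1.
Proof.
by move=> H; apply: esize_seq_le => l1 x l2 E; apply: H; rewrite E mem_cat inE eqxx orbT.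
Qed.

Lemma esize_in (X : eqType) (eX : encodable X) (l : seq X) x : x \in l -> esize x <= esize l.
Proof. by case/splitPr => l1 l2; exact: (esize_mem erefl). Qed.

(** The length is given by a list because [iota 0 n] is exponentially long in the binary encoding of
    [n]. *)
Lemma polytime_iota A X (eA : encodable A) (eX : encodable X) (l : A -> seq X) :
  polytime l -> polytime (fun a => iota 0 (size (l a))).
Proof.
move=> pl; pose step (s : nat * seq nat) (_ : X) := (s.1 + 1, s.1 :: s.2).
have stepE k : foldl step (0, [::]) k = (size k, rev (iota 0 (size k))).
  elim/last_ind: k => // k x IH; rewrite foldl_rcons IH /step /= size_rcons addn1; congr pair.
  by rewrite -[in RHS]addn1 iotaD rev_cat.
apply: (@polytime_ext _ _ _ _ (fun a => rev (foldl step (0, [::]) (l a)).2)).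
  by move=> a; rewrite stepE revK.
apply: polytime_rev; apply: polytime_snd.
apply: (@polytime_foldl _ _ _ _ _ _ (fun _ => step) (fun=> (0, [::])) l
   (fun a => 3 + 5 * esize (l a) + esize (l a) * (5 * esize (l a) + 2))) => //; [rewrite /step; pt|pt| |].
  by pbound_tac; exact: pbound_polytime.
move=> a l1 l2 E; rewrite stepE esize_pair esize_rev.
have le : size l1 <= esize (l a).
  have : size (l a) <= esize (l a) by exact: size_le_esize.
  by rewrite {1}E size_cat; lia.
have := esize_nat_le (size l1).
have : esize (iota 0 (size l1)) <= 1 + size (iota 0 (size l1)) * (5 * esize (l a) + 1).+1.
  apply: esize_seq_le_in => i; rewrite mem_iota => /andP[_ lti].
  by apply: leq_trans (esize_nat_le i) _; lia.
rewrite size_iota; nia.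
Qed.
#[global] Hint Resolve polytime_iota : polytime.

Lemma polytime_sumn A (eA : encodable A) (l : A -> seq nat) :
  polytime l -> polytime (fun a => sumn (l a)).
Proof.
move=> pl.
apply: (@polytime_foldr_add _ _ _ _ _ _ (fun _ x n => x + n) (fun=> 0) l (fun a => esize (l a))) => //; [pt|pt| |].
  exact: pbound_polytime.
by move=> a s x le; have := esize_addn x s; lia.
Qed.
#[global] Hint Resolve polytime_sumn : polytime.

Lemma esize_sumn (l : seq nat) : esize (sumn l) <= esize l.
Proof. by elim: l => //= x l IH; rewrite esize_cons; have := esize_addn x (sumn l); lia. Qed.

Definition prodl : seq nat -> nat := foldr muln 1.

Lemma size_bits_leq n k : (size (bits n) <= k) = (n < 2 ^ k).
Proof.
elim: k n => [|k IH] n; rewrite bitsE; first by case: n.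
case: eqP => [->|n0]; first by rewrite leq0n expn_gt0.
by rewrite /= ltnS IH expnS; lia.
Qed.

Lemma esize_bits_le n : 2 * size (bits n) <= esize n <= 4 * size (bits n) + 1.
Proof.
elim/half_ind: n => // n n0 IH; rewrite bitsE esize_natE gtn_eqF //=.
by case: (odd n) => /=; lia.
Qed.

Lemma polytime_prodl A (eA : encodable A) (l : A -> seq nat) :
  polytime l -> polytime (fun a => prodl (l a)).
Proof.
move=> pl.
apply: (@polytime_ext _ _ _ _ (fun a => foldl (fun p x => x * p) 1 (rev (l a)))).
  by move=> a; rewrite foldl_rev.
apply: (@polytime_foldl _ _ _ _ _ _ (fun _ p x => x * p) (fun=> 1) (fun a => rev (l a))
   (fun a => 5 + 4 * esize (l a))); [pt|pt|pt| |].
  by pbound_tac; exact: pbound_polytime.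
move=> a l1 l2 E.
have le : esize l1 <= esize (l a).
  rewrite -[esize (l a)]esize_rev E; elim: (l1) => [|x k IH]; rewrite ?cat0s ?cat_cons ?esize_cons; last lia.
  exact: esize_gt0.
(* Multiplying numbers at most adds their digit counts, so the accumulator grows additively. *)
have : size (bits (foldl (fun p x => x * p) 1 l1)) <= esize l1.
  elim/last_ind: (l1) => // k x; rewrite foldl_rcons -cats1 => IH.
  have -> : esize (k ++ [:: x]) = esize k + (esize x).+1.
    by rewrite !esize_seq big_cat big_seq1 /=; lia.
  have h := IH; have := esize_bits_le x; rewrite size_bits_leq in h => hx.
  have : size (bits x) <= size (bits x) by []; rewrite {1}size_bits_leq => hx2.
  rewrite size_bits_leq; apply: (@leq_trans (2 ^ (size (bits x) + esize k))).
    by rewrite expnD ltn_mul.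
  by rewrite leq_exp2l //; lia.
by have := esize_bits_le (foldl (fun p x => x * p) 1 l1); lia.
Qed.
#[global] Hint Resolve polytime_prodl : polytime.

(** The thresholds of capacity scaling: the powers of 2 up to [n], largest first. *)
Definition pows (n : nat) : seq nat :=
  (foldl (fun s _ => (bdouble false s.1, s.1 :: s.2)) (1, [::]) (bits n)).2.

Lemma powsE n : pows n = rev [seq 2 ^ i | i <- iota 0 (size (bits n))].
Proof.
rewrite /pows; set step := fun _ _ => _.
suff -> : forall l, foldl step (1, [::]) l = (2 ^ size l, rev [seq 2 ^ i | i <- iota 0 (size l)]) by [].
elim/last_ind => // k x IH; rewrite foldl_rcons IH /step /= size_rcons; congr pair.
  by rewrite /bdouble add0n expnS mul2n.
by rewrite -[(size k).+1]addn1 iotaD map_cat rev_cat.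
Qed.

Lemma polytime_pows A (eA : encodable A) (n : A -> nat) : polytime n -> polytime (fun a => pows (n a)).
Proof.
move=> pn; apply: polytime_snd.
apply: (@polytime_foldl _ _ _ _ _ _ (fun _ s _ => (bdouble false s.1, s.1 :: s.2))
   (fun=> (1, [::])) (fun a => bits (n a))
   (fun a => 10 + 4 * esize (n a) + esize (n a) * (7 + 4 * esize (n a)))); [pt|pt|pt| |].
  by pbound_tac; exact: pbound_polytime.
move=> a l1 l2 E.
have le : size l1 <= esize (n a).
  have : size (bits (n a)) <= esize (bits (n a)) by exact: size_le_esize.
  by rewrite {1}E size_cat esize_bits; lia.
have : let s := foldl (fun (s : nat * seq nat) (_ : bool) => (bdouble false s.1, s.1 :: s.2)) (1, [::]) l1 in
   esize s.1 <= 5 + 4 * size l1 /\ esize s.2 <= 1 + size l1 * (6 + 4 * size l1).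
  elim/last_ind: (l1) => // k x; rewrite foldl_rcons size_rcons.
  move: (foldl _ _ k) => [p s] /= [h1 h2]; rewrite esize_cons; have := esize_bdouble false p.
  by nia.
by case: (foldl _ _ l1) => p s /= [h1 h2]; rewrite esize_pair; nia.
Qed.
#[global] Hint Resolve polytime_pows : polytime.

Lemma polytime_mem A (eA : encodable A) (x : A -> nat) (l : A -> seq nat) :
  polytime x -> polytime l -> polytime (fun a => x a \in l a).
Proof.
move=> px pl; apply: (@polytime_ext _ _ _ _ (fun a => has (fun y => y == x a) (l a))).
  by move=> a; rewrite has_pred1.
apply: polytime_has => //.
have : polytime (fun p : A * nat => x p.1) by apply: polytime_comp px; pt.
pt.
Qed.

Lemma polytime_mem2 A (eA : encodable A) (x : A -> nat * nat) (l : A -> seq (nat * nat)) :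
  polytime x -> polytime l -> polytime (fun a => x a \in l a).
Proof.
move=> px pl; apply: (@polytime_ext _ _ _ _ (fun a => has (fun y => (y.1 == (x a).1) && (y.2 == (x a).2)) (l a))).
  by move=> a; rewrite -has_pred1; apply: eq_has => -[y z]; case: (x a).
apply: polytime_has => //.
have : polytime (fun p : A * (nat * nat) => x p.1) by apply: polytime_comp px; pt.
pt.
Qed.
#[global] Hint Resolve polytime_mem polytime_mem2 : polytime.

Lemma polytime_zip_nat A X (eA : encodable A) (eX : encodable X) (k : A -> seq X) (l : A -> seq nat) :
  polytime k -> polytime l -> polytime (fun a => zip (k a) (l a)).
Proof. exact: polytime_zip 0 _ _. Qed.
#[global] Hint Resolve polytime_zip_nat : polytime.

Notation arc := (nat * nat)%type.

(** * The algorithm *)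

(* Paths are stored backwards, the sink first. *)
Definition arcs (w : seq nat) : seq arc := zip (behead w) w.

(** Graph search in which each reached vertex is stored as a whole path ending there; no predecessor
    table is needed, and the head of a stored path is the vertex it reaches. *)
Definition grow_step (E : seq arc) (acc : seq (seq nat)) : seq (seq nat) :=
  let seen := [seq head 0 P | P <- acc] in
  let c := [seq e <- E | (e.1 \in seen) && (e.2 \notin seen)] in
  if nilp c then acc else
  let e := head (0, 0) c in
  (e.2 :: head [::] [seq P <- acc | head 0 P == e.1]) :: acc.

Definition grow (E : seq arc) (s : nat) : seq (seq nat) :=
  foldl (fun acc _ => grow_step E acc) [:: [:: s]] E.

Definition find_path (n : nat) (E : seq arc) (s : nat) : seq nat :=
  head [::] [seq P <- grow E s | n <= head 0 P].

(* Each arc comes with its capacity and its residual capacity. *)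
Notation net := (seq (arc * (nat * nat))).

Definition push (L : seq arc) (d : nat) (r : net) : net :=
  [seq (e.1, (e.2.1, if e.1 \in L then e.2.2 - d
                     else if (e.1.2, e.1.1) \in L then e.2.2 + d else e.2.2))
   | e <- r].

Definition usable (d : nat) (r : net) : seq arc := [seq e.1 | e <- r & d <= e.2.2].

(** The amount pushed is the threshold [d] and not the bottleneck of the path, so that every
    successful attempt lowers all cuts by exactly [d]. *)
Definition augment (n s : nat) (r : net) (d : nat) : net :=
  let w := find_path n (usable d r) s in
  if nilp w then r else push (arcs w) d r.

Definition total (r : net) : nat := sumn [seq e.2.2 | e <- r].

(** With m arcs, the phase at threshold 2d leaves a cut of residual capacity at most m (2d - 1) = m
    (d - 1) + m d, so m attempts suffice for the phase at d. Failed attempts change nothing, hence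
    the schedule can be fixed in advance. *)
Definition schedule (r : net) : seq nat :=
  flatten [seq [seq p | _ <- r] | p <- pows (total r)].

Definition max_flow (n s : nat) (r : net) : net :=
  foldl (augment n s) r (schedule r).

Definition flow_support (r : net) : seq arc := [seq e.1 | e <- r & e.2.2 < e.2.1].

Definition minl (l : seq nat) : nat := foldl (fun m x => if x < m then x else m) (head 0 l) l.

Definition bottleneck (L : seq arc) (r : net) : nat :=
  minl [seq e.2.1 - e.2.2 | e <- r & e.1 \in L].

(** Peels one path off the flow: [zip w (behead w)] lists the arcs of [w] reversed, and pushing
    along them undoes flow. *)
Definition cancel (n s : nat) (st : net * seq (seq nat * nat)) : net * seq (seq nat * nat) :=
  let w := find_path n (flow_support st.1) s in
  if nilp w then st else
  let b := bottleneck (arcs w) st.1 in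
  (push (zip w (behead w)) b st.1, (w, b) :: st.2).

Definition decompose (n s : nat) (r : net) : seq (seq nat * nat) :=
  (foldl (fun st _ => cancel n s st) (r, [::]) r).2.

Definition flow_paths (n s : nat) (E : seq (arc * nat)) : seq (seq nat * nat) :=
  decompose n s (max_flow n s [seq (e.1, (e.2, e.2)) | e <- E]).

Definition flow_value (P : seq (seq nat * nat)) : nat := sumn [seq p.2 | p <- P].

(** * Polynomial time of the flow routines *)

Lemma polytime_arcs A (eA : encodable A) (w : A -> seq nat) :
  polytime w -> polytime (fun a => arcs (w a)).
Proof. rewrite /arcs; pt. Qed.
#[global] Hint Resolve polytime_arcs : polytime.

Lemma polytime_grow_step : polytime (fun p : seq arc * seq (seq nat) => grow_step p.1 p.2).
Proof. rewrite /grow_step; cbv zeta. pt. Qed.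

#[global] Hint Extern 1 (polytime (fun _ => grow_step _ _)) =>
  apply: (polytime_comp2 polytime_grow_step) : polytime.

Lemma esize_head X (eX : encodable X) (x : X) l : esize (head x l) <= maxn (esize x) (esize l).
Proof. by case: l => [|y l] /=; rewrite ?esize_cons; lia. Qed.

Lemma esize_filter X (eX : encodable X) (p : pred X) l : esize [seq x <- l | p x] <= esize l.
Proof. by elim: l => //= x l IH; case: ifP => _; rewrite ?esize_cons; lia. Qed.

Lemma head_filter (T : eqType) (x : T) (P : pred T) l :
  (x == head x ([seq y <- l | P y])) || ((head x ([seq y <- l | P y]) \in l) && P (head x ([seq y <- l | P y]))).
Proof.
elim: l => //= [|y l IH]; rewrite ?eqxx //; case: ifP => Py; rewrite /= ?inE ?eqxx ?Py ?orbT //.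
by case/orP: IH => [->|/andP[-> ->]]; rewrite ?orbT.
Qed.

Lemma polytime_grow : polytime (fun p : seq arc * nat => grow p.1 p.2).
Proof.
pose (B := fun p : seq arc * nat => 5 + esize p).
apply: (@polytime_foldl _ _ _ _ _ _ (fun p acc _ => grow_step p.1 acc) (fun p => [:: [:: p.2]]) (fun p => p.1)
   (fun p => 2 + B p * (2 + B p * (B p).+1))); [pt|pt|pt| |].
  by rewrite /B; pbound_tac.
move=> [E s] l1 l2; rewrite [fst _]/= [snd _]/= => EE.
have szl : size l1 + 2 <= B (E, s).
  have : size E <= esize E by exact: size_le_esize.
  by rewrite /B esize_pair {1}EE size_cat; lia.
enough (H : let acc := foldl (fun acc _ => grow_step E acc) [:: [:: s]] l1 in
  size acc <= (size l1).+1 /\ forall P, P \in acc -> size P <= (size l1).+1 /\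
    forall x, x \in P -> esize x <= B (E, s)).
  case: H => h1 h2; set acc := foldl _ _ _ in h1 h2 *.
  have : esize acc <= 1 + size acc * (1 + B (E, s) * (B (E, s)).+1).+1.
    apply: esize_seq_le_in => P /h2[sP eP].
    have h : esize P <= 1 + size P * (B (E, s)).+1 by exact: esize_seq_le_in.
    by apply: leq_trans h _; rewrite leq_add2l leq_mul2r; apply/orP; right; lia.
  move=> h; apply: leq_trans h _; apply: leq_add => //; rewrite leq_mul //; lia.
elim/last_ind: l1 {l2 EE szl} => [|l x [IH1 IH2]] /=.
  split=> // P; rewrite inE => /eqP->; split=> // x; rewrite inE => /eqP->.
  by rewrite /B esize_pair; lia.
rewrite foldl_rcons size_rcons; move: (foldl _ _ l) IH1 IH2 => acc IH1 IH2.
have IH2' P : P \in acc -> size P <= (size l).+2 /\ forall y, y \in P -> esize y <= B (E, s).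
  by move=> /IH2[? ?]; split=> //; lia.
rewrite /grow_step; set c := [seq e <- E | _]; case: ifP => _; first by split; [lia|].
split; first by rewrite /=; lia.
move=> P; rewrite inE => /orP[/eqP->|]; last exact: IH2'.
set e := head _ c; set Q := head _ _.
have [sQ eQ] : size Q <= (size l).+1 /\ forall y, y \in Q -> esize y <= B (E, s).
  have := head_filter [::] (fun P => head 0 P == e.1) acc; rewrite -/Q.
  by case/orP => [/eqP<-//|/andP[Qin _]]; exact: IH2.
split=> [|y]; first by rewrite /=; lia.
rewrite inE => /orP[/eqP->|]; last exact: eQ.
have h1 : esize c <= esize E by exact: esize_filter.
have h2 : esize e <= maxn (esize (0, 0)) (esize c) by exact: esize_head.
have h3 : esize e = (esize e.1 + esize e.2).+1 by [].
rewrite /B esize_pair; move: h2; rewrite h3 (_ : esize (0,0) = 3) //; lia.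
Qed.
#[global] Hint Extern 1 (polytime (fun _ => grow _ _)) =>
  apply: (polytime_comp2 polytime_grow) : polytime.

Lemma polytime_find_path : polytime (fun p : nat * (seq arc * nat) => find_path p.1 p.2.1 p.2.2).
Proof. rewrite /find_path; pt. Qed.
#[global] Hint Extern 1 (polytime (fun _ => find_path _ _ _)) =>
  apply: (polytime_comp3 polytime_find_path) : polytime.

Lemma polytime_push : polytime (fun p : seq arc * (nat * net) => push p.1 p.2.1 p.2.2).
Proof. rewrite /push; pt. Qed.
#[global] Hint Extern 1 (polytime (fun _ => push _ _ _)) =>
  apply: (polytime_comp3 polytime_push) : polytime.

Lemma polytime_usable : polytime (fun p : nat * net => usable p.1 p.2).
Proof. rewrite /usable; pt. Qed.
#[global] Hint Extern 1 (polytime (fun _ => usable _ _)) =>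
  apply: (polytime_comp2 polytime_usable) : polytime.

Lemma polytime_augment : polytime (fun p : nat * (nat * (net * nat)) => augment p.1 p.2.1 p.2.2.1 p.2.2.2).
Proof. rewrite /augment; cbv zeta; pt. Qed.
#[global] Hint Extern 1 (polytime (fun _ => augment _ _ _ _)) =>
  apply: (polytime_comp4 polytime_augment) : polytime.

Lemma polytime_schedule : polytime schedule.
Proof. rewrite /schedule /total; pt. Qed.
#[global] Hint Extern 1 (polytime (fun _ => schedule _)) =>
  apply: (polytime_comp1 polytime_schedule) : polytime.
#[global] Hint Resolve polytime_schedule : polytime.

(** The part of a network that no update changes; bounding its encoding leaves only the residuals to
    be bounded. *)
Definition keys (r : net) : seq (arc * nat) := [seq (e.1, e.2.1) | e <- r].

Lemma keys_push L d r : keys (push L d r) = keys r.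
Proof. by rewrite /keys /push -map_comp. Qed.

Lemma keys_augment n s r d : keys (augment n s r d) = keys r.
Proof. by rewrite /augment; case: ifP => // _; rewrite keys_push. Qed.

Lemma size_keys r : size (keys r) = size r.
Proof. by rewrite size_map. Qed.

Lemma esize_net (r : net) v : all (fun e => e.2.2 <= v) r ->
  esize r <= esize (keys r) + size r * (2 * esize v + 1).
Proof.
elim: r => [|[a [u x]] r IH] //= /andP[lx /IH h]; move: h; rewrite !esize_cons !esize_pair /=.
by have := esize_nat_leq lx; lia.
Qed.

Lemma leq_total (r : net) : all (fun e => e.2.2 <= total r) r.
Proof.
apply/allP => e; rewrite /total; elim: r => //= e' r IH; rewrite inE => /orP[/eqP->|/IH h]; lia.
Qed.

Lemma all_push L d r v : all (fun e => e.2.2 <= v) r -> all (fun e => e.2.2 <= v + d) (push L d r).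
Proof.
move=> /allP H; apply/allP => e' /mapP[e /H le ->] /=.
by case: ifP => _; [|case: ifP => _]; lia.
Qed.

Lemma esize_keys r : esize (keys r) <= esize r.
Proof. by elim: r => //= [[a [u x]] r IH]; rewrite !esize_cons !esize_pair /=; lia. Qed.

(** Residuals are bounded without any appeal to the flow being legal: an augmentation adds at most
    its threshold, so they never exceed the initial total plus the sum of the schedule. *)
Lemma polytime_max_flow : polytime (fun p : nat * (nat * net) => max_flow p.1 p.2.1 p.2.2).
Proof.
pose (S := fun p : nat * (nat * net) => esize (schedule p.2.2) + esize (total p.2.2)).
apply: (@polytime_foldl _ _ _ _ _ _ (fun p r d => augment p.1 p.2.1 r d) (fun p => p.2.2) (fun p => schedule p.2.2)
   (fun p => esize p + esize p * (2 * S p + 1))); [pt|pt|pt| |].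
  have : polytime (fun p : nat * (nat * net) => schedule p.2.2) by pt.
  have : polytime (fun p : nat * (nat * net) => total p.2.2) by rewrite /total; pt.
  by move=> p1 p2; rewrite /S; pbound_tac; exact: pbound_polytime.
move=> [n [s r]] l1 l2; rewrite ?[fst _]/= ?[snd _]/= => EE.
set r' := foldl _ _ _.
have kr : keys r' = keys r.
  rewrite /r'; elim/last_ind: (l1) => // k x; rewrite foldl_rcons => IH.
  by rewrite keys_augment.
have vr : all (fun e => e.2.2 <= total r + sumn l1) r'.
  rewrite /r'; elim/last_ind: (l1) => [|k x]; first by rewrite addn0; exact: leq_total.
  rewrite foldl_rcons sumn_rcons; set k' := foldl _ _ _ => IH.
  rewrite /augment; case: ifP => _; last by rewrite addnA; exact: all_push.
  by apply: sub_all IH => e /=; lia.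
apply: leq_trans (esize_net vr) _.
have h1 : esize (keys r) <= esize r := esize_keys r.
have h2 : size r <= esize r by exact: size_le_esize.
have h3 := esize_addn (total r) (sumn l1).
have h4 := esize_sumn l1.
have h5 : esize l1 <= esize (schedule r).
  by rewrite EE; elim: (l1) => [|x k IH]; rewrite ?cat0s ?cat_cons ?esize_cons; last lia; exact: esize_gt0.
have -> : size r' = size r by rewrite -size_keys kr size_keys.
rewrite kr /S !esize_pair ?[fst _]/= ?[snd _]/=; nia.
Qed.
#[global] Hint Extern 1 (polytime (fun _ => max_flow _ _ _)) =>
  apply: (polytime_comp3 polytime_max_flow) : polytime.

Lemma polytime_flow_support : polytime flow_support.
Proof. rewrite /flow_support; pt. Qed.
#[global] Hint Extern 1 (polytime (fun _ => flow_support _)) =>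
  apply: (polytime_comp1 polytime_flow_support) : polytime.
#[global] Hint Resolve polytime_flow_support : polytime.

Lemma foldl_min_in m l : foldl (fun m x => if x < m then x else m) m l \in m :: l.
Proof.
elim: l m => [|x l IH] m /=; first by rewrite inE.
have := IH (if x < m then x else m); rewrite !inE; case: ifP => _ /orP[->|->]; rewrite ?orbT //.
Qed.

Lemma minl_in l : l != [::] -> minl l \in l.
Proof.
case: l => // a l _; rewrite /minl [head _ _]/=.
by have := foldl_min_in a (a :: l); rewrite !inE orbA orbb.
Qed.

Lemma minl_le l x : x \in l -> minl l <= x.
Proof.
rewrite /minl; move: (head 0 l) => m; elim: l m => //= y l IH m.
have dec k m' : foldl (fun m x => if x < m then x else m) m' k <= m'.
  by elim: k m' => //= z k IHk m'; case: ifP => [lt|_]; rewrite ?IHk // (leq_trans (IHk _)) // ltnW.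
rewrite inE => /orP[/eqP->|]; last exact: IH.
by case: ifP => lt; rewrite ?dec // (leq_trans (dec _ _)) // leqNgt lt.
Qed.

Lemma polytime_minl : polytime minl.
Proof.
apply: (@polytime_foldl _ _ _ _ _ _ (fun _ m x => if x < m then x else m) (fun l => head 0 l) (fun l => l)
  (fun l => 1 + esize l)); [pt|pt|pt| |].
  by pbound_tac.
move=> a l1 l2 ->.
have := foldl_min_in (head 0 (l1 ++ l2)) l1; rewrite inE => /orP[/eqP->|h].
  have h : esize (head 0 (l1 ++ l2)) <= maxn (esize 0) (esize (l1 ++ l2)) by exact: esize_head.
  by move: h; rewrite esize_nat0; lia.
apply: (@leq_trans (esize (l1 ++ l2))); last by lia.
by apply: esize_in; rewrite mem_cat h.
Qed.
#[global] Hint Extern 1 (polytime (fun _ => minl _)) =>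
  apply: (polytime_comp1 polytime_minl) : polytime.
#[global] Hint Resolve polytime_minl : polytime.

Lemma polytime_bottleneck : polytime (fun p : seq arc * net => bottleneck p.1 p.2).
Proof. rewrite /bottleneck; pt. Qed.
#[global] Hint Extern 1 (polytime (fun _ => bottleneck _ _)) =>
  apply: (polytime_comp2 polytime_bottleneck) : polytime.

Lemma polytime_cancel : polytime (fun p : nat * (nat * (net * seq (seq nat * nat))) => cancel p.1 p.2.1 p.2.2).
Proof. rewrite /cancel; cbv zeta; pt. Qed.
#[global] Hint Extern 1 (polytime (fun _ => cancel _ _ _)) =>
  apply: (polytime_comp3 polytime_cancel) : polytime.

Lemma keys_cancel n s st : keys (cancel n s st).1 = keys st.1.
Proof. by rewrite /cancel; case: ifP => // _; rewrite keys_push. Qed.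

Lemma esize_sumn_keys (r : net) : esize (sumn [seq e.2.1 | e <- r]) <= esize (keys r).
Proof.
apply: leq_trans (esize_sumn _) _.
by elim: r => //= [[a [u x]] r IH]; rewrite !esize_cons !esize_pair /=; lia.
Qed.

Lemma bottleneck_le L (r : net) : bottleneck L r <= sumn [seq e.2.1 | e <- r].
Proof.
rewrite /bottleneck; set l := [seq _ | _ <- _].
case: (altP (l =P [::])) => [->//|/minl_in].
case/mapP => e; rewrite mem_filter => /andP[_ er] ->.
apply: (leq_trans (leq_subr _ _)).
elim: r er {l} => //= e' r IH; rewrite inE => /orP[/eqP->|/IH h]; first exact: leq_addr.
exact: leq_trans h (leq_addl _ _).
Qed.

Lemma esize_flow_support (r : net) : esize (flow_support r) <= esize (keys r).
Proof.
rewrite /flow_support; elim: r => //= [[a [u x]] r IH].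
by case: ifP => _ /=; rewrite !esize_cons ?esize_pair /=; lia.
Qed.

(** A bottleneck is a capacity minus a residual, hence at most the sum [B] of the capacities, which
    stay fixed. So residuals grow by at most [B] per round, and each round adds at most one path. *)
Lemma polytime_decompose : polytime (fun p : nat * (nat * net) => decompose p.1 p.2.1 p.2.2).
Proof.
apply: polytime_snd.
have [d fp] := pbound_polytime polytime_find_path.
pose (q := fun p : nat * (nat * net) => 10 + 5 * esize p).
pose (v := fun p : nat * (nat * net) => 1 + 2 * (esize p + 5 * esize p * esize p)).
apply: (@polytime_foldl _ _ _ _ _ _ (fun p st _ => cancel p.1 p.2.1 st) (fun p => (p.2.2, [::])) (fun p => p.2.2)
   (fun p => 10 + esize p + esize p * (2 * v p + 1) + esize p * (10 + q p ^ d + 2 * esize p))); [pt|pt|pt| |].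
  by rewrite /q /v; pbound_tac.
move=> [n [s r]] l1 l2; rewrite ?[fst _]/= ?[snd _]/= => EE.
set st := foldl _ _ _; set B := sumn [seq e.2.1 | e <- r].
have kB r' : keys r' = keys r -> sumn [seq e.2.1 | e <- r'] = B.
  have E k : [seq e.2.1 | e <- k] = [seq e.2 | e <- keys k] by rewrite -map_comp.
  by rewrite /B !E => ->.
have hr : esize (keys r) <= esize r := esize_keys r.
have hB : esize B <= esize r by apply: leq_trans (esize_sumn_keys r) hr.
have hT : esize (total r) <= esize r.
  apply: leq_trans (esize_sumn _) _; elim: (r) => //= [[a [u x]] k IH].
  by rewrite !esize_cons !esize_pair /=; lia.
have h2 : size r <= esize r by exact: size_le_esize.
have szl : size l1 <= size r by rewrite EE size_cat leq_addr.
have kr : keys st.1 = keys r.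
  rewrite /st; elim/last_ind: (l1) => // k x; rewrite foldl_rcons => IH.
  by rewrite keys_cancel.
have vr : all (fun e => e.2.2 <= total r + size l1 * B) st.1.
  rewrite /st; have : forall k, keys (foldl (fun st _ => cancel n s st) (r, [::]) (k : net)).1 = keys r.
    by elim/last_ind => // k x; rewrite foldl_rcons keys_cancel.
  move=> kr'; elim/last_ind: (l1) => [|k x]; first by rewrite addn0; exact: leq_total.
  rewrite foldl_rcons size_rcons mulSn; have := kr' k; set k' := foldl _ _ _ => kk IH.
  rewrite /cancel; case: ifP => _ /=; first by apply: sub_all IH => e /=; lia.
  set b := bottleneck _ _; have bB : b <= B by rewrite -(kB _ kk); exact: bottleneck_le.
  by apply: sub_all (all_push _ b IH) => e /=; lia.
have h3 : esize (total r + size l1 * B) <= esize r + esize r * (5 * esize r + 1).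
  apply: leq_trans (esize_addn _ _) _; apply: leq_add => //.
  have : esize (size l1 * B) <= size l1 * esize B + 1.
    by elim: (size l1) => // k IH; rewrite !mulSn; have := esize_addn B (k * B); lia.
  have r1 : 0 < esize r by exact: esize_gt0.
  have : size l1 * esize B <= esize r * esize r by apply: leq_mul => //; lia.
  by nia.
have s1 : esize st.1 <= esize r + esize r * (2 * v (n, (s, r)) + 1).
  apply: leq_trans (esize_net vr) _; rewrite kr -size_keys kr size_keys.
  apply: leq_add => //; apply: leq_mul => //.
  rewrite leq_add2r leq_mul2l; apply/orP; right; apply: leq_trans h3 _.
  by rewrite /v !esize_pair; nia.
have s2 : esize st.2 <= 1 + size l1 * (10 + q (n, (s, r)) ^ d + 2 * esize r).
  rewrite /st; have : forall k, keys (foldl (fun st _ => cancel n s st) (r, [::]) (k : net)).1 = keys r.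
    by elim/last_ind => // k x; rewrite foldl_rcons keys_cancel.
  move=> kr'; elim/last_ind: (l1) => [|k x] //.
  rewrite foldl_rcons size_rcons mulSn; have := kr' k; set k' := foldl _ _ _ => kk IH.
  rewrite /cancel; case: ifP => _ /=; first by lia.
  set b := bottleneck _ _; have bB : b <= B by rewrite -(kB _ kk); exact: bottleneck_le.
  rewrite esize_cons esize_pair; set w := find_path _ _ _.
  have eb : esize b <= 2 * esize r by apply: leq_trans (esize_nat_leq bB) _; lia.
  have ew : esize w <= q (n, (s, r)) ^ d.
    apply: leq_trans (fp (n, (flow_support k'.1, s))) _.
    case: (d) => // d'; rewrite leq_exp2r //.
    rewrite /q !esize_pair; have := esize_flow_support k'.1; rewrite kk; lia.
  by lia.
rewrite (surjective_pairing st) esize_pair !esize_pair.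
move: (v _) (q _ ^ d) s1 s2 => V Q s1 s2; nia.
Qed.
#[global] Hint Extern 1 (polytime (fun _ => decompose _ _ _)) =>
  apply: (polytime_comp3 polytime_decompose) : polytime.

Lemma polytime_flow_paths : polytime (fun p : nat * (nat * seq (arc * nat)) => flow_paths p.1 p.2.1 p.2.2).
Proof. rewrite /flow_paths; pt. Qed.
#[global] Hint Extern 1 (polytime (fun _ => flow_paths _ _ _)) =>
  apply: (polytime_comp3 polytime_flow_paths) : polytime.

Lemma polytime_flow_value : polytime flow_value.
Proof. rewrite /flow_value; pt. Qed.
#[global] Hint Extern 1 (polytime (fun _ => flow_value _)) =>
  apply: (polytime_comp1 polytime_flow_value) : polytime.
#[global] Hint Resolve polytime_flow_value : polytime.

(** Matches the matrix entries of [enc_instance]: pairs are encoded by nodes and cannot be confused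
    with the [Leaf] of a missing edge. *)
#[global] Instance encodable_entry : encodable (option (nat * nat)) :=
  fun o => if o is Some q then enc q else Leaf.

Lemma polytime_isSome A (eA : encodable A) (f : A -> option (nat * nat)) :
  polytime f -> polytime (fun a => isSome (f a)).
Proof.
move=> pf; apply: (@polytime_ext _ _ _ _ (fun a => truthy (enc (f a)))); last pt.
by move=> a; case: (f a).
Qed.

Lemma polytime_odflt A (eA : encodable A) (f : A -> option (nat * nat)) q :
  polytime f -> polytime (fun a => odflt q (f a)).
Proof.
move=> pf; apply: (@polytime_enc _ _ _ _ _ _ (fun a => if truthy (enc (f a)) then enc (f a) else enc q)); last pt.
by move=> a; case: (f a).
Qed.
#[global] Hint Resolve polytime_isSome polytime_odflt : polytime.

Notation matrix_row := (seq (option (nat * nat))).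
Notation vertex_data := ((nat * nat) * (nat * nat))%type.
Notation demand_data := (nat * (nat * (nat * nat)))%type.
(* Adjacency matrix, costs and processing capacities, demands, budget. *)
Notation raw_instance :=
  (seq matrix_row * (seq vertex_data * (seq demand_data * (nat * nat))))%type.

Definition enumerate X (l : seq X) : seq (X * nat) := zip l (iota 0 (size l)).

Lemma polytime_enumerate A X (eA : encodable A) (eX : encodable X) (l : A -> seq X) :
  polytime l -> polytime (fun a => enumerate (l a)).
Proof. rewrite /enumerate; pt. Qed.
#[global] Hint Resolve polytime_enumerate : polytime.

Definition scale (M : nat) (q : nat * nat) : nat := q.1 * M %/ q.2.

Lemma polytime_scale : polytime (fun p : nat * (nat * nat) => scale p.1 p.2).
Proof. rewrite /scale; pt. Qed.
#[global] Hint Extern 1 (polytime (fun _ => scale _ _)) =>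
  apply: (polytime_comp2 polytime_scale) : polytime.

Definition raw_arcs (rows : seq matrix_row) : seq (arc * (nat * nat)) :=
  flatten [seq [seq ((ru.2, cv.2), odflt (0, 1) cv.1) | cv <- enumerate ru.1 & isSome cv.1]
          | ru <- enumerate rows].

Lemma polytime_raw_arcs : polytime raw_arcs.
Proof. rewrite /raw_arcs; pt. Qed.
#[global] Hint Extern 1 (polytime (fun _ => raw_arcs _)) =>
  apply: (polytime_comp1 polytime_raw_arcs) : polytime.
#[global] Hint Resolve polytime_raw_arcs : polytime.

(** * The purchase on raw instances *)

Section Algorithm.
Variable I : raw_instance.

Definition order : nat := size I.1.
(** Without demands vertex 0 takes the role of the source; it exists because [single_source]
    provides a vertex. *)
Definition source : nat := head 0 [seq d.1 | d <- I.2.2.1].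

(** The product of all denominators is a common multiple with an encoding of linear size, so no
    least common multiple has to be computed. *)
Definition flow_den : nat :=
  prodl ([seq e.2.2 | e <- raw_arcs I.1] ++ [seq x.2.2 | x <- I.2.1] ++
         [seq d.2.2.2 | d <- I.2.2.1]).
Definition cost_den : nat := prodl (I.2.2.2.2 :: [seq x.1.2 | x <- I.2.1]).

Definition graph : seq (arc * nat) :=
  [seq (e.1, scale flow_den e.2) | e <- raw_arcs I.1].
Definition items : seq (nat * (nat * nat)) :=
  [seq (x.2, (scale cost_den x.1.1, scale flow_den x.1.2)) | x <- enumerate I.2.1].
Definition limit : nat := scale cost_den I.2.2.2.

(* The sink of vertex [v], resp. of demand [i], is [order + v], resp. [order + i]. *)
Definition processing_net (T : seq nat) : seq (arc * nat) :=
  graph ++ [seq ((x.1, order + x.1), if x.1 \in T then x.2.2 else 0) | x <- items].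
Definition demand_net : seq (arc * nat) :=
  graph ++ [seq ((d.1.2.1, order + d.2), scale flow_den d.1.2.2) | d <- enumerate I.2.2.1].

Definition processing_paths (T : seq nat) := flow_paths order source (processing_net T).
Definition demand_paths := flow_paths order source demand_net.
Definition capture (T : seq nat) : nat := flow_value (processing_paths T).

(** A vertex that exceeds the limit on its own lies in no affordable set. Leaving it out ensures
    that a vertex rejected by greedy is affordable alone. *)
Definition gains (T : seq nat) : seq ((nat * nat) * nat) :=
  [seq ((x.1, x.2.1), capture (x.1 :: T) - capture T)
  | x <- items & (x.1 \notin T) && (x.2.1 <= limit)].

Definition densest (g : seq ((nat * nat) * nat)) : (nat * nat) * nat :=
  foldl (fun b x => if b.2 * x.1.2 < x.2 * b.1.2 then x else b) (head ((0, 0), 0) g) g.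

(* The state consists of the purchased vertices, their cost, and the first
   vertex (if any) that was preferred but did not fit. *)
Definition greedy_step (st : seq nat * (nat * seq nat)) : seq nat * (nat * seq nat) :=
  if ~~ nilp st.2.2 then st else
  let g := gains st.1 in
  if nilp g then st else
  let b := (densest g).1 in
  if st.2.1 + b.2 <= limit then (b.1 :: st.1, (st.2.1 + b.2, [::]))
  else (st.1, (st.2.1, [:: b.1])).

Definition greedy : seq nat * (nat * seq nat) :=
  foldl (fun st _ => greedy_step st) ([::], (0, [::])) items.

Definition purchase : seq nat :=
  if capture greedy.1 < capture greedy.2.2 then greedy.2.2 else greedy.1.
End Algorithm.

(** * Walks through the source and the output *)

Definition drop_to (x : nat) (l : seq nat) : seq nat :=
  rev (foldl (fun k y => if nilp k && ~~ (y == x) then k else y :: k) [::] l).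

Lemma drop_toE x l : drop_to x l = drop (index x l) l.
Proof.
rewrite /drop_to; set f := fun _ _ => _.
have F k y t : foldl f (rcons k y) t = rev t ++ rcons k y.
  elim/last_ind: t => // t z IH; rewrite foldl_rcons IH /f rev_rcons.
  by case: (rev t) => //=; case: (k).
elim: l => //= y l IH; rewrite {2}/f /= eq_sym; case: eqP => // _.
by rewrite (F [::]) rev_cat revK.
Qed.

Definition loop_erase (l : seq nat) : seq nat :=
  foldr (fun x k => if x \in k then drop_to x k else x :: k) [::] l.

(** Both paths run from an artificial sink back to the source; [behead] removes that sink. The first
    half is the path to the processing vertex. The second half is the loop-erased walk from there
    through the source to the destination, whose first vertex is dropped because the first half ends
    in it. *)
Definition route (p q : seq nat) : seq nat :=
  rev (behead p) ++ behead (loop_erase (behead p ++ behead (rev (behead q)))).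

Notation raw_output := (seq nat * seq (nat * (seq nat * (nat * (nat * nat)))))%type.

(** A pair of paths gets the product of their amounts. Dividing by the larger of [A] and [D] makes
    these products add up to the smaller one; [flow_den I] undoes the integer scaling, and 1 stands
    in for a zero denominator. *)
Definition algorithm (I : raw_instance) : raw_output :=
  let T := purchase I in
  let P := processing_paths I T in
  let Q := demand_paths I in
  let A := flow_value P in
  let D := flow_value Q in
  (T, flatten [seq [seq (head 0 q.1 - order I, (route p.1 q.1, (head 0 p.1 - order I,
         (p.2 * q.2, 3 * flow_den I * (if A < D then D else if A == 0 then 1 else A)))))
       | q <- Q] | p <- P]).

(** * Polynomial time of the whole algorithm *)

Lemma polytime_drop_to : polytime (fun p : nat * seq nat => drop_to p.1 p.2).
Proof.
apply: polytime_rev.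
apply: (@polytime_foldl_add _ _ _ _ _ _ (fun p k y => if nilp k && ~~ (y == p.1) then k else y :: k)
  (fun=> [::]) (fun p => p.2) (fun p => (esize p.2).+1)) => //; [pt|pt|pt| |].
  by pbound_tac; apply: pbound_polytime; pt.
by move=> a s x /= le; case: ifP => _; rewrite ?esize_cons; lia.
Qed.
#[global] Hint Extern 1 (polytime (fun _ => drop_to _ _)) =>
  apply: (polytime_comp2 polytime_drop_to) : polytime.

Lemma esize_drop X (eX : encodable X) (l : seq X) i : esize (drop i l) <= esize l.
Proof. by elim: l i => [|y k IH] [|i] //=; rewrite esize_cons; have := IH i; lia. Qed.

Lemma polytime_loop_erase : polytime loop_erase.
Proof.
apply: (@polytime_foldr_add _ _ _ _ _ _ (fun _ x k => if x \in k then drop_to x k else x :: k)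
  (fun=> [::]) (fun l => l) (fun l => (esize l).+1)) => //; [pt|pt|pt| |].
  by pbound_tac.
move=> a s x /= le; case: ifP => _; last by rewrite esize_cons; lia.
rewrite drop_toE; apply: (@leq_trans (esize s)); last exact: leq_addr.
exact: esize_drop.
Qed.
#[global] Hint Extern 1 (polytime (fun _ => loop_erase _)) =>
  apply: (polytime_comp1 polytime_loop_erase) : polytime.
#[global] Hint Resolve polytime_loop_erase : polytime.

Lemma polytime_route : polytime (fun p : seq nat * seq nat => route p.1 p.2).
Proof. rewrite /route; pt. Qed.
#[global] Hint Extern 1 (polytime (fun _ => route _ _)) =>
  apply: (polytime_comp2 polytime_route) : polytime.

Lemma polytime_flow_den : polytime flow_den.
Proof. rewrite /flow_den; pt. Qed.
#[global] Hint Extern 1 (polytime (fun _ => flow_den _)) =>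
  apply: (polytime_comp1 polytime_flow_den) : polytime.
#[global] Hint Resolve polytime_flow_den : polytime.

Lemma polytime_cost_den : polytime cost_den.
Proof. rewrite /cost_den; pt. Qed.
#[global] Hint Extern 1 (polytime (fun _ => cost_den _)) =>
  apply: (polytime_comp1 polytime_cost_den) : polytime.
#[global] Hint Resolve polytime_cost_den : polytime.

Lemma polytime_graph : polytime graph.
Proof. rewrite /graph; pt. Qed.
#[global] Hint Extern 1 (polytime (fun _ => graph _)) =>
  apply: (polytime_comp1 polytime_graph) : polytime.
#[global] Hint Resolve polytime_graph : polytime.

Lemma polytime_items : polytime items.
Proof. rewrite /items; pt. Qed.
#[global] Hint Extern 1 (polytime (fun _ => items _)) =>
  apply: (polytime_comp1 polytime_items) : polytime.
#[global] Hint Resolve polytime_items : polytime.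

Lemma polytime_limit : polytime limit.
Proof. rewrite /limit; pt. Qed.
#[global] Hint Extern 1 (polytime (fun _ => limit _)) =>
  apply: (polytime_comp1 polytime_limit) : polytime.
#[global] Hint Resolve polytime_limit : polytime.

Lemma polytime_order : polytime order.
Proof. rewrite /order; pt. Qed.
#[global] Hint Extern 1 (polytime (fun _ => order _)) =>
  apply: (polytime_comp1 polytime_order) : polytime.
#[global] Hint Resolve polytime_order : polytime.

Lemma polytime_source : polytime source.
Proof. rewrite /source; pt. Qed.
#[global] Hint Extern 1 (polytime (fun _ => source _)) =>
  apply: (polytime_comp1 polytime_source) : polytime.
#[global] Hint Resolve polytime_source : polytime.

Lemma polytime_processing_paths : polytime (fun p : raw_instance * seq nat => processing_paths p.1 p.2).
Proof. rewrite /processing_paths /processing_net; pt. Qed.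
#[global] Hint Extern 1 (polytime (fun _ => processing_paths _ _)) =>
  apply: (polytime_comp2 polytime_processing_paths) : polytime.

Lemma polytime_demand_paths : polytime demand_paths.
Proof. rewrite /demand_paths /demand_net; pt. Qed.
#[global] Hint Extern 1 (polytime (fun _ => demand_paths _)) =>
  apply: (polytime_comp1 polytime_demand_paths) : polytime.
#[global] Hint Resolve polytime_demand_paths : polytime.

Lemma polytime_capture : polytime (fun p : raw_instance * seq nat => capture p.1 p.2).
Proof. rewrite /capture; pt. Qed.
#[global] Hint Extern 1 (polytime (fun _ => capture _ _)) =>
  apply: (polytime_comp2 polytime_capture) : polytime.

Lemma polytime_gains : polytime (fun p : raw_instance * seq nat => gains p.1 p.2).
Proof. rewrite /gains; pt. Qed.
#[global] Hint Extern 1 (polytime (fun _ => gains _ _)) =>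
  apply: (polytime_comp2 polytime_gains) : polytime.

Lemma densest_in g : g != [::] -> densest g \in g.
Proof.
case: g => // a g _; rewrite /densest [head _ _]/=; set f := fun _ _ => _.
suff H : forall k m, foldl f m k \in m :: k.
  by have := H (a :: g) a; rewrite !inE orbA orbb.
elim=> [|x k IH] m /=; first by rewrite inE.
by have := IH (f m x); rewrite !inE /f; case: ifP => _ /orP[->|->]; rewrite ?orbT.
Qed.

Lemma polytime_densest : polytime densest.
Proof.
apply: (@polytime_foldl _ _ _ _ _ _ (fun _ b x => if b.2 * x.1.2 < x.2 * b.1.2 then x else b)
  (fun g => head ((0, 0), 0) g) (fun g => g) (fun g => 5 + esize g)); [pt|pt|pt| |].
  by pbound_tac.
move=> a l1 l2 ->; set f := fun _ _ => _.
have H : forall k m, foldl f m k \in m :: k.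
  elim=> [|x k IH] m /=; first by rewrite inE.
  by have := IH (f m x); rewrite !inE /f; case: ifP => _ /orP[->|->]; rewrite ?orbT.
have := H l1 (head ((0, 0), 0) (l1 ++ l2)); rewrite inE => /orP[/eqP->|h].
  have h : esize (head ((0, 0), 0) (l1 ++ l2)) <= maxn (esize ((0, 0), 0)) (esize (l1 ++ l2)) by exact: esize_head.
  by move: h; rewrite (_ : esize ((0,0),0) = 5) //; lia.
apply: (@leq_trans (esize (l1 ++ l2))); last by lia.
by apply: esize_in; rewrite mem_cat h.
Qed.
#[global] Hint Extern 1 (polytime (fun _ => densest _)) =>
  apply: (polytime_comp1 polytime_densest) : polytime.
#[global] Hint Resolve polytime_densest : polytime.

Lemma polytime_greedy_step :
  polytime (fun p : raw_instance * (seq nat * (nat * seq nat)) => greedy_step p.1 p.2).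
Proof. rewrite /greedy_step; cbv zeta; pt. Qed.
#[global] Hint Extern 1 (polytime (fun _ => greedy_step _ _)) =>
  apply: (polytime_comp2 polytime_greedy_step) : polytime.

Lemma polytime_greedy : polytime greedy.
Proof.
pose (g := fun I : raw_instance => 10 + esize (items I)).
apply: (@polytime_foldl_add _ _ _ _ _ _ (fun I st _ => greedy_step I st) (fun=> ([::], (0, [::])))
  items g) => //; [pt|pt|pt| |].
  by rewrite /g; pbound_tac; apply: pbound_polytime; pt.
move=> I [T [c k]] x _; rewrite /greedy_step /=; case: ifP => _; first by lia.
case: ifP => [_|]; first by lia.
move/negbT; rewrite /nilp size_eq0 => /densest_in/mapP[[v [cv pv]]]; rewrite mem_filter => /andP[_ yi] ->.
have h : esize (v, (cv, pv)) <= esize (items I) by exact: esize_in.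
move: h; rewrite /= /g !esize_pair => h.
have e1 : esize ([::] : seq nat) = 1 by [].
have k0 : 0 < esize k by exact: esize_gt0.
by have := esize_addn c cv; case: ifP => _; rewrite !esize_pair ?esize_cons e1; lia.
Qed.
#[global] Hint Extern 1 (polytime (fun _ => greedy _)) =>
  apply: (polytime_comp1 polytime_greedy) : polytime.
#[global] Hint Resolve polytime_greedy : polytime.

Lemma polytime_purchase : polytime purchase.
Proof. rewrite /purchase; pt. Qed.
#[global] Hint Extern 1 (polytime (fun _ => purchase _)) =>
  apply: (polytime_comp1 polytime_purchase) : polytime.
#[global] Hint Resolve polytime_purchase : polytime.

Lemma polytime_algorithm : polytime algorithm.
Proof.
rewrite /algorithm; cbv zeta; pt.
Qed.

(** * Maximum flows *)

Definition swap (k : arc) : arc := (k.2, k.1).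

Lemma swapK : involutive swap. Proof. by case. Qed.

Lemma arcs_cons x y w : arcs (x :: y :: w) = (y, x) :: arcs (y :: w).
Proof. by []. Qed.

Lemma arcs_swap w : zip w (behead w) = [seq swap k | k <- arcs w].
Proof. by case: w => // x w; elim: w x => // y w IH x; rewrite arcs_cons /= -IH. Qed.

Lemma arcs_in w k : k \in arcs w -> k.1 \in w /\ k.2 \in w.
Proof.
case: w => // x w; elim: w x => // y w IH x; rewrite arcs_cons inE => /orP[/eqP->|/IH[h1 h2]].
  by rewrite /= !inE !eqxx ?orbT.
by rewrite ![_ \in x :: _]in_cons h1 h2 !orbT.
Qed.

(** Paths are stored from the sink end, so the tail of an arc comes one place after its head. This
    is why a simple path contains no arc together with its reverse. *)
Lemma arcs_index w k : uniq w -> k \in arcs w -> index k.1 w = (index k.2 w).+1.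
Proof.
case: w => // x w; elim: w x => // y w IH x /=; rewrite -/(arcs _) => /andP[nx uw].
rewrite arcs_cons inE => /orP[/eqP->|kin].
  by rewrite /= !eqxx; case: eqP nx => // ->; rewrite inE eqxx.
have [h1 h2] := arcs_in kin; have := IH y uw kin => /=.
have xE z : z \in y :: w -> (x == z) = false.
  by move=> zw; apply/eqP => xz; rewrite xz zw in nx.
by rewrite !xE // => ->.
Qed.

Lemma arcs_antisym w k : uniq w -> k \in arcs w -> swap k \notin arcs w.
Proof.
move=> uw kw; apply/negP => sw.
by have := arcs_index uw kw; have := arcs_index uw sw; rewrite /=; lia.
Qed.

Lemma arcs_uniq w : uniq w -> uniq (arcs w).
Proof.
case: w => // x w; elim: w x => // y w IH x /andP[nx uw].
rewrite arcs_cons cons_uniq IH // andbT; apply/negP => /arcs_in[_ xin].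
by rewrite xin in nx.
Qed.

Definition crosses (S : pred nat) (k : arc) : bool := S k.1 && ~~ S k.2.

(** Exits and entries alternate along a path, so their difference telescopes to the two ends. This
    takes the place of flow conservation. *)
Lemma count_crosses (S : pred nat) x w :
  count (crosses S) (arcs (x :: w)) + S x = count (crosses S \o swap) (arcs (x :: w)) + S (last x w).
Proof.
elim: w x => [|y w IH] x //; rewrite arcs_cons /= -/(arcs (y :: w)).
have := IH y; rewrite /crosses /=; case: (S x) (S y) => [] []; lia.
Qed.

Lemma count_crosses_path (S : pred nat) s w : w != [::] -> last 0 w = s -> S s -> ~~ S (head 0 w) ->
  count (crosses S) (arcs w) = (count (crosses S \o swap) (arcs w)).+1.
Proof.
case: w => // x w _ /= <- Sl Sx; have := count_crosses S x w.
by rewrite Sl (negbTE Sx) addn0 addn1.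
Qed.

Lemma count_leq (T : eqType) (a b : pred T) l :
  {in l, forall y, b y -> a y} -> count b l <= count a l.
Proof.
elim: l => // y l IH sub /=; apply: leq_add; last first.
  by apply: IH => z zl; apply: sub; rewrite in_cons zl orbT.
by have := sub y (mem_head _ _); case: (b y) => // ->.
Qed.

Lemma count_lt (T : eqType) (a b : pred T) l x :
  {in l, forall y, b y -> a y} -> x \in l -> a x -> ~~ b x -> count b l < count a l.
Proof.
elim: l => // y l IH sub; rewrite in_cons /=.
have sl : {in l, forall y, b y -> a y} by move=> z zl; apply: sub; rewrite in_cons zl orbT.
move=> /orP[/eqP<- ax bx|xl ax bx].
  by rewrite ax (negbTE bx) ltnS count_leq.
rewrite -addnS leq_add ?IH //; have := sub y (mem_head _ _).
by case: (b y) => // ->.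
Qed.

(** * Search for simple paths *)

Section FindPath.
Variables (n s : nat) (E : seq arc).
Hypothesis sn : s < n.

Definition is_path (w : seq nat) : Prop :=
  [/\ w != [::], uniq w, last 0 w = s & {subset arcs w <= E}].

Definition tips (acc : seq (seq nat)) : seq nat := [seq head 0 P | P <- acc].

(** That stored paths visit reached vertices only is what keeps a path simple when it is extended to
    an unreached vertex. *)
Definition grown (acc : seq (seq nat)) : Prop :=
  s \in tips acc /\ forall P, P \in acc -> is_path P /\ {subset P <= tips acc}.

Definition closed_tips (acc : seq (seq nat)) : Prop :=
  forall e, e \in E -> e.1 \in tips acc -> e.2 \in tips acc.

(** The measure, the number of arcs with an unreached head, is at most [size E] initially, and this
    is the number of rounds in [grow]. *)
Lemma grow_step_spec acc : grown acc -> grown (grow_step E acc) /\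
  (closed_tips acc /\ grow_step E acc = acc \/
   count (fun e => e.2 \notin tips (grow_step E acc)) E < count (fun e => e.2 \notin tips acc) E).
Proof.
move=> [sacc gr]; rewrite /grow_step -/(tips acc); set c := [seq e <- E | _].
case: ifP => [|/negbT] nc.
  split=> //; left; split=> // e eE e1; apply/negbNE/negP => e2.
  have : e \in c by rewrite mem_filter e1 e2.
  by rewrite (nilP nc).
have := mem_head (head (0, 0) c) (behead c).
have -> : head (0, 0) c :: behead c = c by case: (c) nc.
set e := head _ c; rewrite mem_filter => /andP[/andP[e1 e2] eE].
set P := head [::] _.
have [Pacc Pe] : P \in acc /\ head 0 P = e.1.
  have : has (fun P => head 0 P == e.1) acc.
    by case/mapP: e1 => Q Qacc ->; apply/hasP; exists Q.
  rewrite has_filter /P; case F: [seq _ <- _ | _] => [|Q l] //= _.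
  have : Q \in [seq P <- acc | head 0 P == e.1] by rewrite F inE eqxx.
  by rewrite mem_filter => /andP[/eqP-> ->].
have [[Pn Pu Pl PE] Pt] := gr _ Pacc.
split; last first.
  right; rewrite /tips /= -/(tips acc).
  apply: count_lt eE e2 _; first by move=> k _; rewrite inE negb_or => /andP[].
  by rewrite negbK inE eqxx.
have sub : {subset tips acc <= tips ((e.2 :: P) :: acc)}.
  by move=> x xa; rewrite /tips /= inE -/(tips acc) xa orbT.
split; first exact: sub.
move=> Q; rewrite inE => /orP[/eqP->|/gr[pQ tQ]]; last by split=> // x /tQ; exact: sub.
split.
  case: P {sub} Pacc Pe Pn Pu Pl PE Pt => // y P _ /= ye _ /andP[yP uP] lP PE Pt.
  split=> //=; last first.
  - by move=> k; rewrite arcs_cons inE => /orP[/eqP->|/PE//]; rewrite ye; case: (e) eE.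
  by rewrite yP uP !andbT; apply/negP => /Pt; apply/negP.
move=> x; rewrite inE => /orP[/eqP->|/Pt]; last exact: sub.
by rewrite /tips /= inE eqxx.
Qed.

Lemma grow_spec : grown (grow E s) /\ closed_tips (grow E s).
Proof.
have g0 : grown [:: [:: s]].
  by split; rewrite /tips /= ?mem_seq1 ?eqxx // => P; rewrite mem_seq1 => /eqP->; split.
suff H : forall (l : seq arc) acc, grown acc -> count (fun e => e.2 \notin tips acc) E <= size l ->
   let acc' := foldl (fun acc _ => grow_step E acc) acc l in grown acc' /\ closed_tips acc'.
  by apply: H => //; exact: count_size.
elim=> [|x l IH] acc gr /=.
  rewrite leqn0 -[_ == 0]negbK -lt0n -has_count => /hasPn h.
  by split=> // e /h; rewrite negbK.
have [gr'] := grow_step_spec gr.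
case=> [[cl ->] _|lt le]; last by apply: IH => //; rewrite -ltnS (leq_trans lt le).
have stay k : foldl (fun acc _ => grow_step E acc) acc k = acc.
  elim: k => //= _ k IHk; have [_ []] := grow_step_spec gr; first by case=> _ ->.
  move=> h; exfalso; move: h; rewrite ltnNge => /negP; apply.
  have -> : grow_step E acc = acc; last by [].
  rewrite /grow_step; case: ifP => // /negbT; rewrite /nilp size_eq0 -has_filter => /hasP[e eE /andP[e1]].
  by rewrite cl.
by rewrite stay.
Qed.

Lemma find_path_some : find_path n E s != [::] ->
  is_path (find_path n E s) /\ n <= head 0 (find_path n E s).
Proof.
have [[_ gr] _] := grow_spec; rewrite /find_path.
case F: [seq _ <- _ | _] => [|P l] //= _.
have : P \in [seq P <- grow E s | n <= head 0 P] by rewrite F inE eqxx.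
by rewrite mem_filter => /andP[-> /gr[]].
Qed.

Lemma find_path_none : find_path n E s = [::] ->
  exists S : pred nat, [/\ S s, forall x, S x -> x < n & forall e, e \in E -> S e.1 -> S e.2].
Proof.
have [[sg gr] cl] := grow_spec; rewrite /find_path => H.
exists (fun x => x \in tips (grow E s)); split=> // x /mapP[P Pg ->].
rewrite ltnNge; apply/negP => le.
have : P \in [seq P <- grow E s | n <= head 0 P] by rewrite mem_filter le.
case F: [seq _ <- _ | _] H => [|Q l] //= Q0 _.
have : Q \in [seq P <- grow E s | n <= head 0 P] by rewrite F inE eqxx.
by rewrite mem_filter => /andP[_ /gr[[]]]; rewrite Q0.
Qed.
End FindPath.

Definition cut (S : pred nat) (r : net) : nat := \sum_(e <- r | crosses S e.1) e.2.2.

Lemma sum_mem_count (K L : seq arc) (P : pred arc) :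
  uniq K -> uniq L -> (forall k, k \in L -> P k -> k \in K) ->
  \sum_(k <- K | P k) (k \in L) = count P L.
Proof.
move=> uK uL sub.
have -> : \sum_(k <- K | P k) (k \in L) = size [seq k <- K | P k && (k \in L)].
  elim: (K) => [|k l IH] /=; rewrite ?big_nil // big_cons IH.
  by case: (P k) => //=; case: (k \in L).
rewrite -size_filter; apply/perm_size/uniq_perm; rewrite ?filter_uniq // => k.
rewrite !mem_filter; case Pk: (P k) => //=; case kL: (k \in L) => //=.
by rewrite (sub k).
Qed.

Lemma uniq_fst (A T : eqType) (l : seq (A * T)) e e' :
  uniq [seq x.1 | x <- l] -> e \in l -> e' \in l -> e.1 = e'.1 -> e = e'.
Proof.
elim: l => //= x l IH /andP[nx ul]; rewrite !in_cons.
move=> /orP[/eqP->|el] /orP[/eqP->|el'] // ee; last exact: IH.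
  by rewrite ee (map_f fst el') in nx.
by rewrite -ee (map_f fst el) in nx.
Qed.

(** Forward crossings of [L] lower the cut by [d] each, backward ones raise it. The equation is
    additive to avoid truncated subtraction, and the last two hypotheses say that all these
    crossings are recorded in the network. *)
Lemma cut_push (S : pred nat) (L : seq arc) d (r : net) :
  uniq [seq e.1 | e <- r] -> uniq L -> (forall k, k \in L -> swap k \notin L) ->
  (forall e : arc * (nat * nat), e \in r -> e.1 \in L -> d <= e.2.2) ->
  (forall k, k \in L -> crosses S k -> k \in [seq e.1 | e <- r]) ->
  (forall k, k \in L -> crosses S (swap k) -> swap k \in [seq e.1 | e <- r]) ->
  cut S (push L d r) + d * count (crosses S) L =
  cut S r + d * count (crosses S \o swap) L.
Proof.
move=> ur uL asL dL cK bK.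
rewrite -(sum_mem_count ur uL cK).
have -> : count (crosses S \o swap) L = count (crosses S) [seq swap k | k <- L] by rewrite count_map.
rewrite -(@sum_mem_count [seq e.1 | e <- r] [seq swap k | k <- L]) //; last first.
- by move=> k /mapP[k' k'L ->]; exact: bK.
- by rewrite (map_inj_uniq (can_inj swapK)).
rewrite /cut /push !big_map /=.
have D (F : arc * (nat * nat) -> nat) : d * \sum_(e <- r | crosses S e.1) F e =
    \sum_(e <- r | crosses S e.1) d * F e by exact: big_distrr.
rewrite !D -!big_split /= [LHS]big_seq_cond [RHS]big_seq_cond.
apply: eq_bigr => -[k [u x]] /andP[er _] /=.
have -> : (k \in [seq swap k' | k' <- L]) = (swap k \in L).
  by rewrite -{1}(swapK k) (mem_map (can_inj swapK)).
rewrite -/(swap k); case kL: (k \in L).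
  by rewrite (negbTE (asL _ kL)); have := dL _ er kL; rewrite /=; lia.
by case: (swap k \in L); lia.
Qed.

(** * Capacity scaling *)

Section Flow.
Variables (n s : nat) (K : seq arc).
Hypothesis sn : s < n.
Hypothesis uK : uniq K.
Hypothesis symK : forall k, k \in K -> k.2 < n -> swap k \in K.

Definition valid (S : pred nat) : Prop := S s /\ forall x, S x -> x < n.

(** Skew symmetry of the net flow, capacity minus residual, stated without negative numbers. *)
Definition antisym (r : net) : Prop := forall e e' : arc * (nat * nat), e \in r -> e' \in r ->
  e'.1 = swap e.1 -> e.2.1 + e'.2.1 = e.2.2 + e'.2.2.

Definition on_arcs (r : net) : Prop := [seq e.1 | e <- r] = K.

Lemma on_arcs_push L d r : on_arcs r -> on_arcs (push L d r).
Proof. by rewrite /on_arcs /push -map_comp. Qed.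

Lemma on_arcs_mem r e : on_arcs r -> e \in r -> e.1 \in K.
Proof. by move=> <- er; apply/mapP; exists e. Qed.

Lemma on_arcsP r k : on_arcs r -> k \in K -> exists2 e, e \in r & e.1 = k.
Proof. by move=> <- /mapP[e er ->]; exists e. Qed.

Lemma on_arcs_eq r e e' : on_arcs r -> e \in r -> e' \in r -> e.1 = e'.1 -> e = e'.
Proof. by move=> rK; apply: uniq_fst; rewrite rK. Qed.

Lemma antisym_push (L : seq arc) d r : (forall k, k \in L -> swap k \notin L) ->
  (forall e : arc * (nat * nat), e \in r -> e.1 \in L -> d <= e.2.2) -> antisym r -> antisym (push L d r).
Proof.
move=> asL dL as_r _ _ /mapP[e er ->] /mapP[e' er' ->] /= ee.
have := as_r e e' er er' ee; rewrite -!/(swap _) ee swapK.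
case eL: (e.1 \in L).
  by rewrite (negbTE (asL _ eL)); have := dL e er eL; lia.
case eL': (swap e.1 \in L) => //.
by have := dL e' er'; rewrite ee eL' => /(_ isT); lia.
Qed.

Lemma path_arcs_in w (E : seq arc) : is_path s E w -> {subset E <= K} ->
  [/\ uniq (arcs w), (forall k, k \in arcs w -> swap k \notin arcs w) & {subset arcs w <= K}].
Proof.
move=> [_ uw _ sub] EK; split; [exact: arcs_uniq| |by move=> k /sub/EK].
by move=> k; exact: arcs_antisym.
Qed.

(** Arcs into sinks have no reverse in [K], but sinks lie outside valid cuts: the reverse of an arc
    crosses such a cut only if the head of the arc is an inner vertex, where [symK] applies. *)
Lemma crosses_back S k : valid S -> k \in K -> crosses S (swap k) -> swap k \in K.
Proof. by move=> [_ Sn] kK /andP[/= /Sn k2 _]; exact: symK. Qed.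

Lemma path_crossing S w E : is_path s E w -> n <= head 0 w -> valid S ->
  count (crosses S) (arcs w) = (count (crosses S \o swap) (arcs w)).+1.
Proof.
move=> [wn _ lw _] hw [Ss Sn]; apply: count_crosses_path lw Ss _ => //.
by apply/negP => /Sn; lia.
Qed.

Lemma usableP d r e : on_arcs r -> e \in r -> e.1 \in usable d r -> d <= e.2.2.
Proof.
move=> rK er /mapP[e']; rewrite mem_filter => /andP[de er'] ee.
by rewrite (on_arcs_eq rK er er' ee).
Qed.

Lemma augment_spec d r : on_arcs r -> antisym r -> 0 < d ->
  [/\ on_arcs (augment n s r d), antisym (augment n s r d)
    & (forall S, valid S -> cut S (augment n s r d) + d = cut S r) \/
      (augment n s r d = r /\ exists2 S, valid S & cut S r <= size r * d.-1)].
Proof.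
move=> rK ar d0; rewrite /augment; set E := usable d r.
have EK : {subset E <= K}.
  by move=> k /mapP[e]; rewrite mem_filter => /andP[_ er] ->; exact: on_arcs_mem er.
case: ifP => [|/negbT] wn.
  split=> //; right; split=> //.
  have [S [Ss Sn Scl]] : exists S : pred nat,
      [/\ S s, forall x, S x -> x < n & forall e, e \in E -> S e.1 -> S e.2].
    by apply: find_path_none => //; apply/nilP.
  exists S => //; rewrite /cut big_seq_cond.
  apply: (@leq_trans (\sum_(e <- r) d.-1)); last by rewrite big_const_seq iter_addn_0 count_predT mulnC.
  rewrite [leqRHS]big_seq [leqRHS](bigID (fun e => crosses S e.1)) /=.
  apply: leq_trans (leq_addr _ _); apply: leq_sum => e /andP[er /andP[S1 S2]].
  have : e.1 \notin E by apply/negP => /Scl /(_ S1); apply/negP.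
  move=> nE; have : e.2.2 < d; last by lia.
  rewrite ltnNge; apply/negP => de; move/negP: nE; apply.
  by apply/mapP; exists e => //; rewrite mem_filter de.
have [pw hw] : is_path s E (find_path n E s) /\ n <= head 0 (find_path n E s).
  by apply: find_path_some => //; rewrite -size_eq0.
set w := find_path _ _ _ in pw hw *.
have [ua aa sa] := path_arcs_in pw EK.
have dw e : e \in r -> e.1 \in arcs w -> d <= e.2.2.
  by move=> er ew; apply: (usableP rK er); case: pw => _ _ _; apply.
split; [exact: on_arcs_push|exact: antisym_push|].
left=> S vS.
have := @cut_push S (arcs w) d r; rewrite rK => /(_ uK ua aa dw (fun k kw _ => sa k kw)).
move=> /(_ (fun k kw => crosses_back vS (sa k kw))).
rewrite (path_crossing pw hw vS); nia.
Qed.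

(** The value of the flow is the common amount [v] by which all valid cuts have dropped. *)
Definition flow_inv (r0 r : net) : Prop :=
  [/\ on_arcs r, antisym r, keys r = keys r0 &
      exists v, forall S, valid S -> cut S r + v = cut S r0].

Lemma flow_inv_augment r0 r d : 0 < d -> flow_inv r0 r -> flow_inv r0 (augment n s r d).
Proof.
move=> d0 [rK ar kr [v vP]]; have [rK' ar' H] := augment_spec rK ar d0.
split=> //; first by rewrite keys_augment.
case: H => [H|[-> _]]; last by exists v.
by exists (d + v) => S vS; rewrite addnA H // vP.
Qed.

(** The bound on some cut allows [d] per remaining attempt. A successful attempt takes [d] off this
    cut; a failed one exhibits a cut, possibly another one, that is already below the final
    bound. *)
Lemma max_flow_phase r0 r d m j : 0 < d -> flow_inv r0 r -> size r0 = m ->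
  (exists2 S, valid S & cut S r <= m * d.-1 + j * d) ->
  let r' := foldl (augment n s) r (nseq j d) in
  flow_inv r0 r' /\ exists2 S, valid S & cut S r' <= m * d.-1.
Proof.
move=> d0 + sm; elim: j r => [|j IH] r fi [S vS cS] /=.
  by split=> //; exists S => //; rewrite mul0n addn0 in cS.
have fi' := flow_inv_augment d0 fi; apply: IH => //.
have [rK ar kr _] := fi.
have sr : size r = m by rewrite -size_keys kr size_keys.
have [_ _ [H|[-> [S' vS' cS']]]] := augment_spec rK ar d0.
  by exists S => //; have := H S vS; rewrite mulSn in cS; lia.
by exists S' => //; rewrite sr in cS'; lia.
Qed.

Lemma max_flow_spec r : on_arcs r -> antisym r ->
  flow_inv r (max_flow n s r) /\ exists2 S, valid S & cut S (max_flow n s r) = 0.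
Proof.
move=> rK ar.
have fi : flow_inv r r by split=> //; exists 0 => S _; rewrite addn0.
suff H b r' : flow_inv r r' -> (exists2 S, valid S & cut S r' <= size r * (2 ^ b).-1) ->
  let r'' := foldl (augment n s) r' (flatten [seq [seq p | _ <- r] | p <- rev [seq 2 ^ i | i <- iota 0 b]]) in
  flow_inv r r'' /\ exists2 S, valid S & cut S r'' <= 0.
  have [] := H (size (bits (total r))) r fi.
    (* Before the first phase every residual is below the power of 2 that exceeds the total, so the
       cut around [s] meets the bound. *)
    exists (pred1 s); first by split=> [|x /eqP->]; rewrite /= ?eqxx.
    rewrite /cut; apply: (@leq_trans (\sum_(e <- r) (2 ^ size (bits (total r))).-1)); last first.
      by rewrite big_const_seq iter_addn_0 count_predT mulnC.
    rewrite [leqRHS](bigID (fun e => crosses (pred1 s) e.1)) /=.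
    apply: leq_trans (leq_addr _ _); rewrite big_seq_cond [leqRHS]big_seq_cond.
    apply: leq_sum => e /andP[er _]; have := allP (leq_total r) e er.
    have : total r < 2 ^ size (bits (total r)) by rewrite -size_bits_leq.
    by lia.
  rewrite /max_flow /schedule powsE => fi' [S vS]; rewrite leqn0 => /eqP c0.
  by split=> //; exists S.
elim: b r' => [|b IH] r' fi' [S vS cS].
  by split=> //; exists S => //; rewrite muln0 in cS.
rewrite -[X in iota 0 X]addn1 iotaD map_cat rev_cat /= foldl_cat.
have -> : [seq 2 ^ (0 + b) | _ <- r] = nseq (size r) (2 ^ b) by elim: (r) => //= _ l ->.
have p0 : 0 < 2 ^ b by rewrite expn_gt0.
have [|fi2 ex2] := @max_flow_phase r r' (2 ^ b) (size r) (size r) p0 fi' erefl.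
  exists S => //; apply: leq_trans cS _; rewrite expnS -mulnDr leq_mul2l; apply/orP; right; lia.
exact: IH.
Qed.

(** * Decomposition into paths and duality *)

Definition load (P : seq (seq nat * nat)) (k : arc) : nat := \sum_(p <- P) p.2 * (k \in arcs p.1).

Definition unsaturated (e : arc * (nat * nat)) : bool := e.2.2 < e.2.1.

Definition cancel_inv (r0 : net) (st : net * seq (seq nat * nat)) : Prop :=
  [/\ on_arcs st.1, antisym st.1 & keys st.1 = keys r0] /\
  [/\ forall S, valid S -> cut S st.1 = cut S r0 + flow_value st.2,
      forall p, p \in st.2 -> is_path s K p.1 /\ n <= head 0 p.1 &
      forall e0 e : arc * (nat * nat), e0 \in r0 -> e \in st.1 -> e.1 = e0.1 ->
        load st.2 e.1 + (e.2.1 - e.2.2) <= e0.2.1 - e0.2.2].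

(** The bottleneck arc loses all its flow and no arc acquires any, so the number of flow-carrying
    arcs drops. One round per arc of the network is therefore enough. *)
Lemma cancel_spec r0 st : cancel_inv r0 st -> cancel_inv r0 (cancel n s st) /\
  (count unsaturated (cancel n s st).1 < count unsaturated st.1 \/
   cancel n s st = st /\ exists2 S, valid S &
     forall e, e \in st.1 -> unsaturated e -> S e.1.1 -> S e.1.2).
Proof.
case: st => r P [[rK ar kr] [cr pr lr]]; rewrite /= in rK ar kr cr pr lr.
rewrite /cancel /=; set E := flow_support r.
have EK : {subset E <= K}.
  by move=> k /mapP[e]; rewrite mem_filter => /andP[_ er] ->; exact: on_arcs_mem er.
case: ifP => [|/negbT] wn.
  split; first by split.
  right; split=> //.
  have [S [Ss Sn Scl]] : exists S : pred nat,
      [/\ S s, forall x, S x -> x < n & forall e, e \in E -> S e.1 -> S e.2].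
    by apply: find_path_none => //; apply/nilP.
  exists S => // e er ue; apply: Scl; apply/mapP; exists e => //.
  by rewrite mem_filter er andbT.
have [pw hw] : is_path s E (find_path n E s) /\ n <= head 0 (find_path n E s).
  by apply: find_path_some => //; rewrite -size_eq0.
set w := find_path _ _ _ in pw hw *.
have [ua aa sa] := path_arcs_in pw EK.
have uw e : e \in r -> e.1 \in arcs w -> unsaturated e.
  move=> er ew; have [_ _ _ /(_ _ ew)] := pw.
  case/mapP => e'; rewrite mem_filter => /andP[ue' er'] ee.
  by rewrite (on_arcs_eq rK er er' ee).
rewrite arcs_swap; set L := [seq swap k | k <- arcs w].
have memL k : (k \in L) = (swap k \in arcs w).
  by rewrite -{1}(swapK k) (mem_map (can_inj swapK)).
set b := bottleneck (arcs w) r.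
have [e1 [e1r e1w e1b]] : exists e1 : arc * (nat * nat), [/\ e1 \in r, e1.1 \in arcs w & b = e1.2.1 - e1.2.2].
  have : [seq e.2.1 - e.2.2 | e <- r & e.1 \in arcs w] != [::].
    have [wn' _ lw _] := pw.
    have [k kw] : exists k, k \in arcs w.
      case: (w) wn' lw hw => // x [|y t] _ /=; first by move=> ->; lia.
      by move=> _ _; exists (y, x); rewrite arcs_cons in_cons eqxx.
    have [e er ek] := on_arcsP rK (sa k kw).
    rewrite -size_eq0 size_map size_eq0 -has_filter.
    by apply/hasP; exists e; rewrite ?ek.
  move/minl_in/mapP => [e]; rewrite mem_filter => /andP[ew er] bE.
  by exists e.
have ble (e : arc * (nat * nat)) : e \in r -> e.1 \in arcs w -> b <= e.2.1 - e.2.2.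
  by move=> er ew; apply: minl_le; apply/mapP; exists e => //; rewrite mem_filter ew.
have b0 : 0 < b by have := uw e1 e1r e1w; rewrite e1b /unsaturated; lia.
(* By skew symmetry the reverse of a flow-carrying arc has a residual above its capacity, by at
   least [b] on this path; taking [b] away does not make it flow-carrying. *)
have opp (e : arc * (nat * nat)) : e \in r -> swap e.1 \in arcs w -> e.2.1 + b <= e.2.2.
  move=> er ew; have [e' er' ee'] := on_arcsP rK (sa _ ew).
  have := ble e' er'; rewrite ee' ew => /(_ isT) h.
  by have := ar e e' er er' ee'; have := uw e' er'; rewrite ee' ew /unsaturated => /(_ isT); lia.
have uL : uniq L by rewrite (map_inj_uniq (can_inj swapK)).
have aL k : k \in L -> swap k \notin L.
  by rewrite !memL => kw; rewrite aa.
have dL (e : arc * (nat * nat)) : e \in r -> e.1 \in L -> b <= e.2.2.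
  by rewrite memL => er ew; have := opp e er ew; lia.
split; last first.
  left; rewrite /push count_map.
  apply: (count_lt _ e1r); [|exact: uw|].
    move=> e er; rewrite /= /unsaturated /= -/(swap e.1) !memL swapK.
    case ew: (e.1 \in arcs w); first by move=> _; exact: uw.
    by case ew': (swap e.1 \in arcs w) => //; have := opp e er ew'; clear; lia.
  rewrite /unsaturated /= -/(swap e1.1) !memL swapK e1w (negbTE (aa _ e1w)) e1b.
  by have := uw e1 e1r e1w; rewrite /unsaturated; lia.
split; split=> /=.
- exact: on_arcs_push.
- exact: antisym_push.
- by rewrite keys_push.
- move=> S vS.
  have := @cut_push S L b r; rewrite rK => /(_ uK uL aL dL).
  have cK k : k \in L -> crosses S k -> k \in K.
    rewrite memL => kw cS; have := @crosses_back S (swap k) vS (sa _ kw); rewrite swapK.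
    exact.
  have bK k : k \in L -> crosses S (swap k) -> swap k \in K by rewrite memL => /sa.
  move=> /(_ cK bK).
  have -> : count (crosses S \o swap) L = (count (crosses S) L).+1.
    rewrite /L !count_map -(path_crossing pw hw vS); apply: eq_count => k /=.
    by rewrite swapK.
  rewrite cr // /flow_value /=; nia.
- move=> p; rewrite in_cons => /orP[/eqP->|]; last exact: pr.
  by split=> //=; have [? ? ? sub] := pw; split=> // k /sub/EK.
- move=> e0 _ e0r /mapP[e er ->] /= ee0; have := lr e0 e e0r er ee0.
  rewrite /load big_cons /= -/(load P e.1) -/(swap e.1) !memL swapK.
  case ew: (e.1 \in arcs w).
    by rewrite (negbTE (aa _ ew)); have := ble e er ew; have := uw e er ew; rewrite /unsaturated; clear; lia.
  case ew': (swap e.1 \in arcs w); last by rewrite muln0 add0n.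
  by have := opp e er ew'; clear; lia.
Qed.


Lemma cancel_iter r0 st (l : net) : cancel_inv r0 st -> count unsaturated st.1 <= size l ->
  let st' := foldl (fun st _ => cancel n s st) st l in
  cancel_inv r0 st' /\ exists2 S, valid S &
     forall e, e \in st'.1 -> unsaturated e -> S e.1.1 -> S e.1.2.
Proof.
elim: l st => [|x l IH] st inv /=.
  rewrite leqn0 => c0; split=> //; exists (pred1 s).
    by split=> [|y /eqP->]; rewrite /= ?eqxx.
  move=> e er ue; have := has_count unsaturated st.1; rewrite (eqP c0) => /negbT/hasPn/(_ e er).
  by rewrite ue.
have [inv' [lt|[E exS]]] := cancel_spec inv.
  by move=> le; apply: IH => //; rewrite -ltnS (leq_trans lt le).
move=> _; rewrite E.
have -> : foldl (fun st _ => cancel n s st) st l = st by elim: (l) => //= _ k IHk; rewrite E.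
by split.
Qed.

Lemma flow_valueE P : flow_value P = \sum_(p <- P) p.2.
Proof. by elim: P => [|p P IH]; rewrite ?big_nil // big_cons -IH. Qed.

Definition capacity (S : pred nat) (E : seq (arc * nat)) : nat :=
  \sum_(e <- E | crosses S e.1) e.2.

(** Opposite arcs have equal capacity and skew-symmetric flow, so at most one of them carries a
    positive amount. This gives the joint bound on both directions, as undirected edges demand. *)
Theorem flow_paths_spec (E : seq (arc * nat)) : [seq e.1 | e <- E] = K ->
  (forall e e' : arc * nat, e \in E -> e' \in E -> e'.1 = swap e.1 -> e.2 = e'.2) ->
  let P := flow_paths n s E in
  [/\ forall p, p \in P -> is_path s K p.1 /\ n <= head 0 p.1,
      forall e : arc * nat, e \in E -> load P e.1 <= e.2,
      forall e : arc * nat, e \in E -> swap e.1 \in K -> load P e.1 + load P (swap e.1) <= e.2 &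
      exists2 S, valid S & capacity S E <= flow_value P].
Proof.
move=> EK symE.
set r0 := [seq (e.1, (e.2, e.2)) | e <- E].
have rK : on_arcs r0 by rewrite /on_arcs -map_comp.
have a0 : antisym r0.
  by move=> _ _ /mapP[e er ->] /mapP[e' er' ->] /=.
have [[mK ma mk [v vP]] [S0 vS0 S00]] := max_flow_spec rK a0.
set r1 := max_flow n s r0 in mK ma mk vP S00.
have inv0 : cancel_inv r1 (r1, [::]).
  split; split=> //=; first by move=> S vS; rewrite addn0.
  by move=> e0 e e0r er ee; rewrite (on_arcs_eq mK er e0r ee) /load big_nil.
have [] := cancel_iter inv0 (count_size _ _).
rewrite -/(decompose n s r1); set st := foldl _ _ _.
have -> : flow_paths n s E = st.2 by [].
case: st => r P /= [[rK' ar' kr'] [cr pr lr]] [S1 vS1 cl].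
have capE S : capacity S E = cut S r0 by rewrite /capacity /cut big_map.
have keyE e : e \in r1 -> (e.1, e.2.1) \in E.
  move=> er; have : (e.1, e.2.1) \in keys r1 by apply/mapP; exists e.
  rewrite mk /keys -map_comp => /mapP[e' e'E /= [-> ->]].
  by case: e' e'E.
have atE (e : arc * nat) : e \in E -> exists2 x : nat, (e.1, (e.2, x)) \in r1 & load P e.1 <= e.2 - x.
  move=> eE; have eK : e.1 \in K by rewrite -EK; apply/mapP; exists e.
  have [e1 e1r ee1] := on_arcsP mK eK.
  have [e2 e2r ee2] := on_arcsP rK' eK.
  have e1e : e1.2.1 = e.2.
    have := keyE e1 e1r; rewrite ee1 => h.
    by have := @uniq_fst _ _ E (e.1, e1.2.1) e; rewrite EK => /(_ uK h eE erefl)/(congr1 snd).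
  exists e1.2.2; first by rewrite -e1e -ee1; case: (e1) e1r => ? [? ?].
  by have := lr e1 e2 e1r e2r; rewrite ee2 ee1 e1e => /(_ erefl); apply: leq_trans; exact: leq_addr.
split=> //.
- by move=> e /atE[x _]; lia.
- move=> e eE; rewrite -EK => /mapP[e' e'E ee].
  have [x xr lx] := atE e eE; have [y yr ly] := atE e' e'E.
  have h := symE e e' eE e'E (esym ee).
  by rewrite ee; have := ma _ _ xr yr (esym ee); rewrite /=; lia.
exists S0 => //.
have h0 := vP S0 vS0; rewrite S00 add0n in h0.
have h1 := vP S1 vS1.
have h2 := cr S1 vS1.
(* Cycles of flow may survive the decomposition, so the values are compared at the cut [S1] where it
   got stuck: no flow crosses [S1] outwards any more, hence the whole value [v] has been peeled
   off. *)
have : cut S1 r0 <= cut S1 r.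
  have -> : cut S1 r0 = \sum_(e <- keys r | crosses S1 e.1) e.2.
    by rewrite kr' mk /cut /keys !big_map.
  rewrite /cut /keys big_map big_seq_cond [leqRHS]big_seq_cond.
  apply: leq_sum => e /andP[er /andP[c1 c2]] /=.
  by rewrite leqNgt; apply: contra c2 => ue; exact: cl er ue c1.
by rewrite -h1 h2 leq_add2l capE -h0.
Qed.

Lemma weak_duality (E : seq (arc * nat)) P S : [seq e.1 | e <- E] = K ->
  (forall p, p \in P -> is_path s K p.1 /\ n <= head 0 p.1) ->
  (forall e : arc * nat, e \in E -> load P e.1 <= e.2) ->
  valid S -> flow_value P <= capacity S E.
Proof.
move=> EK pP lP vS; rewrite flow_valueE /capacity.
apply: (@leq_trans (\sum_(e <- E | crosses S e.1) load P e.1)); last first.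
  by rewrite big_seq_cond [leqRHS]big_seq_cond; apply: leq_sum => e /andP[/lP].
rewrite /load exchange_big /= big_seq [leqRHS]big_seq; apply: leq_sum => p pin.
have [pw hw] := pP p pin; have [_ uw _ sub] := pw.
have -> : \sum_(e <- E | crosses S e.1) p.2 * (e.1 \in arcs p.1) =
    p.2 * \sum_(k <- K | crosses S k) (k \in arcs p.1) by rewrite -EK big_map big_distrr.
rewrite sum_mem_count //; [|exact: arcs_uniq|by move=> k /sub].
by rewrite (path_crossing pw hw vS) mulnS leq_addr.
Qed.

End Flow.

(** * The greedy purchase *)

Section Densest.
Implicit Types b x y : (nat * nat) * nat.

Definition denser b x : bool := x.2 * b.1.2 <= b.2 * x.1.2.

(** With free vertices the comparison by cross multiplication is not transitive, since 0/0 compares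
    with everything. But the strict test only replaces an entry of positive cost, and this cost can
    be cancelled. *)
Lemma densest_ge g x : x \in g -> denser (densest g) x.
Proof.
rewrite /densest; move: (head _ g) => b0; set f := fun _ _ => _.
have fx b z : denser (f b z) z by rewrite /denser /f; case: ltnP.
have fy b z y : denser b y -> denser (f b z) y.
  rewrite /denser /f; case: ltnP => // lt le.
  have bc : 0 < b.1.2 by case: b.1.2 lt => //; rewrite muln0.
  rewrite -(leq_pmul2r bc); apply: (@leq_trans (b.2 * y.1.2 * z.1.2)).
    by rewrite mulnAC leq_mul2r le orbT.
  by rewrite mulnAC [leqRHS]mulnAC leq_mul2r (ltnW lt) orbT.
have fl l b y : denser b y -> denser (foldl f b l) y.
  by elim: l b => //= z l IH b h; apply: IH; exact: fy.
elim: g b0 => //= z g IH b0; rewrite in_cons => /orP[/eqP->|]; last exact: IH.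
by apply: fl; exact: fx.
Qed.
End Densest.

Section Greedy.
Variables (I : raw_instance) (O : seq nat).
Local Notation f := (capture I).
Hypothesis f_mono : forall A B, {subset A <= B} -> f A <= f B.
Hypothesis f_submod : forall A B C D : seq nat,
  (forall x, x \in C -> (x \in A) || (x \in B)) ->
  (forall x, x \in D -> (x \in A) && (x \in B)) -> f C + f D <= f A + f B.
Hypothesis uniq_items : uniq [seq x.1 | x <- items I].
Hypothesis O_items : {subset O <= [seq x.1 | x <- items I]}.

Definition weight (T : seq nat) : nat := \sum_(x <- items I) (x.1 \in T) * x.2.1.

Hypothesis O_cheap : weight O <= limit I.

Lemma weight_cons v c C T : (v, (c, C)) \in items I -> v \notin T -> weight (v :: T) = weight T + c.
Proof.
move=> vi vT; rewrite /weight.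
rewrite (eq_bigr (fun x : nat * (nat * nat) => (x.1 \in T) * x.2.1 + (x.1 == v) * x.2.1)); last first.
  move=> x _; rewrite in_cons; case: eqP => [->|]; last by rewrite addn0.
  by rewrite (negbTE vT).
rewrite big_split /=; congr (_ + _).
rewrite (bigD1_seq (v, (c, C))) //=; last exact: map_uniq uniq_items.
rewrite eqxx mul1n big_seq_cond big1 ?addn0 // => x /andP[xi xv].
case: eqP => // xe; case/eqP: xv.
by apply: (uniq_fst uniq_items).
Qed.

Lemma item_weight x : x \in items I -> x.1 \in O -> x.2.1 <= limit I.
Proof.
move=> xi xO; apply: leq_trans O_cheap; rewrite /weight.
by rewrite (bigD1_seq x) //= ?xO ?mul1n ?leq_addr //; exact: map_uniq uniq_items.
Qed.

Lemma gainsP T y : y \in gains I T ->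
  exists C, [/\ (y.1.1, (y.1.2, C)) \in items I, y.1.1 \notin T, y.1.2 <= limit I
    & y.2 = f (y.1.1 :: T) - f T].
Proof.
case/mapP => -[v [c C]]; rewrite mem_filter => /andP[/andP[vT le] vi] ->.
by exists C.
Qed.

Lemma mem_gains T x : x \in items I -> x.1 \notin T -> x.2.1 <= limit I ->
  (x.1, x.2.1, f (x.1 :: T) - f T) \in gains I T.
Proof. by move=> xi xT le; apply/mapP; exists x => //; rewrite mem_filter xT le. Qed.

Lemma f_cons v T : f T <= f (v :: T).
Proof. by apply: f_mono => x xT; rewrite in_cons xT orbT. Qed.

Lemma f_union (L T : seq nat) : f (L ++ T) <= f T + \sum_(o <- L) (f (o :: T) - f T).
Proof.
elim: L => [|o L IH]; first by rewrite big_nil addn0.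
rewrite big_cons /=.
have := @f_submod (L ++ T) (o :: T) (o :: L ++ T) T.
have c1 x : x \in o :: L ++ T -> (x \in L ++ T) || (x \in o :: T).
  by rewrite !in_cons !mem_cat; case: (x == o) (x \in L) (x \in T) => [] [] [].
have c2 x : x \in T -> (x \in L ++ T) && (x \in o :: T).
  by rewrite in_cons mem_cat => ->; rewrite !orbT.
move=> /(_ c1 c2); have := f_cons o T; move: IH; move: (\sum_(_ <- _) _) => sm.
lia.
Qed.

(** The vertices of [O] outside [T] jointly gain at least [f O - f T] and cost at most the limit, so
    the best ratio is no worse than this average. Each is affordable alone and thus listed in
    [gains]. *)
Lemma greedy_gain T : gains I T != [::] ->
  (f O - f T) * (densest (gains I T)).1.2 <= (densest (gains I T)).2 * limit I.
Proof.
move=> gT; set b := densest _.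
pose L := [seq x.1 | x <- items I & (x.1 \in O) && (x.1 \notin T)].
have le : f O - f T <= \sum_(o <- L) (f (o :: T) - f T).
  rewrite leq_subLR; apply: leq_trans (f_union L T); apply: f_mono => x xO.
  rewrite mem_cat; case xT: (x \in T); rewrite ?orbT // orbF.
  have [y yi xy] := mapP (O_items xO); apply/mapP; exists y => //.
  by rewrite mem_filter -xy xO xT.
apply: leq_trans (leq_mul le (leqnn _)) _; rewrite /L big_map big_filter.
have -> : (\sum_(x <- items I | (x.1 \in O) && (x.1 \notin T)) (f (x.1 :: T) - f T)) * b.1.2 =
   \sum_(x <- items I | (x.1 \in O) && (x.1 \notin T)) (f (x.1 :: T) - f T) * b.1.2 by rewrite big_distrl.
apply: (@leq_trans (b.2 * weight O)); last by rewrite leq_mul2l O_cheap orbT.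
have -> : b.2 * weight O = \sum_(x <- items I) b.2 * ((x.1 \in O) * x.2.1) by rewrite /weight big_distrr.
rewrite [leqRHS](bigID (fun x : nat * (nat * nat) => (x.1 \in O) && (x.1 \notin T))) /=.
apply: leq_trans (leq_addr _ _).
rewrite big_seq_cond [leqRHS]big_seq_cond; apply: leq_sum => x /andP[xi /andP[xO xT]].
rewrite xO mul1n.
exact: (densest_ge (mem_gains xi xT (item_weight xi xO))).
Qed.

(** Either half of [f O] is reached, or the average gain per cost so far is at least
    [f O / (2 * limit)]. Below half, [greedy_gain] guarantees this ratio for the next vertex, so the
    property persists, and it holds for a rejected vertex too. *)
Definition greedy_inv (st : seq nat * (nat * seq nat)) : Prop :=
  [/\ {subset st.1 <= [seq x.1 | x <- items I]}, st.2.1 = weight st.1, weight st.1 <= limit I &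
    if nilp st.2.2 then f O <= 2 * f st.1 \/ f O * weight st.1 <= 2 * limit I * f st.1
    else exists v c C, [/\ st.2.2 = [:: v], (v, (c, C)) \in items I, c <= limit I
                         & f O <= 2 * f (v :: st.1)]].

Definition unbought (T : seq nat) : nat := count (fun x : nat * (nat * nat) => x.1 \notin T) (items I).

Lemma greedy_step_spec st : greedy_inv st -> greedy_inv (greedy_step I st) /\
  (unbought (greedy_step I st).1 < unbought st.1 \/
   ~~ nilp (greedy_step I st).2.2 \/ (greedy_step I st = st /\ gains I st.1 = [::])).
Proof.
case: st => T [w k] [/= sT -> wT q]; rewrite /greedy_step /=.
case: ifP => kn.
  by split; [split=> //=; move: q; rewrite (negbTE kn)|right; left].
have {}kn : k = [::] by apply/nilP; rewrite -[nilp k]negbK kn.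
rewrite {}kn /= in q *.
case: ifP => [/nilP g0|/negbT g0]; first by split=> //; right; right.
have {}g0 : gains I T != [::] by rewrite -size_eq0.
have gg := greedy_gain g0; have := gainsP (densest_in g0).
set b := densest _ in gg *; case: b gg => [[v c] d] /= gg [C [vi vT cl dE]].
have fv : f (v :: T) = f T + d by rewrite dE subnKC // f_cons.
have sv : {subset v :: T <= [seq x.1 | x <- items I]}.
  move=> x; rewrite in_cons => /orP[/eqP->|/sT//].
  by apply/mapP; exists (v, (c, C)).
have key : f O <= 2 * f (v :: T) \/ f O * (weight T + c) <= 2 * limit I * f (v :: T).
  case: q => [q|q]; first by left; rewrite fv; lia.
  case: (leqP (f O) (2 * f T)) => h; first by left; rewrite fv; lia.
  right; rewrite fv !mulnDr; apply: leq_add => //.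
  apply: (@leq_trans (2 * ((f O - f T) * c))); last by rewrite -mulnA leq_mul2l (mulnC (limit I)) gg orbT.
  by rewrite mulnA leq_mul2r; apply/orP; right; lia.
case: ifP => le.
  split; [split=> //=|left].
  - by rewrite (weight_cons vi vT).
  - by rewrite (weight_cons vi vT).
  - by rewrite (weight_cons vi vT).
  apply: (count_lt _ vi) => /=; rewrite ?in_cons ?eqxx //.
  by move=> x _; rewrite in_cons negb_or => /andP[].
split; last by right; left.
split=> //=; exists v, c, C; split=> //.
case: key => // key.
(* A rejected vertex brings the weight above the limit; the ratio then gives half of [f O] after
   cancelling the limit. *)
move/negbT: le; rewrite -ltnNge => lt.
have k2 := leq_trans (leq_mul (leqnn (f O)) lt) key.
case: (posnP (f O)) => [->//|F0].
have : 0 < limit I by case: (limit I) k2 => //; rewrite muln0 mul0n muln1 leqNgt F0.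
move=> B0; rewrite -(leq_pmul2r B0).
apply: (@leq_trans (f O * (limit I).+1)); first by rewrite leq_mul2l leqnSn orbT.
by apply: leq_trans k2 _; rewrite mulnAC.
Qed.

Lemma greedy_iter st (l : seq (nat * (nat * nat))) : greedy_inv st ->
  (nilp st.2.2 -> gains I st.1 != [::] -> unbought st.1 <= size l) ->
  let st' := foldl (fun st _ => greedy_step I st) st l in
  greedy_inv st' /\ (nilp st'.2.2 -> gains I st'.1 = [::]).
Proof.
elim: l st => [|x l IH] st inv /= H.
  split=> // kn; apply/eqP/negbNE/negP => g0; have := H kn g0.
  rewrite leqn0 => /eqP c0; have [C [vi vT _ _]] := gainsP (densest_in g0).
  have : count pred0 (items I) < unbought st.1 by apply: (count_lt _ vi vT).
  by rewrite c0 ltn0.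
have [inv' dec] := greedy_step_spec inv; apply: IH => // kn g0.
case: dec => [lt|[|[E g0']]]; last by rewrite E g0' in g0.
- rewrite -ltnS; apply: (leq_trans lt); apply: H.
    move: kn; rewrite /greedy_step; case: ifP => [nk kn|/negbT/negbNE//]; by rewrite kn in nk.
  apply/eqP => E; have Es : greedy_step I st = st by rewrite /greedy_step E; case: ifP.
  by rewrite Es ltnn in lt.
- by rewrite kn.
Qed.

Lemma greedy_spec : greedy_inv (greedy I) /\ (nilp (greedy I).2.2 -> gains I (greedy I).1 = [::]).
Proof.
have w0 : weight [::] = 0 by rewrite /weight big1.
apply: greedy_iter => /=; last by move=> _ _; exact: count_size.
by split=> //=; rewrite ?w0 //; right; rewrite muln0.
Qed.

Theorem purchase_spec :
  [/\ {subset purchase I <= [seq x.1 | x <- items I]}, weight (purchase I) <= limit I &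
      f O <= 4 * f (purchase I)].
Proof.
suff H T w k : greedy_inv (T, (w, k)) -> (nilp k -> gains I T = [::]) ->
    [/\ {subset (if f T < f k then k else T) <= [seq x.1 | x <- items I]},
        weight (if f T < f k then k else T) <= limit I &
        f O <= 4 * f (if f T < f k then k else T)].
  have [h1 h2] := greedy_spec; rewrite /purchase.
  by apply: (H _ (greedy I).2.1 _ _ h2); move: h1; rewrite -!surjective_pairing.
rewrite /greedy_inv; cbn [fst snd] => -[sT _ wT q] g0.
case: ifP q g0 => [/nilP-> _ /(_ isT) g0|_ [v [c [C [-> vi cl fO]]]] _].
  have nlt : (f T < f [::]) = false by apply/negbTE; rewrite -leqNgt; apply: f_mono.
  rewrite nlt; split=> //; apply: (@leq_trans (f T)); last by lia.
  (* Nothing was rejected and nothing is left to gain from, so all vertices affordable alone are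
     bought, in particular those of [O]. *)
  apply: f_mono => x xO; apply/negbNE/negP => xT.
  have [y yi xy] := mapP (O_items xO); rewrite xy in xO xT.
  by have := mem_gains yi xT (item_weight yi xO); rewrite g0.
(* Splitting off the rejected vertex costs the second factor 2 of the 4. *)
have tot : f (v :: T) <= f T + f [:: v].
  have := @f_submod T [:: v] (v :: T) [::].
  have c1 x : x \in v :: T -> (x \in T) || (x \in [:: v]) by rewrite in_cons mem_seq1 orbC.
  by move=> /(_ c1 (fun x h => False_ind _ (notF h))); lia.
case: ifP => lt; split=> //; try lia.
  by move=> x; rewrite mem_seq1 => /eqP->; apply/mapP; exists (v, (c, C)).
rewrite (@weight_cons v c C [::]) //.
by rewrite /weight big1.
Qed.
End Greedy.

(** * Networks with one sink per terminal *)

Section Sinks.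
Variables (n s : nat) (G : seq (arc * nat)).
Hypothesis sn : s < n.
Hypothesis uG : uniq [seq e.1 | e <- G].
Hypothesis Gn : forall e : arc * nat, e \in G -> e.1.1 < n /\ e.1.2 < n.
Hypothesis Gsym : forall e : arc * nat, e \in G -> (swap e.1, e.2) \in G.

(* Terminals are triples (index, vertex, capacity). *)
Definition with_sinks (ts : seq (nat * (nat * nat))) : seq (arc * nat) :=
  G ++ [seq ((t.2.1, n + t.1), t.2.2) | t <- ts].

Definition sink_cut (S : pred nat) (ts : seq (nat * (nat * nat))) : nat :=
  capacity S G + \sum_(t <- ts | S t.2.1) t.2.2.

Variable ts : seq (nat * (nat * nat)).
Hypothesis uts : uniq [seq t.1 | t <- ts].
Hypothesis tsn : forall t : nat * (nat * nat), t \in ts -> t.2.1 < n.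

Let E := with_sinks ts.
Let K := [seq e.1 | e <- E].
Let P := flow_paths n s E.

Lemma capacity_with_sinks S : valid n s S -> capacity S E = sink_cut S ts.
Proof.
move=> [Ss Sn]; rewrite /capacity /E /with_sinks big_cat big_map /=; congr (_ + _).
apply: eq_bigl => t; rewrite /crosses /=; case: (S t.2.1) => //=.
by apply/negP => /Sn; lia.
Qed.

Lemma with_sinks_mem (e : arc * nat) : e \in E ->
  e \in G \/ exists2 t, t \in ts & e = ((t.2.1, n + t.1), t.2.2).
Proof. by rewrite mem_cat => /orP[|/mapP[t tin ->]]; [left|right; exists t]. Qed.

Lemma with_sinks_uniq : uniq K.
Proof.
rewrite /K /E /with_sinks map_cat cat_uniq uG /= -map_comp; apply/andP; split.
  apply/hasPn => _ /mapP[t tin ->] /=; apply/negP => /mapP[e /Gn[_ h] /= ee].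
  by rewrite -ee /= in h; lia.
rewrite map_inj_in_uniq; first exact: map_uniq uts.
move=> t t' tin t'in /= [_ /addnI tt]; exact: (uniq_fst uts).
Qed.

Lemma with_sinks_tail k : k \in K -> k.1 < n.
Proof. by case/mapP => e /with_sinks_mem[/Gn[? _] ->|[t /tsn ? ->] ->]. Qed.

Lemma with_sinks_inner k : k \in K -> k.2 < n -> k \in [seq e.1 | e <- G].
Proof.
by case/mapP => e /with_sinks_mem[eG ->|[t _ ->] -> /=]; [move=> _; exact: map_f|lia].
Qed.

Lemma with_sinks_sym k : k \in K -> k.2 < n -> swap k \in K.
Proof.
move=> kK /(with_sinks_inner kK)/mapP[e /Gsym eG ->].
by apply/mapP; exists (swap e.1, e.2) => //; rewrite mem_cat eG.
Qed.

Let spec : [/\ forall p, p \in P -> is_path s K p.1 /\ n <= head 0 p.1,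
      forall e : arc * nat, e \in E -> load P e.1 <= e.2,
      forall e : arc * nat, e \in E -> swap e.1 \in K -> load P e.1 + load P (swap e.1) <= e.2 &
      exists2 S, valid n s S & capacity S E <= flow_value P].
Proof.
apply: flow_paths_spec => //; [exact: with_sinks_uniq|exact: with_sinks_sym|].
move=> e e' /with_sinks_mem eE /with_sinks_mem eE' ee.
case: eE ee => [eG|[t _ ->]] ee; last first.
  case: eE' ee => [/Gn[h _]|[t' /tsn h ->]] ee; first by rewrite ee /= in h; lia.
  by case: ee h; lia.
case: eE' ee => [eG'|[t' tin ->]] ee; last by have [h _] := Gn eG; case: ee h; lia.
by have := uniq_fst uG (Gsym eG) eG' (esym ee); move/(congr1 snd).
Qed.

Lemma flow_value_max S : valid n s S -> flow_value P <= sink_cut S ts.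
Proof.
move=> vS; have [h1 h2 _ _] := spec; rewrite -capacity_with_sinks //.
apply: weak_duality h1 h2 vS => //; exact: with_sinks_uniq.
Qed.

Lemma flow_value_min : exists2 S, valid n s S & sink_cut S ts <= flow_value P.
Proof. by have [_ _ _ [S vS le]] := spec; exists S; rewrite -?capacity_with_sinks. Qed.

Lemma flow_load (e : arc * nat) : e \in G -> load P e.1 + load P (swap e.1) <= e.2.
Proof.
move=> eG; have [_ _ h _] := spec; apply: h; first by rewrite mem_cat eG.
by apply/mapP; exists (swap e.1, e.2); rewrite ?mem_cat ?Gsym.
Qed.

(** No arc leaves a sink, so a path meets a sink only at its end; the rest of it lies in the graph
    [G]. *)
Lemma flow_path_shape p : p \in P ->
  exists t w, [/\ t \in ts, p.1 = (n + t.1) :: t.2.1 :: w, uniq (t.2.1 :: w),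
    last t.2.1 w = s & forall k, k \in arcs (t.2.1 :: w) -> k \in [seq e.1 | e <- G]].
Proof.
have [h _ _ _] := spec; move=> /h[]; case: (p.1) => [|x [|a w]] [] //.
  by move=> _ _ /= ->; lia.
move=> _ /= /andP[xa uw] lw sub hx.
have ax : (a, x) \in K by apply: sub; rewrite in_cons eqxx.
have sub' k : k \in arcs (a :: w) -> k \in K by move=> kw; apply: sub; rewrite arcs_cons in_cons kw orbT.
have [t tin [aE xE]] : exists2 t, t \in ts & a = t.2.1 /\ x = n + t.1.
  have [e eE ee] := mapP ax; case: (with_sinks_mem eE) => [/Gn[_ h']|[t tin E']].
    by rewrite -ee /= in h'; lia.
  by exists t => //; rewrite E' in ee; case: ee.
exists t, w; rewrite -aE -xE; split=> //.
have tl b v : (forall k, k \in arcs (b :: v) -> k \in K) -> b < n -> forall y, y \in b :: v -> y < n.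
  elim: v b => [|c v IH] b sb bn y; first by rewrite mem_seq1 => /eqP->.
  rewrite in_cons => /orP[/eqP->//|]; apply: IH.
    by move=> k kv; apply: sb; rewrite arcs_cons in_cons kv orbT.
  by apply: (@with_sinks_tail (c, b)); apply: sb; rewrite arcs_cons in_cons eqxx.
move=> k kw; apply: with_sinks_inner (sub' _ kw) _.
apply: (tl a w sub') => //; last by have [] := arcs_in kw.
by rewrite aE; exact: tsn.
Qed.

Lemma flow_sink_load t : t \in ts -> \sum_(p <- P) p.2 * (head 0 p.1 == n + t.1) <= t.2.2.
Proof.
move=> tin; have [_ h _ _] := spec.
have := h ((t.2.1, n + t.1), t.2.2); rewrite mem_cat; set m := _ \in map _ _.
have -> : m by apply/mapP; exists t.
rewrite orbT => /(_ isT); apply: leq_trans; rewrite /load big_seq [leqRHS]big_seq.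
apply: leq_sum => p /flow_path_shape[t' [w [t'in pE _ _ _]]].
rewrite pE /= arcs_cons in_cons leq_mul2l; apply/orP; right.
case: eqP => // /addnI tt; have -> : t' = t by exact: (uniq_fst uts).
by rewrite eqxx.
Qed.
End Sinks.

(** * From instances to integer networks *)

Definition ratp (x : rat) : nat * nat := (`|numq x|%N, `|denq x|%N).

(** The instance as plain lists, with the very tree that [enc_instance] produces, so the algorithm
    needs no dependent types. *)
Definition raw (I : instance) : raw_instance :=
  ([seq [seq (if adj u v then Some (ratp (cap [set u; v]%SET)) else None) | v <- enum 'I_(nv I)]
   | u <- enum 'I_(nv I)],
  ([seq (ratp (cost v), ratp (proc v)) | v <- enum 'I_(nv I)],
  ([seq (val (src i), (val (dst i), ratp (dem i))) | i <- enum 'I_(nd I)], ratp (budget I)))).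

Lemma enc_seq_map X Y (f : X -> Y) (g : Y -> tree) (h : X -> tree) l :
  (forall x, g (f x) = h x) -> enc_seq g (map f l) = enc_seq h l.
Proof. by move=> E; elim: l => //= x l ->; rewrite E. Qed.

Lemma enc_raw I : enc (raw I) = enc_instance I.
Proof.
rewrite /enc_instance; congr Node.
  apply: enc_seq_map => u; apply: enc_seq_map => v; by case: ifP.
by congr Node; [|congr Node]; apply: enc_seq_map.
Qed.

Lemma enumerate_ord X m (F : 'I_m -> X) :
  enumerate [seq F i | i <- enum 'I_m] = [seq (F i, val i) | i <- enum 'I_m].
Proof.
rewrite /enumerate size_map size_enum_ord -val_enum_ord.
by elim: (enum 'I_m) => //= i l ->.
Qed.

Lemma dvdn_prodl d l : d \in l -> d %| prodl l.
Proof.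
by elim: l => //= x l IH; rewrite in_cons => /orP[/eqP->|/IH h]; [exact: dvdn_mulr|exact: dvdn_mull].
Qed.

Lemma prodl_gt0 l : all (ltn 0) l -> 0 < prodl l.
Proof. by elim: l => //= x l IH /andP[x0 /IH]; rewrite muln_gt0 x0. Qed.

Lemma denp_gt0 x : 0 < (ratp x).2.
Proof. by rewrite /= absz_gt0 denq_eq0. Qed.

Lemma scaleE (R : realType) M (x : rat) : (0 <= x)%R -> (ratp x).2 %| M ->
  ((scale M (ratp x))%:R = M%:R * ratr x :> R)%R.
Proof.
move=> x0 /dvdnP[k ->]; rewrite /scale mulnA mulnK ?denp_gt0 // /ratr.
have nE : ((numq x)%:~R = (`|numq x|%N)%:R :> R)%R.
  by rewrite -[in LHS](gez0_abs (_ : (0 <= numq x)%R)) ?numq_ge0 // absz_nat.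
have dE : ((denq x)%:~R = (`|denq x|%N)%:R :> R)%R.
  by rewrite -[in LHS](gez0_abs (_ : (0 <= denq x)%R)) ?denq_ge0 // absz_nat.
rewrite nE dE !natrM mulrACA mulrCA; set d := (`|denq x|%N)%:R%R.
have d0 : (d != 0)%R by rewrite pnatr_eq0 -lt0n; exact: (denp_gt0 x).
by field.
Qed.

Section Instance.
Variable I : instance.
Local Notation n := (nv I).
Local Notation J := (raw I).

Definition capn (e : {set 'I_n}) : nat := scale (flow_den J) (ratp (cap e)).
Definition procn (v : 'I_n) : nat := scale (flow_den J) (ratp (proc v)).
Definition costn (v : 'I_n) : nat := scale (cost_den J) (ratp (cost v)).
Definition demn (i : 'I_(nd I)) : nat := scale (flow_den J) (ratp (dem i)).

Lemma order_raw : order J = n.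
Proof. by rewrite /order size_map size_enum_ord. Qed.

(** Each edge occurs in both orientations. *)
Definition adjacent : seq ('I_n * 'I_n) :=
  [seq uv <- [seq (u, v) | u <- enum 'I_n, v <- enum 'I_n] | adj uv.1 uv.2].

Lemma raw_arcsE : raw_arcs J.1 =
  [seq ((val uv.1, val uv.2), ratp (cap [set uv.1; uv.2]%SET))
  | uv <- adjacent].
Proof.
rewrite /adjacent /raw_arcs /raw [fst _]/= enumerate_ord -map_comp filter_flatten map_flatten -!map_comp.
congr flatten; apply: eq_map => u; rewrite /= enumerate_ord.
by elim: (enum 'I_n) => //= v l IH; case uv: (adj u v) => /=; rewrite IH.
Qed.

Lemma raw_arcs_mem e : e \in raw_arcs J.1 <->
  exists u v : 'I_n, adj u v /\ e = ((val u, val v), ratp (cap [set u; v]%SET)).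
Proof.
rewrite raw_arcsE; split.
  case/mapP => -[u v]; rewrite mem_filter => /andP[uv _] ->; by exists u, v.
case=> u [v [uv ->]]; apply/mapP; exists (u, v) => //; rewrite mem_filter uv /=.
by apply/allpairsP; exists (u, v); rewrite !mem_enum.
Qed.

Lemma flow_den_gt0 : 0 < flow_den J.
Proof.
apply: prodl_gt0; rewrite !all_cat; apply/and3P; split; apply/allP => d /mapP[x].
- by move=> /raw_arcs_mem[u [v [_ ->]]] ->; exact: denp_gt0.
- by case/mapP => v _ -> ->; exact: denp_gt0.
- by case/mapP => v _ -> ->; exact: denp_gt0.
Qed.

Section Values.
Variable R : realType.

Lemma capnE (u v : 'I_n) : adj u v ->
  ((capn [set u; v]%SET)%:R = (flow_den J)%:R * ratr (cap [set u; v]%SET) :> R)%R.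
Proof.
move=> uv; apply: scaleE; first exact/ltW/cap_gt0.
apply: dvdn_prodl; rewrite mem_cat; apply/orP; left; apply/mapP.
by exists ((val u, val v), ratp (cap [set u; v]%SET)) => //; apply/raw_arcs_mem; exists u, v.
Qed.

Lemma procnE v : ((procn v)%:R = (flow_den J)%:R * ratr (proc v) :> R)%R.
Proof.
apply: scaleE; first exact: proc_ge0.
apply: dvdn_prodl; rewrite !mem_cat; apply/orP; right; apply/orP; left; apply/mapP.
by exists (ratp (cost v), ratp (proc v)) => //; apply/mapP; exists v; rewrite ?mem_enum.
Qed.

Lemma demnE i : ((demn i)%:R = (flow_den J)%:R * ratr (dem i) :> R)%R.
Proof.
apply: scaleE; first exact/ltW/dem_gt0.
apply: dvdn_prodl; rewrite !mem_cat; apply/orP; right; apply/orP; right; apply/mapP.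
by exists (val (src i), (val (dst i), ratp (dem i))) => //; apply/mapP; exists i; rewrite ?mem_enum.
Qed.

Lemma cost_den_gt0 : 0 < cost_den J.
Proof.
apply: prodl_gt0; apply/andP; split; first exact: denp_gt0.
by apply/allP => d /mapP[x /mapP[v _ ->] ->]; exact: denp_gt0.
Qed.

Lemma costnE v : ((costn v)%:R = (cost_den J)%:R * ratr (cost v) :> R)%R.
Proof.
apply: scaleE; first exact: cost_ge0.
apply: dvdn_prodl; rewrite in_cons; apply/orP; right; apply/mapP.
by exists (ratp (cost v), ratp (proc v)) => //; apply/mapP; exists v; rewrite ?mem_enum.
Qed.

Lemma limitE : ((limit J)%:R = (cost_den J)%:R * ratr (budget I) :> R)%R.
Proof. by apply: scaleE; [exact: budget_ge0|apply: dvdn_prodl; rewrite in_cons eqxx]. Qed.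

End Values.

Lemma graphE : graph J = [seq ((val uv.1, val uv.2), capn [set uv.1; uv.2]%SET)
  | uv <- adjacent].
Proof. by rewrite /graph raw_arcsE -map_comp. Qed.

Lemma graph_mem e : e \in graph J <->
  exists u v : 'I_n, adj u v /\ e = ((val u, val v), capn [set u; v]%SET).
Proof.
rewrite graphE; split.
  case/mapP => -[u v]; rewrite mem_filter => /andP[uv _] ->; by exists u, v.
case=> u [v [uv ->]]; apply/mapP; exists (u, v) => //; rewrite mem_filter uv /=.
by apply/allpairsP; exists (u, v); rewrite !mem_enum.
Qed.

Lemma adj_sym (u v : 'I_n) : adj u v = adj v u.
Proof. by rewrite /adj finset.setUC. Qed.

Lemma graph_uniq : uniq [seq e.1 | e <- graph J].
Proof.
rewrite graphE -map_comp map_inj_uniq; last by move=> [u v] [u' v'] /= [/val_inj-> /val_inj->].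
apply: filter_uniq; apply: allpairs_uniq; rewrite ?enum_uniq //.
by move=> [? ?] [? ?].
Qed.

Lemma graph_bound e : e \in graph J -> e.1.1 < n /\ e.1.2 < n.
Proof. by case/graph_mem => u [v [_ ->]] /=. Qed.

Lemma graph_sym e : e \in graph J -> (swap e.1, e.2) \in graph J.
Proof.
case/graph_mem => u [v [uv ->]] /=; apply/graph_mem; exists v, u; rewrite adj_sym.
by split=> //; rewrite finset.setUC.
Qed.

Lemma itemsE : items J = [seq (val v, (costn v, procn v)) | v <- enum 'I_n].
Proof.
rewrite /items; have -> : J.2.1 = [seq (ratp (cost v), ratp (proc v)) | v <- enum 'I_n] by [].
by rewrite enumerate_ord -map_comp.
Qed.

Definition processors (T : seq nat) : seq (nat * (nat * nat)) :=
  [seq (val v, (val v, if val v \in T then procn v else 0)) | v <- enum 'I_n].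

Definition demands : seq (nat * (nat * nat)) :=
  [seq (val i, (val (dst i), demn i)) | i <- enum 'I_(nd I)].

Lemma processing_netE T : processing_net J T = with_sinks n (graph J) (processors T).
Proof. by rewrite /processing_net /with_sinks itemsE order_raw -!map_comp. Qed.

Lemma demand_netE : demand_net J = with_sinks n (graph J) demands.
Proof.
rewrite /demand_net order_raw /with_sinks; congr (_ ++ _).
have -> : J.2.2.1 = [seq (val (src i), (val (dst i), ratp (dem i))) | i <- enum 'I_(nd I)] by [].
by rewrite enumerate_ord -!map_comp.
Qed.

Lemma processors_uniq T : uniq [seq t.1 | t <- processors T].
Proof. by rewrite -map_comp map_inj_uniq ?enum_uniq //; exact: val_inj. Qed.

Lemma demands_uniq : uniq [seq t.1 | t <- demands].
Proof. by rewrite -map_comp map_inj_uniq ?enum_uniq //; exact: val_inj. Qed.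

Lemma processors_bound T t : t \in processors T -> t.2.1 < n.
Proof. by case/mapP => v _ -> /=; exact: ltn_ord. Qed.

Lemma demands_bound t : t \in demands -> t.2.1 < n.
Proof. by case/mapP => v _ -> /=; exact: ltn_ord. Qed.

Hypothesis sourceP : source J < n.

Definition cut_value (S : pred nat) (T : seq nat) : nat :=
  capacity S (graph J) + \sum_(v : 'I_n) (S (val v) && (val v \in T)) * procn v.

Lemma sink_cut_processors S T : sink_cut (graph J) S (processors T) = cut_value S T.
Proof.
rewrite /sink_cut /cut_value big_map big_enum_cond /= big_mkcond; congr (_ + _).
by apply: eq_bigr => v _; case: (S v) (val v \in T) => [] []; rewrite ?mul1n.
Qed.

Lemma capture_max S T : valid n (source J) S -> capture J T <= cut_value S T.
Proof.
move=> vS; rewrite -sink_cut_processors /capture /processing_paths order_raw processing_netE.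
apply: flow_value_max => //.
- exact: graph_uniq.
- exact: graph_bound.
- exact: graph_sym.
- exact: processors_uniq.
- exact: processors_bound.
Qed.

Lemma capture_min T : exists2 S, valid n (source J) S & cut_value S T <= capture J T.
Proof.
have [|||||S vS le] := @flow_value_min n (source J) (graph J) sourceP _ _ _ (processors T).
- exact: graph_uniq.
- exact: graph_bound.
- exact: graph_sym.
- exact: processors_uniq.
- exact: processors_bound.
by exists S; rewrite // -sink_cut_processors /capture /processing_paths order_raw processing_netE.
Qed.

Lemma capture_mono A B : {subset A <= B} -> capture J A <= capture J B.
Proof.
move=> AB; have [S vS le] := capture_min B; apply: leq_trans (capture_max A vS) _.
apply: leq_trans le; rewrite leq_add2l; apply: leq_sum => v _; rewrite leq_mul2r.
by apply/orP; right; case: (S (val v)) => //=; case vA: (val v \in A) => //; rewrite (AB _ vA).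
Qed.

(** The intersection of the cuts [X] and [Y] goes with [C] and their union with [D]. The opposite
    pairing fails: a vertex in [X] only, bought in [B] only, would be charged on the left and not on
    the right. *)
Lemma capture_submod (A B C D : seq nat) :
  (forall x, x \in C -> (x \in A) || (x \in B)) ->
  (forall x, x \in D -> (x \in A) && (x \in B)) ->
  capture J C + capture J D <= capture J A + capture J B.
Proof.
move=> CAB DAB; have [X [Xs Xn] leX] := capture_min A; have [Y [Ys Yn] leY] := capture_min B.
have v1 : valid n (source J) (fun x => X x && Y x) by split; rewrite ?Xs // => x /andP[/Xn].
have v2 : valid n (source J) (fun x => X x || Y x).
  by split; rewrite ?Xs // => x /orP[/Xn|/Yn].
apply: leq_trans (leq_add (capture_max C v1) (capture_max D v2)) _.
apply: leq_trans (leq_add leX leY); rewrite /cut_value addnACA [leqRHS]addnACA.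
apply: leq_add.
  rewrite /capacity ![\sum_(_ <- _ | _) _]big_mkcond -!big_split /=; apply: leq_sum => e _.
  rewrite /crosses.
  by case: (X e.1.1) (X e.1.2) (Y e.1.1) (Y e.1.2) => [] [] [] [] //=; rewrite ?addn0 ?add0n ?leq_addr ?leq_addl.
rewrite -!big_split /=; apply: leq_sum => v _.
have := CAB v; have := DAB v.
case: (X (val v)) (Y (val v)) (val v \in A) (val v \in B) (val v \in C) (val v \in D) => [] [] [] [] [] [] //= d c;
  try (by have := d isT); try (by have := c isT); lia.
Qed.
End Instance.

(** * Routing through the source *)

Lemma loop_erase_spec (e : rel nat) x l : path e x l ->
  exists l', [/\ loop_erase (x :: l) = x :: l', uniq (x :: l'), path e x l' & last x l' = last x l].
Proof.
elim: l x => [|y l IH] x; first by exists [::].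
rewrite [path _ _ _]/= => /andP[exy /IH[l' [E u p la]]].
have -> : loop_erase (x :: y :: l) =
    if x \in y :: l' then drop_to x (y :: l') else x :: y :: l' by rewrite -E.
case: ifP => xin; last by exists (y :: l'); split=> //; rewrite /= ?xin ?u ?exy //.
rewrite drop_toE; exists (drop (index x (y :: l')).+1 (y :: l')).
have dE : drop (index x (y :: l')) (y :: l') = x :: drop (index x (y :: l')).+1 (y :: l').
  by rewrite (drop_nth 0) ?index_mem // nth_index.
have ud : uniq (drop (index x (y :: l')) (y :: l')) by exact: drop_uniq.
have cE : y :: l' = take (index x (y :: l')) (y :: l') ++ x :: drop (index x (y :: l')).+1 (y :: l').
  by rewrite -dE cat_take_drop.
split=> //; first by rewrite -dE.
  have sub a b : sorted e (a ++ x :: b) -> path e x b.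
    by case: a => [|z a] //=; rewrite cat_path /= => /and3P[].
  by apply: (sub (take (index x (y :: l')) (y :: l'))); rewrite -cE.
have : last x (y :: l') = last x (drop (index x (y :: l')).+1 (y :: l')).
  by rewrite {1}cE last_cat.
by move=> <- /=.
Qed.

Definition joins (k : arc) : pred arc := fun a => (a == k) || (a == swap k).

Definition touches (k : arc) (w : seq nat) : nat := (k \in arcs w) + (swap k \in arcs w).

Lemma joins_swap k a : joins k (swap a) = joins k a.
Proof. by rewrite /joins -{1}[k]swapK !(inj_eq (can_inj swapK)) orbC. Qed.

Lemma count_joins k w : uniq w -> count (joins k) (arcs w) <= touches k w.
Proof.
move=> uw; rewrite /touches -!count_uniq_mem ?arcs_uniq //.
by rewrite -count_predUI leq_addr.
Qed.

Lemma count_joins_le1 k w : uniq w -> count (joins k) (arcs w) <= has (joins k) (arcs w).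
Proof.
move=> uw; case: (boolP (has _ _)) => [_|]; last by rewrite has_count -leqNgt.
apply: leq_trans (count_joins k uw) _; rewrite /touches.
by case kw: (k \in arcs w) => //=; rewrite ?leq_b1 // (negbTE (arcs_antisym uw kw)).
Qed.

Lemma arcs_cat_cons w x l : arcs (w ++ x :: l) = arcs (rcons w x) ++ arcs (x :: l).
Proof.
elim: w => [|y w IH] //; case: w IH => [|z w] IH //.
have -> : arcs ((y :: z :: w) ++ x :: l) = (z, y) :: arcs ((z :: w) ++ x :: l) by [].
by rewrite IH.
Qed.

Lemma arcs_rev w : arcs (rev w) = rev [seq swap k | k <- arcs w].
Proof.
case: w => // x w; elim: w x => // y w IH x.
have -> : rev (x :: y :: w) = rev w ++ [:: y; x] by rewrite !rev_cons -!cats1 -catA.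
rewrite arcs_cat_cons -rev_cons IH [in RHS]arcs_cons map_cons rev_cons.
by rewrite -cats1.
Qed.

Lemma arcs_path (F : pred arc) z w : (forall k, F k -> F (swap k)) ->
  (forall k, k \in arcs (z :: w) -> F k) -> path (fun a b => F (a, b)) z w.
Proof.
move=> sF; elim: w z => //= c w IH z Fk; apply/andP; split.
  by apply: (sF (c, z)); apply: Fk; rewrite arcs_cons in_cons eqxx.
by apply: IH => k kw; apply: Fk; rewrite arcs_cons in_cons kw orbT.
Qed.

Lemma path_arcs_rev (F : pred arc) z w : (forall k, F k -> F (swap k)) ->
  path (fun a b => F (a, b)) z w -> path (fun a b => F (a, b)) (last z w) (rev (belast z w)).
Proof.
move=> sF pw; rewrite rev_path; apply: sub_path pw => a b; exact: (sF (a, b)).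
Qed.

Lemma path_arcs (F : pred arc) z w : (forall k, F k -> F (swap k)) ->
  path (fun a b => F (a, b)) z w -> forall k, k \in arcs (z :: w) -> F k.
Proof.
move=> sF; elim: w z => // c w IH z /= /andP[zc pw] k; rewrite arcs_cons in_cons.
by case/orP => [/eqP->|]; [exact: (sF (z, c))|exact: IH].
Qed.

Lemma arcs_tails z w u : u \in w -> exists2 k, k \in arcs (z :: w) & k.1 = u.
Proof.
elim: w z => // c w IH z; rewrite in_cons => /orP[/eqP->|/(IH c)[k kw ku]].
  by exists (c, z); rewrite // arcs_cons in_cons eqxx.
by exists k => //; rewrite arcs_cons in_cons kw orbT.
Qed.

Section Route.
Variables (s : nat) (E : pred arc).
Hypothesis symE : forall k, E k -> E (swap k).
Variables (x y : nat) (v d : nat) (wp wq : seq nat).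
Let p := x :: v :: wp.
Let q := y :: d :: wq.
Hypothesis up : uniq (v :: wp).
Hypothesis lp : last v wp = s.
Hypothesis lq : last d wq = s.
Hypothesis Ep : forall k, k \in arcs (v :: wp) -> E k.
Hypothesis Eq : forall k, k \in arcs (d :: wq) -> E k.

Let rev_consE (z : nat) w : rev (z :: w) = last z w :: rev (belast z w).
Proof. by rewrite lastI rev_rcons. Qed.

Let last_rev (z : nat) w : last (last z w) (rev (belast z w)) = z.
Proof. by case: w => //= c w; rewrite rev_cons last_rcons. Qed.

Lemma route_spec : exists w,
  [/\ route p q = s :: w, path (fun a b => E (a, b)) s w, last s w = d, v \in s :: w &
   [/\ forall u, count_mem u (s :: w) <= 2,
       forall u, u \in s :: w -> u \in (v :: wp) ++ (d :: wq) &
       forall k, count (joins k) (arcs (s :: w)) <=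
         2 * touches k (v :: wp) + touches k (d :: wq)]].
Proof.
(* [F] collects the arcs of both paths in either direction. The erased half stays inside [F] and is
   simple, so it uses an edge at most once, and only if one of the paths touches it; the first half
   accounts for the other copy of the first path. *)
pose F k := (k \in arcs (v :: wp)) || (swap k \in arcs (v :: wp)) ||
   (k \in arcs (d :: wq)) || (swap k \in arcs (d :: wq)).
have sF k : F k -> F (swap k).
  by rewrite /F swapK; do !case: (_ \in _).
have FE k : F k -> E k.
  by rewrite /F; do ![case/orP]; try (by apply: Ep); try (by apply: Eq) => h;
     move=> h; rewrite -[k]swapK; apply: symE; [exact: Ep|exact: Eq].
have Fp k : k \in arcs (v :: wp) -> F k by rewrite /F => ->.
have Fq k : k \in arcs (d :: wq) -> F k by rewrite /F => ->; rewrite !orbT.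
have pp := arcs_path sF Fp.
have pq := path_arcs_rev sF (arcs_path sF Fq).
have pw : path (fun a b => F (a, b)) v (wp ++ rev (belast d wq)) by rewrite cat_path pp lp -lq.
have [l [El ul pl ll]] := loop_erase_spec pw.
have llE : last v l = d by rewrite ll last_cat lp -lq last_rev.
have rE : route p q = s :: (rev (belast v wp) ++ l).
  rewrite /route /p /q [behead (x :: _)]/= [behead (y :: _)]/= rev_consE lp.
  by rewrite [rev (d :: wq)]rev_consE [behead (_ :: rev _)]/= El.
have cE : s :: (rev (belast v wp) ++ l) = rev (v :: wp) ++ l by rewrite rev_consE lp.
exists (rev (belast v wp) ++ l).
have vin : v \in rev (v :: wp) by rewrite mem_rev mem_head.
have lsub u : u \in l -> u \in (v :: wp) ++ (d :: wq).
  move=> /(arcs_tails v)[k /(path_arcs sF pl) Fk <-]; rewrite mem_cat.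
  by move: Fk => /orP[/orP[/orP[]|]|] /arcs_in[/= h1 h2]; rewrite ?h1 ?h2 ?orbT.
split=> //.
- rewrite cat_path; apply/andP; split.
    by rewrite -lp; apply: path_arcs_rev => //; exact: arcs_path.
  by rewrite -{1}lp last_rev; apply: sub_path pl => a b; exact: FE.
- by rewrite last_cat -lp last_rev.
- by rewrite cE mem_cat vin.
split.
- move=> u; rewrite cE count_cat count_rev; have := count_uniq_mem u up.
  have ul' : uniq l by case/andP: ul.
  by have := count_uniq_mem u ul'; move=> -> ->; case: (_ \in _) (_ \in _) => [] [].
- move=> u; rewrite cE mem_cat mem_rev => /orP[uv|/lsub//].
  by rewrite mem_cat uv.
move=> k; rewrite cE.
have -> : rev (v :: wp) ++ l = rev wp ++ v :: l by rewrite rev_cons cat_rcons.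
rewrite arcs_cat_cons count_cat -rev_cons arcs_rev count_rev count_map.
rewrite mul2n -addnn -addnA; apply: leq_add.
  rewrite (eq_count (joins_swap k)); exact: count_joins.
apply: leq_trans (count_joins_le1 k ul) _.
case: hasP => // -[a al ja].
have Fa : F a := path_arcs sF pl al.
have Fk : F k by case/orP: ja Fa => /eqP-> // /sF; rewrite swapK.
by move: Fk; rewrite /F /touches; do !case: (_ \in _).
Qed.
End Route.

(** * The optimum is bounded by cuts *)

Section Optimum.
Variables (R : realType) (I : instance) (T : {set 'I_(nv I)}) (p : {ffun triple I -> R}).
Hypothesis fp : feasible T p.
Local Open Scope ring_scope.

Lemma traversals_cons e x y w :
  @traversals I e (x :: y :: w) = (([set x; y]%SET == e) + traversals e (y :: w))%N.
Proof. by []. Qed.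

Lemma path_crosses (S : pred 'I_(nv I)) x w : path (@adj I) x w -> S x ->
  has (predC S) (x :: w) -> exists u v, [/\ adj u v, S u, ~~ S v & (0 < traversals [set u; v]%SET (x :: w))%N].
Proof.
elim: w x => [|y w IH] x; first by move=> _ /= ->.
rewrite [path _ _ _]/= => /andP[xy pw] Sx; rewrite [has _ _]/= Sx /=.
case Sy: (S y) => /= h; last first.
  by exists x, y; rewrite Sx Sy xy traversals_cons eqxx.
have [|u [v [uv Su Sv tr]]] := IH y pw Sy; first by rewrite /= Sy.
by exists u, v; rewrite traversals_cons ltn_addl.
Qed.

Lemma adjacent_mem (u v : 'I_(nv I)) : (u, v) \in adjacent I = adj u v.
Proof.
rewrite mem_filter /=; case: (adj u v) => //=.
by apply/allpairsP; exists (u, v); rewrite !mem_enum.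
Qed.

(** Every walk in question starts in [S] and leaves it, so its whole amount passes some crossing
    edge. The filter keeps the outward orientation only, hence each edge is counted once. *)
Lemma flow_cut_le (S : pred 'I_(nv I)) (Q : pred (triple I)) :
  (forall t, valid_triple t -> Q t -> S (src (tdemand t)) /\ has (predC S) (twalk t)) ->
  \sum_(t | Q t) p t <=
  \sum_(uv <- adjacent I | S uv.1 && ~~ S uv.2) ratr (cap [set uv.1; uv.2]%SET).
Proof.
have [p0 pv pe _ _] := fp; move=> H.
apply: (@le_trans _ _ (\sum_(uv <- adjacent I | S uv.1 && ~~ S uv.2)
   \sum_t p t *+ traversals [set uv.1; uv.2]%SET (twalk t))); last first.
  rewrite big_seq_cond [leRHS]big_seq_cond; apply: ler_sum => -[u v] /andP[uv _].
  by apply: pe; rewrite adjacent_mem in uv.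
rewrite exchange_big /= [leRHS](bigID Q) /=.
have ge0 t : 0 <= \sum_(uv <- adjacent I | S uv.1 && ~~ S uv.2)
    p t *+ traversals [set uv.1; uv.2]%SET (twalk t).
  by apply: sumr_ge0 => uv _; rewrite mulrn_wge0.
apply: (@le_trans _ _ (\sum_(t | Q t) \sum_(uv <- adjacent I | S uv.1 && ~~ S uv.2)
    p t *+ traversals [set uv.1; uv.2]%SET (twalk t))); last first.
  by rewrite lerDl; apply: sumr_ge0 => t _.
apply: ler_sum => t Qt; case: (boolP (valid_triple t)) => vt; last by rewrite [leLHS]pv //; exact: ge0.
have [Ss hS] := H t vt Qt.
case/andP: vt => + _; move: hS; rewrite /is_walk; case: (twalk t) => // x w hS /and4P[/eqP xs pw _ _].
rewrite -xs in Ss; have [u [v [uv Su Sv tr]]] := path_crosses pw Ss hS.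
rewrite big_mkcond (bigD1_seq (u, v)) /= ?adjacent_mem ?uv //; last first.
  by apply: filter_uniq; apply: allpairs_uniq; rewrite ?enum_uniq // => -[? ?] [? ?].
rewrite Su Sv /= -[leLHS]addr0; apply: lerD; first by rewrite -[leLHS]mulr1n ler_wpMn2l.
by apply: sumr_ge0 => uv' _; case: ifP => // _; rewrite mulrn_wge0.
Qed.

Local Notation M := (flow_den (raw I)).

Lemma capacityE (S : pred nat) : (capacity S (graph (raw I)))%:R =
  M%:R * \sum_(uv <- adjacent I | crosses S (val uv.1, val uv.2)) ratr (cap [set uv.1; uv.2]%SET) :> R.
Proof.
rewrite /capacity graphE big_map natr_sum big_distrr /= big_seq_cond [RHS]big_seq_cond.
by apply: eq_bigr => -[u v] /andP[uv _] /=; rewrite capnE // -adjacent_mem.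
Qed.

Lemma routed_split (Q : pred (triple I)) : routed p = \sum_(t | Q t) p t + \sum_(t | ~~ Q t) p t.
Proof. exact: bigID. Qed.

(** Flow processed outside [S] has left [S], and flow processed inside is limited by the capacities
    there. Comparing with cuts in this way avoids truncating walks and building a flow from them. *)
Lemma routed_le_processing (S : pred nat) :
  (forall i : 'I_(nd I), S (val (src i))) ->
  M%:R * routed p <= (cut_value I S [seq val v | v <- enum T])%:R.
Proof.
move=> Ss; have [p0 pv _ pp _] := fp.
rewrite /cut_value natrD capacityE natr_sum (routed_split (fun t => ~~ S (val (tvertex t)))) mulrDr.
apply: lerD.
  rewrite ler_wpM2l //.
  apply: (@flow_cut_le (fun u => S (val u)) (fun t => ~~ S (val (tvertex t)))) => t /andP[_ tw] nS.
  by split; [exact: Ss|apply/hasP; exists (tvertex t)].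
have -> : \sum_(t | ~~ ~~ S (val (tvertex t))) p t =
    \sum_(v : 'I_(nv I) | S (val v)) \sum_(t | tvertex t == v) p t.
  rewrite (partition_big (@tvertex I) (fun v => S (val v))) /=; last by move=> t; rewrite negbK.
  apply: eq_bigr => v Sv; apply: eq_bigl => t; rewrite negbK; case: eqP => [->|]; rewrite ?andbF // Sv.
  by [].
rewrite big_distrr /= big_mkcond /=; apply: ler_sum => v _.
rewrite (mem_map val_inj) mem_enum natrM procnE.
case: ifP => _; last by rewrite mul0r.
apply: (@le_trans _ _ (M%:R * (if v \in T then ratr (proc v) else 0))); first by rewrite ler_wpM2l.
by case: ifP => _; rewrite /= ?mul1r ?mulr0 ?mul0r.
Qed.

Lemma routed_le_demand (S : pred nat) :
  (forall i : 'I_(nd I), S (val (src i))) ->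
  M%:R * routed p <= (sink_cut (graph (raw I)) S (demands I))%:R.
Proof.
move=> Ss; have [p0 pv _ _ pd] := fp.
rewrite /sink_cut natrD capacityE natr_sum (routed_split (fun t => ~~ S (val (dst (tdemand t))))) mulrDr.
apply: lerD.
  rewrite ler_wpM2l //.
  apply: (@flow_cut_le (fun u => S (val u)) (fun t => ~~ S (val (dst (tdemand t)))))
    => t /andP[tw _] nS.
  split; first exact: Ss.
  move: tw; rewrite /is_walk; case: (twalk t) => // x w /and4P[_ _ /eqP lw _].
  by apply/hasP; exists (dst (tdemand t)) => //; rewrite -lw mem_last.
have -> : \sum_(t | ~~ ~~ S (val (dst (tdemand t)))) p t =
    \sum_(i : 'I_(nd I) | S (val (dst i))) \sum_(t | tdemand t == i) p t.
  rewrite (partition_big (@tdemand I) (fun i => S (val (dst i)))) /=; last by move=> t; rewrite negbK.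
  apply: eq_bigr => v Sv; apply: eq_bigl => t; rewrite negbK; case: eqP => [->|]; rewrite ?andbF // Sv.
  by [].
rewrite big_map big_enum_cond /= big_distrr /=; apply: ler_sum => i _.
by rewrite demnE ler_wpM2l.
Qed.
End Optimum.

(** * Feasibility and approximation ratio *)

(** From exp(x) >= 1 + x at -1/6: the sixth power of 5/6 is 15625/46656, just above 1/3. The
    exponent 5 is too small, as the fifth power of 4/5 is below 1/3. *)
Lemma expR1_inv_ge (R : realType) : (1 / 3 <= (expR 1)^-1 :> R)%R.
Proof.
rewrite -expRN.
have -> : (-1 = (-1 / 6) * 6%:R :> R)%R by field.
rewrite expRM_natr.
have h : (5 / 6 <= expR (-1 / 6) :> R)%R by have := expR_ge1Dx (-1 / 6 : R)%R; lra.
apply: (@le_trans _ _ ((5 / 6) ^+ 6)%R); last by apply: lerXn2r; rewrite ?nnegrE //; lra.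
by lra.
Qed.

(** Choice along a list. Positions are kept, since different pairs of paths may lead to the same
    triple and their amounts must then be added. *)
Lemma lift_seq (A B : eqType) (T : A -> B -> Prop) (l : seq A) :
  (forall a, a \in l -> exists b, T a b) ->
  exists2 z : seq (A * B), map fst z = l & forall x, x \in z -> T x.1 x.2.
Proof.
elim: l => [|a l IH] H; first by exists [::].
have [b Tab] := H a (mem_head _ _).
have [|z zl zT] := IH; first by move=> a' al; apply: H; rewrite in_cons al orbT.
exists ((a, b) :: z); first by rewrite /= zl.
by move=> x; rewrite in_cons => /orP[/eqP->|/zT].
Qed.

Section Solution.
Variables (R : realType) (I : instance).
Hypothesis ss : single_source I.
Local Notation n := (nv I).
Local Notation J := (raw I).
Local Notation s := (source J).
Local Notation M := (flow_den J).

Lemma src_source (i : 'I_(nd I)) : val (src i) = s.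
Proof.
have [v sv] := ss; rewrite sv /source.
have -> : [seq d.1 | d <- J.2.2.1] = [seq val (src i) | i <- enum 'I_(nd I)] by rewrite -map_comp.
case E: (enum 'I_(nd I)) => [|j l] /=; last by rewrite sv.
by have := mem_enum 'I_(nd I) i; rewrite E.
Qed.

Lemma source_lt : s < n.
Proof.
have [v sv] := ss; rewrite /source.
have -> : [seq d.1 | d <- J.2.2.1] = [seq val (src i) | i <- enum 'I_(nd I)] by rewrite -map_comp.
by case: (enum _) => [|j l] /=; [exact: leq_ltn_trans (leq0n v) (ltn_ord v)|exact: ltn_ord].
Qed.

Lemma items_uniq : uniq [seq x.1 | x <- items J].
Proof. by rewrite itemsE -map_comp map_inj_uniq ?enum_uniq //; exact: val_inj. Qed.

Lemma weightE (T : seq nat) : weight J T = \sum_(v : 'I_n) (val v \in T) * costn v.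
Proof. by rewrite /weight itemsE big_map big_enum. Qed.

Lemma weight_affordable (T : seq nat) (U : {set 'I_n}) :
  (forall v, (v \in U) = (val v \in T)) -> affordable U <-> weight J T <= limit J.
Proof.
move=> UT; rewrite /affordable weightE -(ler_nat R) limitE -(ler_rat R) rmorph_sum natr_sum /=.
have -> : (\sum_(v : 'I_n) ((val v \in T) * costn v)%N%:R =
   (cost_den J)%:R * \sum_(v in U) ratr (cost v) :> R)%R.
  rewrite big_distrr [RHS]big_mkcond /=; apply: eq_bigr => v _.
  by rewrite natrM costnE UT; case: ifP; rewrite ?mul1r ?mul0r.
by rewrite ler_pM2l // ltr0n cost_den_gt0.
Qed.

Variable T0 : seq nat.
Local Notation P := (processing_paths J T0).
Local Notation Q := (demand_paths J).

Lemma PE : P = flow_paths n s (with_sinks n (graph J) (processors I T0)).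
Proof. by rewrite /processing_paths order_raw processing_netE. Qed.

Lemma QE : Q = flow_paths n s (with_sinks n (graph J) (demands I)).
Proof. by rewrite /demand_paths order_raw demand_netE. Qed.

Lemma P_shape p : p \in P -> exists (v : 'I_n) w,
  [/\ p.1 = (n + v) :: val v :: w, uniq (val v :: w), last (val v) w = s &
      forall k, k \in arcs (val v :: w) -> k \in [seq e.1 | e <- graph J]].
Proof.
rewrite PE => /(flow_path_shape source_lt (@graph_uniq I) (@graph_bound I) (@graph_sym I)
  (@processors_uniq I T0) (@processors_bound I T0))[t [w [/mapP[v _ ->] pE u l sub]]].
by exists v, w.
Qed.

Lemma Q_shape q : q \in Q -> exists (i : 'I_(nd I)) w,
  [/\ q.1 = (n + i) :: val (dst i) :: w, uniq (val (dst i) :: w), last (val (dst i)) w = s &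
      forall k, k \in arcs (val (dst i) :: w) -> k \in [seq e.1 | e <- graph J]].
Proof.
rewrite QE => /(flow_path_shape source_lt (@graph_uniq I) (@graph_bound I) (@graph_sym I)
  (@demands_uniq I) (@demands_bound I))[t [w [/mapP[v _ ->] pE u l sub]]].
by exists v, w.
Qed.

Lemma P_load e : e \in graph J -> load P e.1 + load P (swap e.1) <= e.2.
Proof.
rewrite PE; exact: (flow_load source_lt (@graph_uniq I) (@graph_bound I) (@graph_sym I)
  (@processors_uniq I T0) (@processors_bound I T0)).
Qed.

Lemma Q_load e : e \in graph J -> load Q e.1 + load Q (swap e.1) <= e.2.
Proof.
rewrite QE; exact: (flow_load source_lt (@graph_uniq I) (@graph_bound I) (@graph_sym I)
  (@demands_uniq I) (@demands_bound I)).
Qed.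

Lemma P_sink (v : 'I_n) : \sum_(p <- P) p.2 * (head 0 p.1 == n + v) <= (val v \in T0) * procn v.
Proof.
rewrite PE; set t := (val v, (val v, if val v \in T0 then procn v else 0)).
have tin : t \in processors I T0 by apply/mapP; exists v; rewrite ?mem_enum.
have := flow_sink_load source_lt (@graph_uniq I) (@graph_bound I) (@graph_sym I)
  (@processors_uniq I T0) (@processors_bound I T0) tin.
have -> : t.2.2 = (val v \in T0) * procn v by rewrite /t /=; case: (_ \in _); rewrite ?mul1n.
exact.
Qed.

Lemma Q_sink (i : 'I_(nd I)) : \sum_(q <- Q) q.2 * (head 0 q.1 == n + i) <= demn i.
Proof.
have tin : (val i, (val (dst i), demn i)) \in demands I by apply/mapP; exists i; rewrite ?mem_enum.
rewrite QE; exact: (flow_sink_load source_lt (@graph_uniq I) (@graph_bound I) (@graph_sym I)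
  (@demands_uniq I) (@demands_bound I) tin).
Qed.

Lemma keys_graph (u v : 'I_n) : ((val u, val v) \in [seq e.1 | e <- graph J]) = adj u v.
Proof.
apply/mapP/idP => [[e /graph_mem[u' [v' [uv ->]]] /= [/val_inj-> /val_inj->]] //|uv].
by exists ((val u, val v), capn [set u; v]%SET) => //; apply/graph_mem; exists u, v.
Qed.

Lemma traversals_joins (u v : 'I_n) (w : seq 'I_n) :
  traversals [set u; v]%SET w = count (joins (val u, val v)) (arcs (map val w)).
Proof.
case: w => // x w; elim: w x => // y w IH x.
rewrite traversals_cons IH map_cons [in RHS]map_cons arcs_cons /=; congr (nat_of_bool _ + _).
rewrite /joins /swap /= !xpair_eqE !(inj_eq val_inj).
apply/eqP/idP.
  move=> E; have := set21 x y; have := set22 x y; rewrite E !in_set2.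
  have := set21 u v; have := set22 u v; rewrite -E !in_set2.
  do !(case/orP => /eqP ?); subst; rewrite ?eqxx ?orbT //.
by case/orP => /andP[/eqP-> /eqP->] //; rewrite finset.setUC.
Qed.

Lemma touches_cons k x w : touches k w <= touches k (x :: w).
Proof.
case: w => [|y w]; first by rewrite /touches.
rewrite /touches arcs_cons !in_cons.
by apply: leq_add; [case: (k \in arcs _)|case: (swap k \in arcs _)]; rewrite ?orbT.
Qed.

Lemma out_triple p q : p \in P -> q \in Q -> exists t : triple I,
  [/\ val (tdemand t) = head 0 q.1 - order J, map val (twalk t) = route p.1 q.1,
      val (tvertex t) = head 0 p.1 - order J, valid_triple t &
      forall u v : 'I_n, traversals [set u; v]%SET (twalk t) <=
        2 * touches (val u, val v) p.1 + touches (val u, val v) q.1].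
Proof.
move=> /P_shape[v [wp [pE up lp Ep]]] /Q_shape[i [wq [qE uq lq Eq]]].
pose E k := k \in [seq e.1 | e <- graph J].
have symE k : E k -> E (swap k).
  by case/mapP => e /graph_sym eG ->; apply/mapP; exists (swap e.1, e.2).
have [w [rE pw lw vw [cw sw tw]]] := @route_spec s E symE (n + v) (n + i) v (dst i) wp wq up lp lq Ep Eq.
have bound (z : nat) r : z < n -> (forall k, k \in arcs (z :: r) -> E k) -> forall y, y \in z :: r -> y < n.
  move=> zn sub y; rewrite in_cons => /orP[/eqP->//|/(arcs_tails z)[k /sub/mapP[e /graph_bound[h _] ->] <-]].
  exact: h.
have wn y : y \in s :: w -> y < n.
  by move=> /sw; rewrite mem_cat => /orP[]; apply: bound.
have [W WE] : exists W : seq 'I_n, map val W = s :: w.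
  exists (pmap insub (s :: w)); rewrite pmap_filter; last exact: insubK.
  by apply/all_filterP/allP => y /wn yn; rewrite insubT.
have sz : size W <= 2 * n.
  rewrite -(size_map val) WE.
  have -> : size (s :: w) = \sum_(y : 'I_n) count_mem (val y) (s :: w).
    rewrite -WE; under eq_bigr do rewrite count_map.
    elim: (W) => [|x r IH] /=; first by rewrite big1.
    rewrite big_split /= -IH (bigD1 x) //= eqxx big1 ?addn0 // => y yx.
    by rewrite (inj_eq val_inj) eq_sym (negbTE yx).
  apply: (@leq_trans (\sum_(y : 'I_n) 2)); first by apply: leq_sum => y _; exact: cw.
  by rewrite sum_nat_const card_ord mulnC.
exists ((i, Bseq sz), v); split.
- by rewrite qE order_raw /= addKn.
- by rewrite /twalk /= WE pE qE.
- by rewrite pE order_raw /= addKn.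
- rewrite /valid_triple /tdemand /tvertex /twalk /=; apply/andP; split; last first.
    by rewrite -(mem_map val_inj) WE.
  case: W WE {sz} => // x W [xs WE]; apply/and4P; split.
  + by apply/eqP/val_inj; rewrite src_source.
  + move: pw; rewrite -WE -xs path_map; apply: sub_path => a b; rewrite /= /E keys_graph //.
  + by apply/eqP/val_inj; rewrite /= -last_map xs WE.
  + apply/forallP => u; have := cw (val u); rewrite -WE -xs -map_cons count_map.
    by apply: leq_trans; rewrite eq_leq //; apply: eq_count => y /=; rewrite (inj_eq val_inj).
move=> a b; rewrite /twalk /= traversals_joins WE.
apply: leq_trans (tw _) _; rewrite pE qE; apply: leq_add; last exact: touches_cons.
by rewrite leq_mul2l touches_cons.
Qed.
End Solution.

Section FlowSum.
Variables (R : realType) (T : finType) (den : nat) (l : seq (T * (nat * nat))).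
Hypothesis denE : forall x, x \in l -> x.2.2 = den.
Local Open Scope ring_scope.

Lemma sum_sparse (c : T -> nat) :
  \sum_t (\sum_(x <- l | x.1 == t) x.2.1%:R / x.2.2%:R) *+ c t =
  (\sum_(x <- l) x.2.1 * c x.1)%N%:R / den%:R :> R.
Proof.
rewrite natr_sum big_distrl /=.
transitivity (\sum_t \sum_(x <- l | x.1 == t) x.2.1%:R / x.2.2%:R *+ c x.1 : R).
  by apply: eq_bigr => t _; rewrite -sumrMnl; apply: eq_bigr => x /eqP->.
rewrite (exchange_big_dep xpredT) //= !big_seq; apply: eq_bigr => x xl.
rewrite (big_pred1 x.1) => [|t]; last by rewrite eq_sym.
by rewrite denE // -mulr_natr natrM mulrAC.
Qed.
End FlowSum.

(** * Feasibility and value of the output flow *)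

Section Output.
Variables (R : realType) (I : instance) (T0 : seq nat).
Hypothesis ss : single_source I.
Local Notation n := (nv I).
Local Notation J := (raw I).
Local Notation M := (flow_den J).
Local Notation P := (processing_paths J T0).
Local Notation Q := (demand_paths J).
Local Notation A := (flow_value P).
Local Notation D := (flow_value Q).

(** The maximum, with 1 instead of 0 to be a legal denominator; [norm_mul] survives this exception
    because the product vanishes then. *)
Definition norm (a d : nat) : nat := if a < d then d else if a == 0 then 1 else a.

Lemma norm_gt0 a d : 0 < norm a d.
Proof. by rewrite /norm; case: (ltnP a d) => [ad|_]; [lia|case: a]. Qed.

Lemma norm_ge a d : a <= norm a d /\ d <= norm a d.
Proof.
by rewrite /norm; case: (ltnP a d) => [ad|da]; [|case: eqP => a0]; split; lia.
Qed.

Lemma norm_mul a d : a * d = minn a d * norm a d.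
Proof.
rewrite /norm /minn; case: (ltnP a d) => // da; case: eqP => [a0|_]; last by rewrite mulnC.
by move: da; rewrite a0 leqn0 => /eqP->.
Qed.

Local Notation den := (3 * M * norm A D).

Lemma den_gt0 : 0 < den.
Proof. by rewrite !muln_gt0 flow_den_gt0 norm_gt0. Qed.

Definition out_entry (pq : (seq nat * nat) * (seq nat * nat)) : nat * (seq nat * (nat * (nat * nat))) :=
  (head 0 pq.2.1 - order J, (route pq.1.1 pq.2.1, (head 0 pq.1.1 - order J,
    (pq.1.2 * pq.2.2, den)))).

Definition represents (pq : (seq nat * nat) * (seq nat * nat)) (t : triple I) : Prop :=
  [/\ val (tdemand t) = head 0 pq.2.1 - order J, map val (twalk t) = route pq.1.1 pq.2.1,
      val (tvertex t) = head 0 pq.1.1 - order J, valid_triple t &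
      forall u v : 'I_n, traversals [set u; v]%SET (twalk t) <=
        2 * touches (val u, val v) pq.1.1 + touches (val u, val v) pq.2.1].

Variable z : seq (((seq nat * nat) * (seq nat * nat)) * triple I).
Hypothesis zE : map fst z = [seq (p, q) | p <- P, q <- Q].
Hypothesis zT : forall x, x \in z -> represents x.1 x.2.

Let l : seq (triple I * (nat * nat)) := [seq (x.2, (x.1.1.2 * x.1.2.2, den)) | x <- z].

Let denE x : x \in l -> x.2.2 = den.
Proof. by case/mapP => y _ ->. Qed.

Variable o : output I.
Hypothesis oE : o.2 = l.

Lemma sum_out_flow (c : triple I -> nat) :
  (\sum_t out_flow R o t *+ c t = (\sum_(x <- z) x.1.1.2 * x.1.2.2 * c x.2)%N%:R / den%:R)%R.
Proof.
rewrite -(big_map (fun x => (x.2, (x.1.1.2 * x.1.2.2, den))) xpredT (fun y => y.2.1 * c y.1)) -/l.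
by rewrite -(sum_sparse R denE); apply: eq_bigr => t _; rewrite ffunE oE.
Qed.

Lemma sum_pairs (F : (seq nat * nat) * (seq nat * nat) -> nat) :
  \sum_(x <- z) F x.1 = \sum_(p <- P) \sum_(q <- Q) F (p, q).
Proof. by rewrite -(big_map fst xpredT F) zE big_allpairs. Qed.

Lemma routed_out_flow : (routed (out_flow R o) = (minn A D)%:R / (3 * M)%:R)%R.
Proof.
transitivity (\sum_t out_flow R o t *+ (fun=> 1%N) t)%R; first by apply: eq_bigr.
rewrite sum_out_flow.
rewrite (eq_bigr (fun x : ((seq nat * nat) * (seq nat * nat)) * triple I => x.1.1.2 * x.1.2.2)); last first.
  by move=> x _; rewrite muln1.
rewrite (sum_pairs (fun pq => pq.1.2 * pq.2.2)) /=.
have -> : \sum_(p <- P) \sum_(q <- Q) p.2 * q.2 = A * D.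
  rewrite !flow_valueE big_distrl; apply: eq_bigr => p _ /=; by rewrite big_distrr.
rewrite norm_mul !natrM; have := flow_den_gt0 I; rewrite -(ltr0n R) => M0.
have := norm_gt0 A D; rewrite -(ltr0n R) => m0.
by field; rewrite !gt_eqF.
Qed.

(** Turns a capacity constraint into an inequality of integers: [F] bounds the coefficient of a
    triple by data of its two paths, and the double sum over pairs then factors. *)
Lemma flow_le (c : triple I -> nat) (F : (seq nat * nat) * (seq nat * nat) -> nat) Z (b : R) :
  (forall x, x \in z -> c x.2 <= F x.1) ->
  \sum_(p <- P) \sum_(q <- Q) p.2 * q.2 * F (p, q) <= 3 * norm A D * Z ->
  (Z%:R = M%:R * b)%R -> (\sum_t out_flow R o t *+ c t <= b)%R.
Proof.
move=> cF le Zb; rewrite sum_out_flow ler_pdivrMr ?ltr0n ?den_gt0 //.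
have -> : (b * den%:R = (3 * norm A D * Z)%:R)%R by rewrite !natrM Zb; ring.
rewrite ler_nat; apply: leq_trans le.
rewrite -(sum_pairs (fun pq => pq.1.2 * pq.2.2 * F pq)) big_seq [leqRHS]big_seq.
by apply: leq_sum => x /cF h; rewrite leq_mul2l h orbT.
Qed.

Let sum_P (f g : seq nat * nat -> nat) :
  \sum_(p <- P) \sum_(q <- Q) p.2 * q.2 * (f p + g q) =
  (\sum_(p <- P) p.2 * f p) * D + A * \sum_(q <- Q) q.2 * g q.
Proof.
rewrite !flow_valueE big_distrl big_distrl -big_split /=; apply: eq_bigr => p _.
by rewrite !big_distrr -big_split /=; apply: eq_bigr => q _; lia.
Qed.

Lemma load_touches K (k : arc) : \sum_(p <- K) p.2 * touches k p.1 = load K k + load K (swap k).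
Proof. by rewrite /load -big_split /=; apply: eq_bigr => p _; rewrite /touches mulnDr. Qed.

Lemma out_feasible (U : {set 'I_n}) : (forall v, (v \in U) = (val v \in T0)) ->
  feasible U (out_flow R o).
Proof.
move=> UT; have [An Dn] := norm_ge A D.
have sumP (C : pred (triple I)) : (\sum_(t | C t) out_flow R o t = \sum_t out_flow R o t *+ C t)%R.
  by rewrite big_mkcond; apply: eq_bigr => t _; case: (C t).
split.
- move=> t; rewrite ffunE; apply: sumr_ge0 => x _.
  by rewrite divr_ge0 // ler0n.
- move=> t nv; rewrite ffunE oE big_map big_seq_cond big1 // => x /andP[xz /eqP xt].
  by have [_ _ _ v _] := zT xz; rewrite /= in xt; rewrite -xt v in nv.
- move=> e eE; have /cards2P[u [v [uv eq]]] : #|e| == 2 by rewrite edges_card2.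
  have adjuv : adj u v by rewrite /adj -eq.
  rewrite eq; apply: (@flow_le _ (fun pq => 2 * touches (val u, val v) pq.1.1 + touches (val u, val v) pq.2.1)
    (capn [set u; v]%SET)); last exact: capnE.
    by move=> x /zT[].
  rewrite (sum_P (fun p => 2 * touches (val u, val v) p.1) (fun q => touches (val u, val v) q.1)).
  rewrite (eq_bigr (fun p : seq nat * nat => 2 * (p.2 * touches (val u, val v) p.1))); last first.
    by move=> p _; rewrite mulnCA.
  rewrite -big_distrr /= !load_touches.
  have eG : ((val u, val v), capn [set u; v]%SET) \in graph J by apply/graph_mem; exists u, v.
  have lP := P_load ss T0 eG; have lQ := Q_load ss eG; rewrite /= in lP lQ.
  (* Twice the load of the first flow plus once that of the second: this is where the 3 in the
     denominator is used up. *)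
  apply: (@leq_trans (2 * capn [set u; v]%SET * norm A D + norm A D * capn [set u; v]%SET)); last by lia.
  by apply: leq_add; apply: leq_mul => //; rewrite leq_mul2l lP.
- move=> v; rewrite sumP.
  apply: (@flow_le _ (fun pq => (head 0 pq.1.1 == n + v) + 0) ((val v \in T0) * procn v)).
  + move=> [[p q] t] xz; have [_ _ h _ _] := zT xz; rewrite addn0 /= in h *.
    have : (p, q) \in [seq (p, q) | p <- P, q <- Q] by rewrite -zE; apply/mapP; exists ((p, q), t).
    case/allpairsP => -[p' q'] /= [/(P_shape ss)[v' [w [pE _ _ _]]] _ [pp _]].
    rewrite pp pE /= in h *; rewrite order_raw addKn in h.
    by case: eqP => // tv; rewrite -tv h eqxx.
  + rewrite (sum_P (fun p => head 0 p.1 == n + v) (fun=> 0)) /=.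
    rewrite [X in _ + A * X]big1 ?muln0 ?addn0; last by move=> q _; rewrite muln0.
    apply: (@leq_trans (((val v \in T0) * procn v) * norm A D)); last by rewrite mulnC leq_mul2r leq_pmull ?orbT.
    by apply: leq_mul => //; exact: P_sink.
  + rewrite natrM procnE UT; case: (val v \in T0) => /=; first by rewrite mul1r.
    by rewrite mul0r mulr0.
- move=> i; rewrite sumP.
  apply: (@flow_le _ (fun pq => 0 + (head 0 pq.2.1 == n + i)) (demn i)); last exact: demnE.
  + move=> [[p q] t] xz; have [h _ _ _ _] := zT xz; rewrite add0n /= in h *.
    have : (p, q) \in [seq (p, q) | p <- P, q <- Q] by rewrite -zE; apply/mapP; exists ((p, q), t).
    case/allpairsP => -[p' q'] /= [_ /(Q_shape ss)[v' [w [qE _ _ _]]] [_ qq]].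
    rewrite qq qE /= in h *; rewrite order_raw addKn in h.
    by case: eqP => // tv; rewrite -tv h eqxx.
  + rewrite (sum_P (fun=> 0) (fun q => head 0 q.1 == n + i)) /=.
    rewrite [X in X * D + _]big1 ?mul0n ?add0n; last by move=> q _; rewrite muln0.
    apply: (@leq_trans (norm A D * demn i)); last by rewrite leq_mul2r leq_pmull ?orbT.
    by apply: leq_mul => //; exact: Q_sink.
Qed.
End Output.

Section Approximation.
Variables (R : realType) (I : instance).
Hypothesis ss : single_source I.
Local Notation n := (nv I).
Local Notation J := (raw I).
Local Notation M := (flow_den J).
Local Notation A := (flow_value (processing_paths J (purchase J))).
Local Notation D := (flow_value (demand_paths J)).

Lemma purchase_correct (O : seq nat) :
  {subset O <= [seq x.1 | x <- items J]} -> weight J O <= limit J ->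
  [/\ {subset purchase J <= [seq x.1 | x <- items J]}, weight J (purchase J) <= limit J &
      capture J O <= 4 * capture J (purchase J)].
Proof.
move=> Oi Oc; apply: purchase_spec => //.
- exact: (capture_mono (source_lt ss)).
- exact: (capture_submod (source_lt ss)).
- exact: items_uniq.
Qed.

Lemma optimum_le (T : {set 'I_n}) (p : {ffun triple I -> R}) : is_solution T p ->
  (M%:R * routed p <= (4 * minn A D)%N%:R)%R.
Proof.
move=> [aff fp]; set O := [seq val v | v <- enum T].
have Oi : {subset O <= [seq x.1 | x <- items J]}.
  by move=> x /mapP[v _ ->]; rewrite itemsE -map_comp map_f // mem_enum.
have OT v : (v \in T) = (val v \in O) by rewrite mem_map ?mem_enum //; exact: val_inj.
have [_ _ le4] := purchase_correct Oi (proj1 (weight_affordable R OT) aff).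
have srcS (S : pred nat) : valid n (source J) S -> forall i : 'I_(nd I), S (val (src i)).
  by move=> [Ss _] i; rewrite (src_source ss).
have leA : (M%:R * routed p <= (4 * A)%N%:R)%R.
  have [S vS leS] := capture_min (source_lt ss) O.
  apply: le_trans (routed_le_processing fp (srcS S vS)) _.
  by rewrite ler_nat (leq_trans leS).
have leD : (M%:R * routed p <= D%:R)%R.
  have [S vS leS] := flow_value_min (source_lt ss) (@graph_uniq I) (@graph_bound I) (@graph_sym I)
    (@demands_uniq I) (@demands_bound I).
  apply: le_trans (routed_le_demand fp (srcS S vS)) _.
  by rewrite ler_nat QE.
rewrite /minn; case: ltnP => // _; apply: le_trans leD _.
by rewrite ler_nat leq_pmull.
Qed.

Lemma approximation (o : output I) :
  routed (out_flow R o) = ((minn A D)%:R / (3 * M)%:R)%R ->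
  (((1 - (expR 1)^-1) / 8)%:E * opt_value R I <= (routed (out_flow R o))%:E)%E.
Proof.
move=> ->; set v := (_ / _)%R.
have c1 : ((1 - (expR 1)^-1) / 8 <= 1 / 12 :> R)%R by have := expR1_inv_ge R; lra.
have c0 : (0 <= (1 - (expR 1)^-1) / 8 :> R)%R.
  by apply: divr_ge0 => //; rewrite subr_ge0 -expRN expR_le1; lra.
have v0 : (0 <= v)%R by rewrite divr_ge0.
have M0 : (0 < M%:R :> R)%R by rewrite ltr0n flow_den_gt0.
have vE : (v * 12 * M%:R = (4 * minn A D)%N%:R)%R.
  by rewrite /v !natrM; field; rewrite gt_eqF.
have opt : (opt_value R I <= (v * 12)%:E)%E.
  apply: ge_ereal_sup => _ [T [p [sol ->]]]; rewrite lee_fin.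
  by rewrite -(ler_pM2r M0) vE [leLHS]mulrC; exact: optimum_le sol.
apply: (@le_trans _ _ (((1 - (expR 1)^-1) / 8)%:E * (v * 12)%:E)%E).
  by apply: lee_wpmul2l; rewrite ?lee_fin.
rewrite -EFinM lee_fin.
by apply: (@le_trans _ _ (1 / 12 * (v * 12))%R); [rewrite ler_wpM2r // mulr_ge0|lra].
Qed.

Lemma algorithm_output : exists o : output I, enc (algorithm J) = enc_output o /\
  [/\ out_wf o, is_solution (out_set o) (out_flow R o) &
   (((1 - (expR 1)^-1) / 8)%:E * opt_value R I <= (routed (out_flow R o))%:E)%E].
Proof.
set T0 := purchase J; set P := processing_paths J T0; set Q := demand_paths J.
(* Compared with the empty purchase, only to learn that the purchase is affordable and consists of
   vertices. *)
have [Ti Tc _] : [/\ {subset T0 <= [seq x.1 | x <- items J]}, weight J T0 <= limit J &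
   capture J [::] <= 4 * capture J T0].
  by apply: purchase_correct => //; rewrite /weight big1.
have [W WE] : exists W : seq 'I_n, map val W = T0.
  exists (pmap insub T0); rewrite pmap_filter; last exact: insubK.
  apply/all_filterP/allP => x /Ti; rewrite itemsE -map_comp => /mapP[v _ ->].
  by rewrite /= insubT.
have [z zE zT] : exists2 z : seq (((seq nat * nat) * (seq nat * nat)) * triple I),
    map fst z = [seq (p, q) | p <- P, q <- Q] & forall x, x \in z -> represents x.1 x.2.
  by apply: lift_seq => _ /allpairsP[[p q] [/= pP qQ ->]]; exact: (out_triple ss pP qQ).
pose o : output I := (W, [seq (x.2, (x.1.1.2 * x.1.2.2, 3 * M * norm A D)) | x <- z]).
have UT v : (v \in out_set o) = (val v \in T0) by rewrite finset.in_set -WE mem_map //; exact: val_inj.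
exists o; split.
  have algE : (algorithm J).2 = [seq out_entry I T0 pq | pq <- [seq (p, q) | p <- P, q <- Q]].
    by rewrite map_allpairs.
  have -> : algorithm J = (T0, (algorithm J).2) by [].
  rewrite algE -zE /enc_output; congr Node.
    by rewrite -WE; apply: enc_seq_map.
  rewrite /o /= /enc /encodable_seq.
  elim: (z) zT => //= x k IH kT; congr Node; last by apply: IH => y yk; apply: kT; rewrite in_cons yk orbT.
  have [hd hw hv _ _] := kT x (mem_head _ _).
  rewrite /out_entry -hd -hw -hv; congr Node; congr Node.
  by symmetry; rewrite /enc /encodable_seq; elim: (twalk x.2) => //= y r ->.
split.
- by apply/allP => _ /mapP[x _ ->] /=; rewrite den_gt0.
- split; first exact: (proj2 (weight_affordable R UT) Tc).
  by apply: (@out_feasible R I T0 ss z zE zT o erefl).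
- by apply: approximation; exact: (@routed_out_flow R I T0 z zE o erefl).
Qed.

End Approximation.

Theorem theorem12 (R : realType) :
  polytime_solvable enc_instance enc_output single_source
    (fun (I : instance) (o : output I) =>
       [/\ out_wf o,
           is_solution (out_set o) (out_flow R o)
         & (((1 - (expR 1)^-1) / 8)%:E * opt_value R I
              <= (routed (out_flow R o))%:E)%E]).
Proof.
have [c [m [h [[d hd] H]]]] := polytime_algorithm.
exists c, (('X + 1%:P) ^+ d)%R => I ss.
have [out [outE good]] := algorithm_output R ss.
have [k [s [ex le [s0 _]]]] := H (input_store (enc_instance I)) (raw I) (esym (enc_raw I)).
exists k, s, out; split=> //; last by rewrite s0.
apply: leq_trans le _; apply: leq_trans (hd _) _.
by rewrite horner_exp hornerD hornerX hornerC /esize enc_raw natrXE natrDE natr1E addn1.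
Qed.
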